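(* Let $m>0$ and $W\in L^2_{\mathrm{loc}}(\mathbb R^n,\mathbb R)$. Let $\mathcal W(\mathbb R^n):=H^1(\mathbb R^n)\cap\operatorname{dom}W$, equipped with the inner product $$\langle f,g\rangle_{\mathcal W}:=\int_{\mathbb R^n}\nabla f\cdot\overline{\nabla g}\,dx+\int_{\mathbb R^n}W^2f\overline g\,dx+\int_{\mathbb R^n}f\overline g\,dx,$$ and let $$\operatorname{dom}S_0:=\{f\in\mathcal W(\mathbb R^n):(\Delta-W^2)f\in L^2(\mathbb R^n)\},\qquad\operatorname{dom}\mathcal A_0:=\operatorname{dom}S_0\times\mathcal W(\mathbb R^n).$$ Let $\mathcal A_0$ be the operator in $\mathcal W(\mathbb R^n)\oplus L^2(\mathbb R^n)$ with domain $\operatorname{dom}\mathcal A_0$ acting as $$\begin{pmatrix}0&I\\-\Delta+m^2+W^2&2\mathrm iW\end{pmatrix},$$ and, for $\lambda\in\mathbb C\setminus\{0\}$, let $S_0(\lambda)$ be the operator in $L^2(\mathbb R^n)$ with ($\lambda$-independent) domain $\operatorname{dom}S_0$ acting as $\frac1\lambda\big(-\Delta+m^2+(W+\lambda\mathrm i)^2\big)$. Then $\mathcal A_0$ is closed with $0\in\rho(\mathcal A_0)$ and its domain is dense in $\mathcal W(\mathbb R^n)\oplus\mathcal W(\mathbb R^n)$ and in $\mathcal W(\mathbb R^n)\oplus L^2(\mathbb R^n)$. Moreover, the (point and essential) spectra of $\mathcal A_0$ and $S_0(\cdot)$ are equivalent, more precisely, $$\sigma(\mathcal A_0)=\sigma(S_0(\cdot)),\qquad\sigma_{\mathrm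 p}(\mathcal A_0)=\sigma_{\mathrm p}(S_0(\cdot)),\qquad\sigma_{\mathrm{e2}}(\mathcal A_0)=\sigma_{\mathrm{e2}}(S_0(\cdot)).$$
   Context: $\operatorname{dom}W$ is the maximal domain of multiplication by $W$ in $L^2(\mathbb R^n)$. All differential expressions are understood in the standard distributional sense. $\rho,\sigma,\sigma_{\mathrm p}$ are resolvent set, spectrum and point spectrum; $\sigma_{\mathrm{e2}}(T)$ is the set of $\lambda\in\mathbb C$ such that $T-\lambda$ is not a closed operator with closed range and finite-dimensional kernel. For the family, $\sigma(S_0(\cdot))=\{\lambda\in\mathbb C\setminus\{0\}:0\in\sigma(S_0(\lambda))\}$, and analogously for $\sigma_{\mathrm p}$, $\sigma_{\mathrm{e2}}$. *)

(* Defs.v *)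
From HB Require Import structures.
From mathcomp Require Import all_boot all_order all_algebra.
From mathcomp Require Import generic_quotient ring_quotient.
From mathcomp Require Import complex.
From mathcomp Require Import all_classical all_reals all_analysis.

Set Implicit Arguments.
Unset Strict Implicit.
Unset Printing Implicit Defensive.

Import Order.TTheory GRing.Theory Num.Theory.
Import numFieldNormedType.Exports.

Local Open Scope classical_set_scope.
Local Open Scope ring_scope.
Local Open Scope complex_scope.
Local Open Scope quotient_scope.
Local Open Scope measure_display_scope.

Local Notation Re := (@complex.Re _).
Local Notation Im := (@complex.Im _).

(* R^n carries the product sigma-algebra of the Borel sigma-algebra of R, that
   is, its own Borel sigma-algebra. *)
Definition rV_coord (R : realType) n (i : 'I_n) (x : 'rV[R]_n) : R := x ord0 i.

Section measurable_rV.
Variables (R : realType) (n : nat).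

Let rV_set0 : g_sigma_preimage (@rV_coord R n) set0.
Proof. exact: sigma_algebra0. Qed.

Let rV_setC A :
  g_sigma_preimage (@rV_coord R n) A -> g_sigma_preimage (@rV_coord R n) (~` A).
Proof. exact: sigma_algebraC. Qed.

Let rV_bigcup (F : (set 'rV[R]_n)^nat) :
  (forall i, g_sigma_preimage (@rV_coord R n) (F i)) ->
  g_sigma_preimage (@rV_coord R n) (\bigcup_i (F i)).
Proof. exact: sigma_algebra_bigcup. Qed.

HB.instance Definition _ :=
  @isMeasurable.Build (measure_tuple_display R.-ocitv.-measurable.-sigma)
    'rV[R]_n (g_sigma_preimage (@rV_coord R n)) rV_set0 rV_setC rV_bigcup.

End measurable_rV.

Lemma measurable_rV_coord (R : realType) n (i : 'I_n) :
  measurable_fun [set: 'rV[R]_n] (@rV_coord R n i).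
Proof.
move=> _ Y mY; rewrite setTI; apply: sub_sigma_algebra => /=.
rewrite -bigcup_seq/=; exists i => /=; first by rewrite mem_index_enum.
by exists Y => //; rewrite setTI.
Qed.

Lemma measurable_fun_rVP d (T : measurableType d) (R : realType) n
    (f : T -> 'rV[R]_n) :
  (forall i, measurable_fun [set: T] (@rV_coord R n i \o f)) ->
  measurable_fun [set: T] f.
Proof.
move=> mf.
have sub : g_sigma_preimage (fun i => @rV_coord R n i \o f) `<=` measurable.
  apply: smallest_sub; first exact: sigma_algebra_measurable.
  case: n => [|n] in f mf *; first by rewrite big_ord0.
  rewrite -bigcup_mkord_ord; apply: bigcup_sub => i Ii.
  by move=> A [B mB <-]; exact: mf.
by rewrite g_sigma_preimage_comp in sub => _ A mA; apply: sub; exists A.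
Qed.

Definition rV_cons (R : realType) n (p : R * 'rV[R]_n) : 'rV[R]_n.+1 :=
  row_mx p.1%:M p.2.

Definition rV_uncons (R : realType) n (x : 'rV[R]_n.+1) : R * 'rV[R]_n :=
  (x ord0 ord0, \row_i x ord0 (lift ord0 i)).

Section rV_cons.
Variables (R : realType) (n : nat).

Lemma rV_cons0 (p : R * 'rV[R]_n) : rV_cons p ord0 ord0 = p.1.
Proof.
rewrite /rV_cons mxE; case: splitP => [j _|k] //=.
by rewrite !ord1 mxE eqxx.
Qed.

Lemma rV_consS (p : R * 'rV[R]_n) i : rV_cons p ord0 (lift ord0 i) = p.2 ord0 i.
Proof.
rewrite /rV_cons mxE; case: splitP => [j|k] /=.
  by rewrite ord1 /bump.
by rewrite /bump leq0n => -[ik]; congr (p.2 _ _); apply: val_inj.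
Qed.

Lemma rV_consK : cancel (@rV_cons R n) (@rV_uncons R n).
Proof.
move=> [a v]; congr pair; first by rewrite rV_cons0.
by apply/rowP => i; rewrite mxE rV_consS.
Qed.

Lemma measurable_rV_cons : measurable_fun setT (@rV_cons R n).
Proof.
apply: measurable_fun_rVP => i; have [j ->|->] := unliftP ord0 i.
  rewrite (_ : _ \o _ = rV_coord j \o snd).
    by apply: measurableT_comp => //; exact: measurable_rV_coord.
  by apply/funext => p; rewrite /= /rV_coord rV_consS.
rewrite (_ : _ \o _ = fst)//.
by apply/funext => p; rewrite /= /rV_coord rV_cons0.
Qed.

Lemma measurable_rV_uncons : measurable_fun setT (@rV_uncons R n).
Proof.
apply/measurable_fun_pairP; split.
  exact: (measurable_rV_coord ord0).
apply: measurable_fun_rVP => i.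
rewrite (_ : _ \o _ = rV_coord (lift ord0 i)); first exact: measurable_rV_coord.
by apply/funext => x; rewrite /= /rV_coord mxE.
Qed.

End rV_cons.

Section lebesgue_rV.
Variable R : realType.
Local Open Scope ereal_scope.

Section lebesgue_rVS.
Variables (n : nat) (mu : {sigma_finite_measure set 'rV[R]_n -> \bar R}).

Definition lebesgue_rVS : set 'rV[R]_n.+1 -> \bar R :=
  pushforward (@lebesgue_measure R \x mu) (@rV_cons R n).

Let lebesgue_rVS0 : lebesgue_rVS set0 = 0.
Proof. by rewrite /lebesgue_rVS /pushforward preimage_set0 measure0. Qed.

Let lebesgue_rVS_ge0 A : 0 <= lebesgue_rVS A.
Proof. by rewrite /lebesgue_rVS /pushforward measure_ge0. Qed.

Let lebesgue_rVS_sigma_additive : semi_sigma_additive lebesgue_rVS.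
Proof.
exact: (@measure_semi_sigma_additive _ _ _
  (measure_function_pushforward__canonical__measure_function_Measure
    (@lebesgue_measure R \x mu) (@measurable_rV_cons R n))).
Qed.

HB.instance Definition _ := isMeasure.Build _ _ _ lebesgue_rVS
  lebesgue_rVS0 lebesgue_rVS_ge0 lebesgue_rVS_sigma_additive.

Let lebesgue_rVS_sigma_finite : sigma_finite setT lebesgue_rVS.
Proof.
have /sigma_finiteP[F [TF ndF Foo]] := sigma_finiteT (@lebesgue_measure R).
have /sigma_finiteP[G [TG ndG Goo]] := sigma_finiteT mu.
exists (fun k => @rV_uncons R n @^-1` (F k `*` G k)) => [|k].
  rewrite -preimage_bigcup (_ : \bigcup_k _ = setT) ?preimage_setT//.
  apply/seteqP; split=> // -[x y] _.
  have [[i _ Fx] [j _ Gy]] : (\bigcup_k F k) x /\ (\bigcup_k G k) y.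
    by rewrite -TF -TG.
  exists (maxn i j) => //; split.
  - by move: x Fx; exact/subsetPset/ndF/leq_maxl.
  - by move: y Gy; exact/subsetPset/ndG/leq_maxr.
have [[mF Fk] [mG Gk]] := (Foo k, Goo k); split.
  rewrite -[X in measurable X]setTI; apply: measurable_rV_uncons => //.
  exact: measurableX.
rewrite /lebesgue_rVS /pushforward -comp_preimage.
rewrite (_ : _ \o _ = id); last by apply/funext => p; exact: rV_consK.
by rewrite preimage_id product_measure1E// lte_mul_pinfty// ge0_fin_numE.
Qed.

HB.instance Definition _ := Measure_isSigmaFinite.Build _ _ _ lebesgue_rVS
  lebesgue_rVS_sigma_finite.

End lebesgue_rVS.

Fixpoint lebesgue_rV n : {sigma_finite_measure set 'rV[R]_n -> \bar R} :=
  match n with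
  | 0%N => \d_ (0%R : 'rV[R]_0)
  | k.+1 => lebesgue_rVS (lebesgue_rV k)
  end.

End lebesgue_rV.

Section L2.
Context d (T : measurableType d) (R : realType).
Variable mu : {measure set T -> \bar R}.

Definition cintegral (f : T -> R[i]) : R[i] :=
  (\int[mu]_x Re (f x)) +i* (\int[mu]_x Im (f x)).

(* Since |f|^2 = (Re f)^2 + (Im f)^2, these are the measurable f with |f|^2
   integrable. *)
Definition cLfun2 : {pred T -> R[i]} :=
  [pred f | (Re \o f \in Lfun mu 2%:E)
         && (Im \o f \in Lfun mu 2%:E)].

Lemma cLfun2_submod_closed : submod_closed cLfun2.
Proof.
have pD : submod_closed (Lfun mu 2%:E) := Lfun_submod_closed mu (lee1n 2).
have Z a (f : T -> R) : f \in Lfun mu 2%:E -> a *: f \in Lfun mu 2%:E.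
  by move=> fL; rewrite -[a *: f]addr0 pD.2// pD.1.
have D (f g : T -> R) : f \in Lfun mu 2%:E -> g \in Lfun mu 2%:E ->
    f + g \in Lfun mu 2%:E.
  by move=> fL gL; rewrite -[f]scale1r pD.2.
split=> [|a f g].
  by rewrite inE; apply/andP; split; exact: pD.1.
rewrite !inE => /andP[fr fi] /andP[gr gi]; apply/andP; split.
  rewrite (_ : _ \o _ = Re a *: (Re \o f)
    + (- Im a) *: (Im \o f) + (Re \o g)).
    by apply: (D) => //; apply: (D); exact: Z.
  apply/funext => x; rewrite /= !fctE /=.
  case: a (f x) (g x) => [a1 a2] [f1 f2] [g1 g2] /=.
  by rewrite scaleNr.
rewrite (_ : _ \o _ = Re a *: (Im \o f)
  + Im a *: (Re \o f) + (Im \o g)).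
  by apply: (D) => //; apply: (D); exact: Z.
apply/funext => x; rewrite /= !fctE /=.
by case: a (f x) (g x) => [a1 a2] [f1 f2] [g1 g2].
Qed.

HB.instance Definition _ := GRing.isSubmodClosed.Build _ _ cLfun2
  cLfun2_submod_closed.

Record cLfun2Type := CLfun2 { cLfun2_fun :> T -> R[i]; _ : cLfun2_fun \in cLfun2 }.

HB.instance Definition _ := [isSub for cLfun2_fun].
HB.instance Definition _ := [Choice of cLfun2Type by <:].
HB.instance Definition _ := [SubChoice_isSubLmodule of cLfun2Type by <:].

Definition ae_null : {pred cLfun2Type} :=
  [pred f : cLfun2Type | `[< {ae mu, forall x, f x = 0} >]].

Lemma ae_null_zmod_closed : zmod_closed ae_null.
Proof.
split=> [|f g]; first by apply/asboolP; exact: nearW.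
move=> /asboolP f0 /asboolP g0; apply/asboolP; near=> x.
have -> : (f - g) x = f x - g x by [].
by rewrite (near f0 x)// (near g0 x)// subrr.
Unshelve. all: by end_near.
Qed.

HB.instance Definition _ := GRing.isZmodClosed.Build _ ae_null
  ae_null_zmod_closed.

Definition L2 := Quotient.quot ae_null.

HB.instance Definition _ := GRing.Zmodule.on L2.
HB.instance Definition _ := EqQuotient.on L2.

Definition L2_scale (a : R[i]) (f : L2) : L2 := \pi_L2 (a *: repr f).

Lemma L2_piZ a (f : cLfun2Type) : L2_scale a (\pi_L2 f) = \pi_L2 (a *: f).
Proof.
apply/eqP; rewrite -Quotient.idealrBE -scalerBr.
have : \pi_L2 (repr (\pi_L2 f)) == \pi_L2 f by rewrite reprK.
rewrite -Quotient.idealrBE => /asboolP g0; apply/asboolP; near=> x.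
rewrite (_ : (_ *: _ : cLfun2Type) x = a * (repr (\pi_L2 f) - f) x)//.
by rewrite (near g0 x)// mulr0.
Unshelve. all: by end_near.
Qed.

Let L2_scalerA a b (f : L2) : L2_scale a (L2_scale b f) = L2_scale (a * b) f.
Proof.
rewrite -(reprK f); move: (repr f) => g.
by rewrite (L2_piZ b g) (L2_piZ a (b *: g)) (L2_piZ (a * b) g) scalerA.
Qed.

Let L2_scale1r : left_id 1 L2_scale.
Proof.
by move=> f; rewrite -(reprK f); move: (repr f) => g; rewrite L2_piZ scale1r.
Qed.

Let L2_scalerDr : right_distributive L2_scale +%R.
Proof.
move=> a f g; rewrite -(reprK f) -(reprK g).
by move: (repr f) (repr g) => u v; rewrite -raddfD !L2_piZ scalerDr raddfD.
Qed.

Let L2_scalerDl (f : L2) : {morph L2_scale^~ f : a b / a + b}.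
Proof.
move=> a b; rewrite -(reprK f); move: (repr f) => g.
by rewrite !L2_piZ scalerDl raddfD.
Qed.

HB.instance Definition _ := GRing.Zmodule_isLmodule.Build R[i] L2
  L2_scalerA L2_scale1r L2_scalerDr L2_scalerDl.

(* A representative; everything below is invariant under a.e. equality. *)
Definition L2_fun (f : L2) : T -> R[i] := cLfun2_fun (repr f).

Definition L2_inner (f g : L2) : R[i] :=
  cintegral (fun x => L2_fun f x * (L2_fun g x)^*%C).

End L2.
Coercion L2_fun : L2 >-> Funclass.

(* A complex inner product space, given as a subspace [carrier] of an ambient
   vector space, so that spaces with different inner products (such as H^1 and
   L^2) can share their vectors. The inner product is linear in its first
   argument and its values outside [carrier] are irrelevant. *)
Record innerSpace (R : realType) := InnerSpace {
  ambient :> lmodType R[i];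
  carrier : set ambient;
  inner : ambient -> ambient -> R[i]
}.
Arguments carrier {R} _.
Arguments inner {R} _ _ _.

Section operators.
Variable R : realType.
Implicit Types X Y H : innerSpace R.

Definition hnorm X (x : X) : R := Num.sqrt (Re (inner X x x)).
Arguments hnorm X x : clear implicits.

Definition hcvg X (u : nat -> X) (x : X) : Prop :=
  (fun k => hnorm X (u k - x)) @ \oo --> (0 : R).
Arguments hcvg X u x : clear implicits.

Definition hdense X (D : set X) : Prop :=
  D `<=` carrier X /\
  forall x, carrier X x -> forall e : R, 0 < e ->
    exists2 y, D y & hnorm X (x - y) < e.
Arguments hdense X D : clear implicits.

Definition direct_sum X Y : innerSpace R :=
  @InnerSpace R (X * Y)%type (carrier X `*` carrier Y)
    (fun p q => inner X p.1 q.1 + inner Y p.2 q.2).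

(* Only the values of [act] on [dom] are meaningful. *)
Record operator H := Operator { dom : set H; act :> H -> H }.

Definition op_minus H (T : operator H) (l : R[i]) : operator H :=
  Operator (dom T) (fun x => T x - l *: x).

Definition closed_operator H (T : operator H) : Prop :=
  forall (u : nat -> H) (x y : H), (forall k, dom T (u k)) ->
    carrier H x -> carrier H y ->
    hcvg H u x -> hcvg H (fun k => T (u k)) y ->
    dom T x /\ T x = y.

Definition closed_range H (T : operator H) : Prop :=
  forall (u : nat -> H) (y : H), (forall k, dom T (u k)) -> carrier H y ->
    hcvg H (fun k => T (u k)) y -> exists2 x, dom T x & T x = y.

Definition op_kernel H (T : operator H) : set H := [set x | dom T x /\ T x = 0].

Definition finite_dimensional (V : lmodType R[i]) (A : set V) : Prop :=
  exists (k : nat) (b : 'I_k -> V),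
    forall x, A x -> exists c : 'I_k -> R[i], x = \sum_i c i *: b i.

Definition resolvent_set H (T : operator H) : set R[i] :=
  [set l | set_bij (dom T) (carrier H) (op_minus T l) /\
    exists C : R, forall x, dom T x -> hnorm H x <= C * hnorm H (op_minus T l x)].

Definition spectrum H (T : operator H) : set R[i] := ~` resolvent_set T.

Definition point_spectrum H (T : operator H) : set R[i] :=
  [set l | exists2 x, x != 0 & op_kernel (op_minus T l) x].

Definition essential_spectrum2 H (T : operator H) : set R[i] :=
  [set l | ~ [/\ closed_operator (op_minus T l), closed_range (op_minus T l)
               & finite_dimensional (op_kernel (op_minus T l))]].

Definition family_spectrum (sp : forall H, operator H -> set R[i])
    H (S : R[i] -> operator H) : set R[i] :=
  [set l | l != 0 /\ sp H (S l) 0].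

End operators.
Arguments hnorm {R} X x.
Arguments hcvg {R} X u x.
Arguments hdense {R} X D.
Arguments spectrum {R} H T.
Arguments point_spectrum {R} H T.
Arguments essential_spectrum2 {R} H T.

Section distributions.
Variables (R : realType) (n : nat).
Local Notation E := 'rV[R]_n.
Local Notation mu := (lebesgue_rV R n).

Definition partial (i : 'I_n) (phi : E -> R) : E -> R :=
  'D_(delta_mx ord0 i) phi.

Definition smooth (phi : E -> R) : Prop :=
  forall s : seq 'I_n, continuous (foldr partial phi s) /\
    forall i x, derivable (foldr partial phi s) x (delta_mx ord0 i).

Definition test_function (phi : E -> R) : Prop :=
  smooth phi /\ compact (closure [set x | phi x != 0]).

(* Complex distributions are represented by their values at real test
   functions, which determine them by C-linearity. The values at functions that
   are not test functions are irrelevant. *)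
Definition Distribution : Type := (E -> R) -> R[i].

HB.instance Definition _ := GRing.Lmodule.on Distribution.

(* Meaningful for locally integrable u. *)
Definition regular_dist (u : E -> R[i]) : Distribution :=
  fun phi => cintegral mu (fun x => u x * (phi x)%:C).

Definition dpartial (i : 'I_n) (T : Distribution) : Distribution :=
  fun phi => - T (partial i phi).

Definition laplacian (T : Distribution) : Distribution :=
  \sum_i dpartial i (dpartial i T).

Definition represents (T : Distribution) (h : L2 mu) : Prop :=
  forall phi, test_function phi -> T phi = regular_dist h phi.

Definition in_L2 (T : Distribution) : Prop := exists h, represents T h.

(* The square-integrable function h with T = h, meaningful when [in_L2 T]; h is
   then unique. *)
Definition dist_L2 (T : Distribution) : L2 mu := xget 0 (represents T).

Definition L2_loc (W : E -> R) : Prop :=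
  measurable_fun setT W /\
  forall K, compact K -> (\int[mu]_(x in K) (W x ^+ 2)%:E < +oo)%E.

Definition H1 : set (L2 mu) :=
  [set f : L2 mu | forall i, in_L2 (dpartial i (regular_dist f))].

Definition weak_partial (i : 'I_n) (f : L2 mu) : L2 mu :=
  dist_L2 (dpartial i (regular_dist f)).

Definition L2_space : innerSpace R :=
  @InnerSpace R (L2 mu) setT (@L2_inner _ _ _ mu).

End distributions.
Arguments L2_space : clear implicits.

Section operator_matrix.
Variables (R : realType) (n : nat) (m : R) (W : 'rV[R]_n -> R).
Local Notation mu := (lebesgue_rV R n).

Definition dom_mul : set (L2 mu) :=
  [set f : L2 mu | (fun x => (W x)%:C * f x) \in cLfun2 mu].

(* For f in H^1, [weak_partial i f] is the i-th weak derivative of f. *)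
Definition W_inner (f g : L2 mu) : R[i] :=
  cintegral mu (fun x => \sum_i weak_partial i f x * (weak_partial i g x)^*%C)
  + cintegral mu (fun x => (W x ^+ 2)%:C * f x * (g x)^*%C)
  + cintegral mu (fun x => f x * (g x)^*%C).

Definition W_space : innerSpace R :=
  @InnerSpace R (L2 mu) (@H1 R n `&` dom_mul) W_inner.

(* If f and W f are in L^2 and W is in L^2_loc, then W^2 f = W (W f) is locally
   integrable, so that it is a distribution; the same holds for the other
   potential terms below. *)
Definition dom_S0 : set (L2 mu) :=
  [set f : L2 mu | carrier W_space f /\
    in_L2 (laplacian (regular_dist f) - regular_dist (fun x => (W x ^+ 2)%:C * f x))].

Definition A0 : operator (direct_sum W_space (L2_space R n)) :=
  @Operator R (direct_sum W_space (L2_space R n))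
    (dom_S0 `*` carrier W_space)
    (fun p : L2 mu * L2 mu => (p.2, dist_L2
       (- laplacian (regular_dist p.1) + (m ^+ 2)%:C *: regular_dist p.1
        + regular_dist (fun x => (W x ^+ 2)%:C * p.1 x)
        + regular_dist (fun x => 2 * 'i%C * (W x)%:C * p.2 x)))).

Definition S0 (l : R[i]) : operator (L2_space R n) :=
  @Operator R (L2_space R n) dom_S0
    (fun f : L2 mu => dist_L2
       (l^-1 *: (- laplacian (regular_dist f) + (m ^+ 2)%:C *: regular_dist f
        + regular_dist (fun x => ((W x)%:C + l * 'i%C) ^+ 2 * f x)))).

End operator_matrix.

(* Main.v *)
(* With L = -Delta + m^2 + W^2, the form a(u, v) = <grad u, grad v> + <W u, W v>
   + m^2 <u, v> gives a norm on H^1 /\ dom W equivalent to the given one, which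
   is complete because weak derivatives and multiplication by W are closed; so
   the Riesz theorem produces, for every f in L^2, some u in dom S0 with
   L u = f and a(u, v) = <f, v> for all v. Conversely every u in dom S0 satisfies
   the latter with f = L u, because L is injective. Injectivity is the crux, as
   the weak equation may a priori only be tested with smooth compactly supported
   functions. A solution u of L u = 0 is tested with chi(x / r) atan(u_k), where
   u_k is a mollification of u: as atan is bounded, dominated convergence along an
   a.e. convergent subsequence copes with the L^1 term W^2 u, the gradient term
   has a nonnegative limit inferior because atan is increasing, and r -> oo leaves
   m^2 \int u atan u <= 0.

   Density follows from orthogonality: a vector orthogonal to dom S0 for the form
   with m = 1 is orthogonal to the range of L, which is L^2.

   The spectra are compared through P(l) = L + 2 i l W - l^2 = l S0(l): the first
   row of (A0 - l)(x, y) = (f, g) gives y = l x + f, and the second one becomes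
   P(l) x = g - (2 i W - l) f, where W is bounded from H^1 /\ dom W to L^2. *)

(* The obstacle is that [W] is merely in L^2_loc. If [u] and [W u] are in L^2, the mollifications
   [u_k] converge to [u] in the first-order Sobolev norm, but nothing makes [W u_k] converge to
   [W u] in L^2, so density of test functions in the energy space is not at hand. Uniqueness has to
   be reached by test functions that are bounded with compact support, for which [W phi] is square
   integrable; a bounded function of [u_k] also supplies a majorant independent of [k]. This
   function should be smooth, increasing, at most linear and zero only at 0. [atan] is all of these,
   and its derivative is rational with positive denominator. The limit in the gradient term is
   quantified by a completed square with a free parameter [d], so that convergence of the
   derivatives of [atan u_k] is never asked for.

   On the operator side, multiplication by [W] may be unbounded on L^2. Closedness of [S0 l] is
   therefore no bounded perturbation argument; an a priori estimate for the pencil in the energy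
   norm takes its place. For the matrix, closedness comes instead from its bounded inverse. *)
Require Import Defs.
From mathcomp Require Import all_boot all_order all_algebra.
From mathcomp Require Import complex ring lra.
From mathcomp Require Import all_classical all_reals all_analysis.

Set Implicit Arguments.
Unset Strict Implicit.
Unset Printing Implicit Defensive.

Import Order.TTheory GRing.Theory Num.Theory.
Import numFieldNormedType.Exports measurable_realfun.

Local Open Scope classical_set_scope.
Local Open Scope ring_scope.
Local Open Scope complex_scope.

Local Notation Re := (@complex.Re _).
Local Notation normc := ComplexField.Normc.normc.
Local Notation Im := (@complex.Im _).

(** * Hilbert spaces *)

Section hilbert_defs.
Variable R : realType.

Definition linsub (V : lmodType R[i]) (D : set V) : Prop :=
  D 0 /\ forall a x y, D x -> D y -> D (a *: x + y).

(** All axioms are restricted to [carrier X], outside of which [inner] is arbitrary. Positivity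
    concerns the real part only; conjugate symmetry forces the imaginary part of [inner X x x] to
    vanish. *)
Record preHilbert (X : innerSpace R) : Prop := PreHilbert {
  carrier_sub : linsub (carrier X);
  inner_lin : forall a x y z, carrier X x -> carrier X y -> carrier X z ->
    inner X (a *: x + y) z = a * inner X x z + inner X y z;
  inner_conj : forall x y, carrier X x -> carrier X y ->
    inner X y x = (inner X x y)^*%C;
  inner_ge0 : forall x, carrier X x -> 0 <= Re (inner X x x);
  inner_def : forall x, carrier X x -> Re (inner X x x) = 0 -> x = 0 }.

Definition hcauchy (X : innerSpace R) (u : nat -> X) : Prop :=
  forall e : R, 0 < e -> exists N, forall i j, (N <= i)%N -> (N <= j)%N ->
    hnorm X (u i - u j) < e.

Definition hcomplete (X : innerSpace R) : Prop :=
  forall u : nat -> X, (forall k, carrier X (u k)) -> hcauchy u ->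
    exists2 x, carrier X x & hcvg X u x.

(** A real inner product with the same norm. Riesz representation and orthogonality to a complex
    subspace can be phrased with it, since multiplying a vector by ['i] recovers the imaginary
    part. *)
Definition rin (X : innerSpace R) (x y : X) : R := Re (inner X x y).

End hilbert_defs.
Arguments hcauchy {R} X u.
Arguments rin {R} X x y.

Section subspace_theory.
Variables (R : realType) (V : lmodType R[i]) (D : set V).
Hypothesis DS : linsub D.

Lemma linsubD x y : D x -> D y -> D (x + y).
Proof. by move=> Dx Dy; rewrite -[x]scale1r; exact: DS.2. Qed.

Lemma linsubZ a x : D x -> D (a *: x).
Proof. by move=> Dx; rewrite -[_ *: _]addr0; apply: DS.2 => //; exact: DS.1. Qed.

Lemma linsubB x y : D x -> D y -> D (x - y).
Proof.
by move=> Dx Dy; apply: linsubD => //; rewrite -scaleN1r; exact: linsubZ.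
Qed.

End subspace_theory.

Section hilbert_theory.
Variables (R : realType) (X : innerSpace R).
Hypothesis HX : preHilbert X.
Local Notation c := (carrier X).
Implicit Types (x y z : X) (t : R).

Let cS := carrier_sub HX.

Lemma rinD x y z : c x -> c y -> c z -> rin X (x + y) z = rin X x z + rin X y z.
Proof.
move=> cx cy cz; rewrite /rin -[x in x + y]scale1r (inner_lin HX)// mul1r.
by case: (inner X x z) (inner X y z) => [a b] [a' b'].
Qed.

Lemma inner0l z : c z -> inner X 0 z = 0.
Proof.
move=> cz; have := inner_lin HX 1 cS.1 cS.1 cz.
by rewrite scaler0 addr0 mul1r => /eqP; rewrite -subr_eq0 opprD addNKr oppr_eq0 => /eqP.
Qed.

Lemma innerZl a x z : c x -> c z -> inner X (a *: x) z = a * inner X x z.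
Proof.
by move=> cx cz; rewrite -[a *: x]addr0 (inner_lin HX)// ?inner0l ?addr0//; exact: cS.1.
Qed.

Lemma rinZ t x z : c x -> c z -> rin X (t%:C *: x) z = t * rin X x z.
Proof.
by move=> cx cz; rewrite /rin innerZl//; case: inner => a b /=; rewrite mul0r subr0.
Qed.

Lemma rinC x y : c x -> c y -> rin X y x = rin X x y.
Proof. by move=> cx cy; rewrite /rin (inner_conj HX)//; case: inner. Qed.

Lemma rinN x z : c x -> c z -> rin X (- x) z = - rin X x z.
Proof.
move=> cx cz; rewrite -mulN1r -rinZ//; congr rin.
by rewrite rmorphN1 scaleN1r.
Qed.

Lemma rinB x y z : c x -> c y -> c z -> rin X (x - y) z = rin X x z - rin X y z.
Proof.
move=> cx cy cz; rewrite rinD ?rinN//.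
by rewrite -sub0r; apply: linsubB => //; exact: cS.1.
Qed.

Lemma rinDr x y z : c x -> c y -> c z -> rin X z (x + y) = rin X z x + rin X z y.
Proof.
by move=> cx cy cz; rewrite rinC ?rinD// 1?rinC// 1?[rin _ y z]rinC//; exact: linsubD.
Qed.

Lemma rinBr x y z : c x -> c y -> c z -> rin X z (x - y) = rin X z x - rin X z y.
Proof.
by move=> cx cy cz; rewrite rinC ?rinB// 1?rinC// 1?[rin _ y z]rinC//; exact: linsubB.
Qed.

Lemma rinZr t x z : c x -> c z -> rin X z (t%:C *: x) = t * rin X z x.
Proof.
by move=> cx cz; rewrite rinC ?rinZ// 1?rinC//; exact: linsubZ.
Qed.

Lemma inner_Im0 x : c x -> Im (inner X x x) = 0.
Proof.
move=> cx; have := inner_conj HX cx cx; case: (inner X x x) => a b /= [] /eqP.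
by rewrite -subr_eq0 opprK -mulr2n mulrn_eq0/= => /eqP.
Qed.

Lemma rin_scale2 a x : c x ->
  rin X (a *: x) (a *: x) = (Re a ^+ 2 + Im a ^+ 2) * rin X x x.
Proof.
move=> cx; have cax := linsubZ cS a cx.
rewrite /rin innerZl// (inner_conj HX cax cx) innerZl//.
have := inner_Im0 cx; case: (inner X x x) => p q /= ->; case: a {cax} => a b /=.
by ring.
Qed.

Lemma ihnormE x : hnorm X x = Num.sqrt (rin X x x). Proof. by []. Qed.

Lemma hnorm_sqr x : c x -> hnorm X x ^+ 2 = rin X x x.
Proof. by move=> cx; rewrite ihnormE sqr_sqrtr//; exact: (inner_ge0 HX). Qed.

Lemma hnorm_ge0 x : 0 <= hnorm X x.
Proof. exact: sqrtr_ge0. Qed.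

Lemma hnorm_eq0 x : c x -> hnorm X x = 0 -> x = 0.
Proof.
move=> cx h0; apply: (inner_def HX) => //.
by have := hnorm_sqr cx; rewrite h0 expr0n.
Qed.

Lemma ihnorm0 : hnorm X 0 = 0.
Proof. by rewrite ihnormE /rin inner0l ?sqrtr0//; exact: cS.1. Qed.

Lemma ihnormZ a x : c x -> hnorm X (a *: x) = normc a * hnorm X x.
Proof.
by move=> cx; rewrite !ihnormE rin_scale2// sqrtrM ?addr_ge0 ?sqr_ge0//; case: a.
Qed.

Lemma ihnormN x : c x -> hnorm X (- x) = hnorm X x.
Proof.
move=> cx; rewrite -scaleN1r ihnormZ//.
by rewrite /normc /= oppr0 expr0n addr0 sqrrN expr1n sqrtr1 mul1r.
Qed.

Lemma ihnormBC x y : c x -> c y -> hnorm X (x - y) = hnorm X (y - x).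
Proof. by move=> cx cy; rewrite -ihnormN ?opprB//; exact: linsubB. Qed.

Lemma rin_sqD x y : c x -> c y ->
  rin X (x + y) (x + y) = rin X x x + 2 * rin X x y + rin X y y.
Proof.
move=> cx cy; have cxy := linsubD cS cx cy.
by rewrite rinD// !rinDr// [rin X y x]rinC//; ring.
Qed.

Lemma rin_sqB x y : c x -> c y ->
  rin X (x - y) (x - y) = rin X x x - 2 * rin X x y + rin X y y.
Proof.
move=> cx cy; have cxy := linsubB cS cx cy.
by rewrite rinB// !rinBr// [rin X y x]rinC//; ring.
Qed.

Lemma cauchy_schwarz_sq x y : c x -> c y ->
  rin X x y ^+ 2 <= rin X x x * rin X y y.
Proof.
move=> cx cy; have [y0|yn0] := eqVneq (rin X y y) 0.
  have -> : y = 0 by exact: (inner_def HX).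
  by rewrite rinC ?[rin X 0 x]/rin ?inner0l//= ?expr0n ?mulr_ge0//; try exact: cS.1;
    apply: (inner_ge0 HX) => //; exact: cS.1.
have y0 : 0 < rin X y y by rewrite lt_def yn0 (inner_ge0 HX).
(* The vector subtracted from [x] is its orthogonal projection onto the real line through [y]. *)
have cs := linsubZ cS (rin X x y / rin X y y)%:C cy.
have := inner_ge0 HX (linsubB cS cx cs).
rewrite -[Re _]/(rin _ _ _) rin_sqB// rinZr// rinZ// rinZr// => h.
rewrite -subr_ge0 -(pmulr_lge0 _ (_ : 0 < (rin X y y)^-1)) ?invr_gt0//.
by apply: le_trans h _; rewrite le_eqVlt; apply/orP; left; apply/eqP; field.
Qed.

Lemma cauchy_schwarz x y : c x -> c y -> `|rin X x y| <= hnorm X x * hnorm X y.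
Proof.
move=> cx cy; rewrite !ihnormE -sqrtrM ?(inner_ge0 HX)// -sqrtr_sqr.
by apply: ler_wsqrtr; exact: cauchy_schwarz_sq.
Qed.

Lemma ihnormD x y : c x -> c y -> hnorm X (x + y) <= hnorm X x + hnorm X y.
Proof.
move=> cx cy; rewrite -(@ler_pXn2r _ 2)// ?nnegrE ?addr_ge0 ?hnorm_ge0//.
rewrite sqrrD !hnorm_sqr//; last exact: linsubD.
rewrite rin_sqD//.
have := le_trans (ler_norm _) (cauchy_schwarz cx cy).
by move=> h; rewrite -mulr_natl; lra.
Qed.

Lemma ihnormB x y : c x -> c y -> hnorm X (x - y) <= hnorm X x + hnorm X y.
Proof.
move=> cx cy; rewrite -[hnorm X y]ihnormN//; apply: ihnormD => //.
by rewrite -sub0r; apply: linsubB => //; exact: cS.1.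
Qed.

Lemma hnorm_dist x y z : c x -> c y -> c z ->
  hnorm X (x - z) <= hnorm X (x - y) + hnorm X (y - z).
Proof.
move=> cx cy cz; rewrite -[x - z](subrKA y).
by apply: ihnormD; exact: linsubB.
Qed.

Lemma hcvgP (u : nat -> X) x : hcvg X u x <->
  forall e : R, 0 < e -> exists N, forall k, (N <= k)%N -> hnorm X (u k - x) < e.
Proof.
split=> [/cvgr0Pnorm_lt h e e0|h].
  have [N _ hN] := h _ e0; exists N => k Nk.
  by have := hN k Nk; rewrite /= ger0_norm// hnorm_ge0.
apply/cvgr0Pnorm_lt => e e0; have [N hN] := h _ e0.
by exists N => // k /= /hN; rewrite ger0_norm// hnorm_ge0.
Qed.

Lemma hcvg_cauchy (u : nat -> X) x : (forall k, c (u k)) -> c x ->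
  hcvg X u x -> hcauchy X u.
Proof.
move=> cu cx /hcvgP h e e0.
have [|N hN] := h (e / 2); first by rewrite divr_gt0.
exists N => i j Ni Nj; apply: le_lt_trans (hnorm_dist (cu i) cx (cu j)) _.
by rewrite [hnorm _ (x - _)]ihnormBC// [e]splitr ltrD// hN.
Qed.

Lemma hcvg_unique (u : nat -> X) x y : (forall k, c (u k)) -> c x -> c y ->
  hcvg X u x -> hcvg X u y -> x = y.
Proof.
move=> cu cx cy /hcvgP hx /hcvgP hy; apply/eqP; rewrite -subr_eq0; apply/eqP.
apply: hnorm_eq0; first exact: linsubB.
apply/eqP; rewrite eq_le hnorm_ge0 andbT; apply/ler_addgt0Pr => e e0.
have e2 : 0 < e / 2 by rewrite divr_gt0.
have [N hN] := hx _ e2; have [M hM] := hy _ e2.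
rewrite add0r; apply: le_trans (hnorm_dist cx (cu (maxn N M)) cy) _.
rewrite ihnormBC// [e]splitr ltW// ltrD// ?hN ?hM// ?leq_maxl// leq_maxr//.
Qed.

Lemma hcvgD (u v : nat -> X) x y : (forall k, c (u k)) -> (forall k, c (v k)) ->
  c x -> c y -> hcvg X u x -> hcvg X v y -> hcvg X (fun k => u k + v k) (x + y).
Proof.
move=> cu cv cx cy /hcvgP hx /hcvgP hy; apply/hcvgP => e e0.
have e2 : 0 < e / 2 by rewrite divr_gt0.
have [N hN] := hx _ e2; have [M hM] := hy _ e2.
exists (maxn N M) => k; rewrite geq_max => /andP[Nk Mk].
rewrite opprD addrACA; apply: le_lt_trans (ihnormD _ _) _; try exact: linsubB.
by rewrite [e]splitr ltrD// ?hN ?hM.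
Qed.

Lemma hcvgZ a (u : nat -> X) x : (forall k, c (u k)) ->
  c x -> hcvg X u x -> hcvg X (fun k => a *: u k) (a *: x).
Proof.
move=> cu cx hx; rewrite /hcvg.
rewrite (_ : (fun _ => _) =
    (fun k => normc a * hnorm X (u k - x))); last first.
  by apply/funext => k; rewrite -scalerBr ihnormZ//; exact: linsubB.
by rewrite -(mulr0 (normc a)); exact: cvgMr.
Qed.

Lemma rin_cvg (u : nat -> X) x z : (forall k, c (u k)) -> c x -> c z ->
  hcvg X u x -> (fun k => rin X (u k) z) @ \oo --> rin X x z.
Proof.
move=> cu cx cz /hcvgP h; apply/cvgrPdist_lt => e e0.
have p0 : 0 < hnorm X z + 1 by rewrite ltr_wpDl// hnorm_ge0.
have [|N hN] := h (e / (hnorm X z + 1)); first by rewrite divr_gt0.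
exists N => // k /= Nk; rewrite distrC -rinB//.
apply: le_lt_trans (cauchy_schwarz _ cz) _; first exact: linsubB.
have := hN k Nk; rewrite ltr_pdivlMr// => hk; apply: le_lt_trans hk.
by rewrite ler_wpM2l ?hnorm_ge0// lerDl.
Qed.

(* Minimise [|v|^2 - 2 F v]. *)
Lemma riesz (F : X -> R) (C : R) : hcomplete X ->
  (forall x y, c x -> c y -> F (x + y) = F x + F y) ->
  (forall t x, c x -> F (t%:C *: x) = t * F x) ->
  (forall x, c x -> `|F x| <= C * hnorm X x) ->
  exists2 u, c u & forall x, c x -> rin X u x = F x.
Proof.
move=> cX FD FZ FC.
pose J v := rin X v v - 2 * F v.
(* [|F v| <= C |v|] gives [J v >= |v|^2 - 2 C |v| >= - C ^+ 2]. *)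
have JC v : c v -> - C ^+ 2 <= J v.
  move=> cv; rewrite /J -hnorm_sqr//.
  have := FC v cv; rewrite ler_norml => /andP[_ h].
  have := sqr_ge0 (hnorm X v - C); rewrite sqrrB -mulr_natl.
  by nra.
pose A := [set J v | v in c].
have A0 : A !=set0 by exists (J 0), 0 => //; exact: cS.1.
have lA : has_lbound A by exists (- C ^+ 2) => _ [v cv <-]; exact: JC.
pose d := inf A.
have dJ v : c v -> d <= J v by move=> cv; apply: inf_lbound => //; exists v.
have appr k : exists v, c v /\ J v < d + k.+1%:R^-1.
  have [//|_ [v cv <-] h] := @inf_adherent _ A k.+1%:R^-1 _ (conj A0 lA).
  by exists v.
have [v hv] := choice appr.
have cv k : c (v k) by have [] := hv k.
have Jv k : J (v k) < d + k.+1%:R^-1 by have [] := hv k.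
(* Parallelogram law: [|x - y|^2 = 2 J x + 2 J y - 4 J ((x + y) / 2)], and the midpoint has
   [J >= d]. *)
have par x y : c x -> c y ->
    rin X (x - y) (x - y) <= 2 * (J x - d) + 2 * (J y - d).
  move=> cx cy; have cxy := linsubD cS cx cy.
  have := dJ _ (linsubZ cS (2^-1)%:C cxy).
  rewrite /J FZ// FD// rinZr ?rinZ//; last exact: linsubZ.
  rewrite rin_sqD// rin_sqB//; lra.
have ucau : hcauchy X v.
  move=> e e0; have e2 : 0 < e ^+ 2 / 4 by rewrite divr_gt0// exprn_gt0.
  have /cvgrPdist_lt/(_ _ e2)[N _ hN] := @cvg_harmonic R.
  exists N => i j Ni Nj.
  rewrite -(@ltr_pXn2r _ 2)// ?nnegrE ?hnorm_ge0 ?(ltW e0)//.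
  rewrite hnorm_sqr; last exact: linsubB.
  apply: le_lt_trans (par _ _ (cv i) (cv j)) _.
  have hk k : (N <= k)%N -> J (v k) < d + e ^+ 2 / 4.
    move=> /hN; rewrite /= sub0r normrN ger0_norm /harmonic//= => hk.
    by apply: lt_trans (Jv k) _; rewrite ltrD2l.
  by have := hk _ Ni; have := hk _ Nj; lra.
have [u cu /[dup] hu /hcvgP hu'] := cX _ cv ucau.
(* Continuity of [J] at [u]: the difference [J u - J (v k)] is at most [2 (|u| + |C|) |u - v k|];
   the added 1 keeps the divisor positive. *)
have Ju : J u <= d.
  apply/ler_addgt0Pr => e e0.
  have B0 : 0 < 2 * (hnorm X u + `|C| + 1).
    by rewrite mulr_gt0// ltr_wpDl// addr_ge0 ?hnorm_ge0.
  have e2 : 0 < e / 2 by rewrite divr_gt0.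
  have [N hN] := hu' _ (divr_gt0 e2 B0).
  have /cvgrPdist_lt/(_ _ e2)[M _ hM] := @cvg_harmonic R.
  have {hM}hM := hM _ (leq_maxr N M); have {hN}hN := hN _ (leq_maxl N M).
  move: (maxn N M) hM hN => k.
  rewrite /= sub0r normrN ger0_norm /harmonic//= => hM.
  rewrite ihnormBC// ltr_pdivlMr// => hN.
  have cuv := linsubB cS cu (cv k).
  have : J (v k) < d + e / 2 by apply: lt_trans (Jv k) _; rewrite ltrD2l.
  have Fk : F (v k) = F u - F (u - v k).
    by apply/eqP; rewrite eq_sym subr_eq -FD// addrC subrK.
  rewrite /J Fk.
  have -> : rin X (v k) (v k) = rin X u u - 2 * rin X u (u - v k)
      + rin X (u - v k) (u - v k).
    by rewrite -rin_sqB// subKr.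
  have := inner_ge0 HX cuv; rewrite -[Re _]/(rin _ _ _).
  have := cauchy_schwarz cu cuv; rewrite ler_norml => /andP[_ h1].
  have := FC _ cuv; rewrite ler_norml => /andP[h2 _].
  have := ler_wpM2r (hnorm_ge0 (u - v k)) (ler_norm C).
  by have := hnorm_ge0 (u - v k); move: h1 h2 hN => *; lra.
exists u => // x cx.
pose q := rin X x x; pose b := rin X u x - F x.
have key t : 0 <= t ^+ 2 * q + 2 * t * b.
  have ctx := linsubZ cS t%:C cx.
  have := dJ _ (linsubD cS cu ctx).
  move=> /(le_trans Ju); rewrite /J FD// FZ// rin_sqD// !rinZr// rinZ//.
  by rewrite /q /b; lra.
have q0 : 0 <= q by exact: (inner_ge0 HX).
suff : b = 0 by move/eqP; rewrite subr_eq0 => /eqP.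
have q1 : 0 < q + 1 by rewrite ltr_wpDl.
(* Close to the minimum of the quadratic in [t]. The divisor is [q + 1] because [q] may vanish; the
   value is still negative unless [b = 0]. *)
have := key (- b / (q + 1)).
have -> : (- b / (q + 1)) ^+ 2 * q + 2 * (- b / (q + 1)) * b
  = - (b ^+ 2 * ((q + 2) / (q + 1) ^+ 2)) by field; rewrite gt_eqF.
rewrite oppr_ge0 pmulr_lle0 => [h|]; last first.
  by rewrite divr_gt0// ?exprn_gt0// ltr_wpDl.
by apply/eqP; rewrite -sqrf_eq0 eq_le h sqr_ge0.
Qed.

End hilbert_theory.

(** * Closures of subspaces, and density by orthogonality *)

Section closure.
Variables (R : realType) (X : innerSpace R).
Hypotheses (HX : preHilbert X) (cX : hcomplete X).
Variable D : set X.
Hypotheses (DS : linsub D) (Dc : D `<=` carrier X).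

Definition hclosure : set X := [set x | carrier X x /\
  forall e : R, 0 < e -> exists2 y, D y & hnorm X (x - y) < e].

Definition hclosure_space : innerSpace R := InnerSpace hclosure (inner X).

Lemma hclosure_linsub : linsub hclosure.
Proof.
have cS := carrier_sub HX; split.
  split=> [|e e0]; first exact: cS.1.
  by exists 0; [exact: DS.1|rewrite subrr ihnorm0].
move=> a x y [cx hx] [cy hy]; split; first exact: cS.2.
move=> e e0; have p0 : 0 < normc a + 1.
  by rewrite ltr_wpDl//; case: a => *; exact: sqrtr_ge0.
have [|x' Dx' hx'] := hx (e / 2 / (normc a + 1)).
  by rewrite !divr_gt0.
have [|y' Dy' hy'] := hy (e / 2); first by rewrite divr_gt0.
exists (a *: x' + y'); first exact: DS.2.
have cxx := linsubB cS cx (Dc Dx').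
rewrite opprD addrACA -scalerBr.
apply: le_lt_trans (ihnormD HX (linsubZ cS a cxx) (linsubB cS cy (Dc Dy'))) _.
rewrite [e]splitr ltrD// ihnormZ//.
move: hx'; rewrite ltr_pdivlMr// => h; apply: le_lt_trans h.
by rewrite mulrC ler_wpM2l ?hnorm_ge0// lerDl.
Qed.

Lemma hclosure_preHilbert : preHilbert hclosure_space.
Proof.
split=> /=; first exact: hclosure_linsub.
- by move=> a x y z [cx _] [cy _] [cz _]; exact: (inner_lin HX).
- by move=> x y [cx _] [cy _]; exact: (inner_conj HX).
- by move=> x [cx _]; exact: (inner_ge0 HX).
- by move=> x [cx _]; exact: (inner_def HX).
Qed.

Lemma hclosure_complete : hcomplete hclosure_space.
Proof.
move=> u uc ucau; have [k|x cx ux] := cX _ ucau; first by have [] := uc k.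
exists x => //; split=> // e e0.
have e2 : 0 < e / 2 by rewrite divr_gt0.
have /hcvgP/(_ _ e2)[N hN] := ux; have {hN}hN := hN N (leqnn N).
have [cu /(_ _ e2)[y Dy hy]] := uc N; exists y => //.
apply: le_lt_trans (hnorm_dist HX cx cu (Dc Dy)) _.
by rewrite ihnormBC// [e]splitr ltrD.
Qed.

(** The Riesz theorem on the closure of [D] gives the orthogonal projection [p] of [x]; then [x - p]
    is orthogonal to [D], hence zero, and [x] lies in the closure. *)
Lemma dense_of_trivial_orthogonal :
  (forall x, carrier X x -> (forall y, D y -> rin X x y = 0) -> x = 0) ->
  hdense X D.
Proof.
move=> triv; split=> // x cx.
have cS := carrier_sub HX.
have [|||p [cp hp] pE] := @riesz _ _ hclosure_preHilbert (rin X x) (hnorm X x)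
    hclosure_complete.
- by move=> y z [cy _] [cz _]; exact: rinDr.
- by move=> t y [cy _]; exact: rinZr.
- by move=> y [cy _]; exact: cauchy_schwarz.
suff -> : x = p by [].
apply/eqP; rewrite -subr_eq0; apply/eqP; apply: triv => [|y Dy].
  exact: linsubB.
have cy := Dc Dy.
rewrite rinB// -[rin X p y]/(rin hclosure_space p y) pE ?subrr//; split=> // e e0.
by exists y => //; rewrite subrr ihnorm0.
Qed.

End closure.

(** * The operator matrix and its pencil *)

Section direct_sum_theory.
Variables (R : realType) (X Y : innerSpace R).
Hypotheses (HX : preHilbert X) (HY : preHilbert Y).

Lemma direct_sum_preHilbert : preHilbert (direct_sum X Y).
Proof.
have [cX cY] := (carrier_sub HX, carrier_sub HY).
have ReD (a b : R[i]) : Re (a + b) = Re a + Re b by case: a b => [? ?] [].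
split=> /=.
- split=> [|a [x y] [x' y'] [/= cx cy] [/= cx' cy']].
    by split; [exact: cX.1|exact: cY.1].
  by split; [exact: cX.2|exact: cY.2].
- move=> a [x y] [x' y'] [z w] [/= cx cy] [/= cx' cy'] [/= cz cw].
  by rewrite (inner_lin HX)// (inner_lin HY)// mulrDr addrACA.
- move=> [x y] [x' y'] [/= cx cy] [/= cx' cy'].
  by rewrite (inner_conj HX cx cx') (inner_conj HY cy cy') rmorphD.
- move=> [x y] [/= cx cy]; rewrite ReD addr_ge0//.
    exact: (inner_ge0 HX).
  exact: (inner_ge0 HY).
- move=> [x y] [/= cx cy]; rewrite ReD => /eqP.
  rewrite paddr_eq0 ?(inner_ge0 HX)// ?(inner_ge0 HY)// => /andP[/eqP x0 /eqP y0].
  by rewrite (inner_def HX cx x0) (inner_def HY cy y0).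
Qed.

Lemma rin_direct_sum (p q : direct_sum X Y) :
  rin (direct_sum X Y) p q = rin X p.1 q.1 + rin Y p.2 q.2.
Proof. by rewrite /rin /=; case: inner => ? ?; case: inner. Qed.

Lemma hnorm_direct_sum1 (p : direct_sum X Y) : carrier (direct_sum X Y) p ->
  hnorm X p.1 <= hnorm (direct_sum X Y) p.
Proof.
move=> [/= c1 c2]; apply: ler_wsqrtr; rewrite -!/(rin _ _ _) rin_direct_sum.
by rewrite lerDl (inner_ge0 HY).
Qed.

Lemma hnorm_direct_sum2 (p : direct_sum X Y) : carrier (direct_sum X Y) p ->
  hnorm Y p.2 <= hnorm (direct_sum X Y) p.
Proof.
move=> [/= c1 c2]; apply: ler_wsqrtr; rewrite -!/(rin _ _ _) rin_direct_sum.
by rewrite lerDr (inner_ge0 HX).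
Qed.

Lemma hnorm_direct_sum_le (p : direct_sum X Y) : carrier (direct_sum X Y) p ->
  hnorm (direct_sum X Y) p <= hnorm X p.1 + hnorm Y p.2.
Proof.
move=> cp; have [/= c1 c2] := cp.
rewrite -(@ler_pXn2r _ 2)// ?nnegrE ?addr_ge0 ?hnorm_ge0//.
rewrite (hnorm_sqr direct_sum_preHilbert)// rin_direct_sum sqrrD.
rewrite (hnorm_sqr HX)// (hnorm_sqr HY)// lerD2r lerDl.
by rewrite mulrn_wge0// mulr_ge0// hnorm_ge0.
Qed.

Lemma hcvg_direct_sum (u : nat -> direct_sum X Y) (p : direct_sum X Y) :
  (forall k, carrier (direct_sum X Y) (u k)) -> carrier (direct_sum X Y) p ->
  hcvg (direct_sum X Y) u p <->
  hcvg X (fun k => (u k).1) p.1 /\ hcvg Y (fun k => (u k).2) p.2.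
Proof.
move=> cu cp; have cup k := linsubB (carrier_sub direct_sum_preHilbert) (cu k) cp.
split=> [/hcvgP h|[/hcvgP h1 /hcvgP h2]].
  split; apply/hcvgP => e /h[N hN]; exists N => k Nk.
    by apply: le_lt_trans (hN k Nk); exact: (hnorm_direct_sum1 (cup k)).
  by apply: le_lt_trans (hN k Nk); exact: (hnorm_direct_sum2 (cup k)).
apply/hcvgP => e e0; have e2 : 0 < e / 2 by rewrite divr_gt0.
have [N hN] := h1 _ e2; have [M hM] := h2 _ e2.
exists (maxn N M) => k; rewrite geq_max => /andP[Nk Mk].
apply: le_lt_trans (hnorm_direct_sum_le (cup k)) _.
by rewrite [e]splitr ltrD// ?hN ?hM.
Qed.

Lemma hdense_direct_sum (A : set X) (B : set Y) :
  hdense X A -> hdense Y B -> hdense (direct_sum X Y) (A `*` B).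
Proof.
move=> [AX dA] [BY dB]; split.
  by move=> [x y] [/= /AX cx /BY cy].
move=> [x y] [/= cx cy] e e0; have e2 : 0 < e / 2 by rewrite divr_gt0.
have [x' Ax hx] := dA x cx _ e2; have [y' By hy] := dB y cy _ e2.
exists (x', y') => //.
apply: le_lt_trans (hnorm_direct_sum_le _) _.
  apply: (linsubB (carrier_sub direct_sum_preHilbert)) => //.
  by split; [exact: AX|exact: BY].
by rewrite [e]splitr ltrD.
Qed.

End direct_sum_theory.

(** * The operator matrix and its pencil over an abstract pair of spaces *)

Section pencil.
Variables (R : realType) (E : lmodType R[i]) (cV : set E).
Variables (iV iH : E -> E -> R[i]).
Local Notation V := (InnerSpace cV iV).
Local Notation H := (InnerSpace [set: E] iH).
Hypotheses (HV : preHilbert V) (HH : preHilbert H) (cplV : hcomplete V).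
Hypothesis VH : forall x : E, cV x -> hnorm H x <= hnorm V x.
Variable D : set E.
Hypotheses (DS : linsub D) (DV : D `<=` cV).
Variables (L M : E -> E).
Hypothesis L_lin : forall a x y, D x -> D y -> L (a *: x + y) = a *: L x + L y.
Hypothesis M_lin : forall a x y, cV x -> cV y -> M (a *: x + y) = a *: M x + M y.
Hypothesis M_le : forall x : E, cV x -> hnorm H (M x) <= hnorm V x.
Hypothesis L_surj : forall f, exists2 x, D x & L x = f.
Variable (cL : R).
Hypothesis cL_gt0 : 0 < cL.
Hypothesis L_ge : forall x : E, D x -> cL * rin V x x <= rin H (L x) x.
Variables (A : operator (direct_sum V H)) (S : R[i] -> operator H).
Hypothesis domA : dom A = D `*` cV.
Hypothesis actA : forall x y, D x -> cV y ->
  A (x, y) = (y, L x + (2 * 'i) *: M y).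
Hypothesis domS : forall l, dom (S l) = D.
Hypothesis actS : forall l x, D x ->
  S l x = l^-1 *: (L x + (2 * 'i * l) *: M x - l ^+ 2 *: x).

Local Notation nV := (hnorm V).
Local Notation nH := (hnorm H).
Implicit Types (x y f g : E) (l : R[i]).

Let cS := carrier_sub HV.
Let cH x : carrier H x. Proof. by []. Qed.

Definition pencil l x : E := L x + (2 * 'i * l) *: M x - l ^+ 2 *: x.

Lemma normc_ge0 (a : R[i]) : 0 <= normc a.
Proof. by case: a => *; exact: sqrtr_ge0. Qed.

Lemma normcX2 (a : R[i]) : normc (a ^+ 2) = normc a ^+ 2.
Proof. by rewrite !expr2 ComplexField.Normc.normcM. Qed.

Lemma normc_2i (l : R[i]) : normc (2 * 'i * l) = 2 * normc l.
Proof.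
rewrite 2!ComplexField.Normc.normcM; congr (_ * _).
rewrite -(rmorph_nat (real_complex R)) /= expr0n add0r expr1n sqrtr1 mulr1.
by rewrite addr0 sqrtr_sqr ger0_norm.
Qed.

Let nHD (a b : E) : nH (a + b) <= nH a + nH b.
Proof. exact: (ihnormD HH). Qed.

Let nHB (a b : E) : nH (a - b) <= nH a + nH b.
Proof. exact: (ihnormB HH). Qed.

(** Coercivity and Cauchy-Schwarz give [cL |x|_V^2 <= |L x|_H |x|_H <= |L x|_H |x|_V]; one factor
    [|x|_V] cancels. *)
Lemma L_le x : D x -> cL * hnorm V x <= hnorm H (L x).
Proof.
move=> Dx; have Vx := DV Dx.
have := L_ge Dx; rewrite -(hnorm_sqr HV)// => h.
have := le_trans (ler_norm _) (cauchy_schwarz HH (cH (L x)) (cH x)).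
move=> /(le_trans h){h}; have [x0|x0] := eqVneq (hnorm V x) 0.
  by rewrite x0 mulr0 hnorm_ge0.
have {}x0 : 0 < hnorm V x by rewrite lt_def x0 hnorm_ge0.
rewrite expr2 mulrA => /le_trans /(_ (ler_wpM2l (hnorm_ge0 _) (VH Vx))).
by rewrite ler_pM2r.
Qed.

(** A priori estimate. In the coercivity inequality, [L x] is replaced by
    [pencil l x - 2 i l M x + l^2 x], and one factor of each product is bounded by [|x|_V], which
    then cancels. The norm of [x] in [H] has to stay on the right, as [l] is arbitrary. *)
Lemma pencil_ge l : exists2 C : R, 0 <= C & forall x, D x ->
  hnorm V x <= C * (hnorm H (pencil l x) + hnorm H x).
Proof.
pose k := 1 + 2 * normc l + normc l ^+ 2.
have k0 : 0 <= k by rewrite !addr_ge0// ?mulr_ge0 ?normc_ge0// exprn_ge0 ?normc_ge0.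
exists (k / cL) => [|x Dx]; first by rewrite divr_ge0// ltW.
have Vx := DV Dx.
have [x0|x0] := eqVneq (hnorm V x) 0.
  by rewrite x0 mulr_ge0 ?addr_ge0 ?hnorm_ge0// divr_ge0// ltW.
have {}x0 : 0 < hnorm V x by rewrite lt_def x0 hnorm_ge0.
rewrite mulrAC ler_pdivlMr// mulrC.
have LE : L x = pencil l x - (2 * 'i * l) *: M x + l ^+ 2 *: x.
  by rewrite /pencil addrAC subrK addrK.
have := L_ge Dx; rewrite {1}LE rinD// rinB// -(hnorm_sqr HV)// => h.
have := le_trans (ler_norm _) (cauchy_schwarz HH (cH (pencil l x)) (cH x)).
have := cauchy_schwarz HH (cH ((2 * 'i * l) *: M x)) (cH x).
rewrite ihnormZ// normc_2i ler_norml => /andP[h2 _].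
have := le_trans (ler_norm _) (cauchy_schwarz HH (cH (l ^+ 2 *: x)) (cH x)).
rewrite ihnormZ// normcX2 => h3 h1.
have [hV hM] := (VH Vx, M_le Vx).
set v := hnorm V x in x0 h hV hM *; set w := hnorm H x in h1 h2 h3 hV *.
set s := hnorm H (pencil l x) in h1 *; set mm := hnorm H (M x) in h2 hM.
have [w0 s0 m0 n0] : [/\ 0 <= w, 0 <= s, 0 <= mm & 0 <= normc l].
  by split; rewrite ?hnorm_ge0 ?normc_ge0.
rewrite -(ler_pM2r x0) -mulrA -expr2; apply: le_trans h _.
apply: (@le_trans _ _ (s * w + 2 * normc l * mm * w + normc l ^+ 2 * w * w)).
  by move: h1 h2 h3; lra.
have e1 : s * w <= s * v by rewrite ler_wpM2l.
have e2 : normc l * mm * w <= normc l * v * w by rewrite ler_wpM2r// ler_wpM2l.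
have e3 : normc l ^+ 2 * w * w <= normc l ^+ 2 * w * v.
  by rewrite ler_wpM2l// mulr_ge0// exprn_ge0.
have e4 : 0 <= (2 * normc l + normc l ^+ 2) * s * v + w * v.
  rewrite addr_ge0 ?mulr_ge0 ?addr_ge0 ?mulr_ge0 ?exprn_ge0// ltW//.
rewrite /k; move: e1 e2 e3 e4; lra.
Qed.

Lemma M_zero : M 0 = 0.
Proof.
by have := M_lin (-1) cS.1 cS.1; rewrite scaler0 addr0 scaleN1r addNr.
Qed.

Lemma pencil_lin l a x y : D x -> D y ->
  pencil l (a *: x + y) = a *: pencil l x + pencil l y.
Proof.
move=> Dx Dy; rewrite /pencil L_lin// M_lin//; try exact: DV.
rewrite [in LHS]scalerDr [in - (_ *: _)]scalerDr opprD.
rewrite (scalerA _ a (M x)) (scalerA _ a x) (mulrC _ a) (mulrC (l ^+ 2) a).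
rewrite -!(scalerA a) -scalerN !scalerDr -!scalerN !addrA.
by rewrite (ACl (1 * 3 * 5 * 2 * 4 * 6)%AC).
Qed.

Lemma pencilB l x y : D x -> D y -> pencil l (x - y) = pencil l x - pencil l y.
Proof.
move=> Dx Dy; rewrite addrC -[- y]scaleN1r pencil_lin//.
by rewrite scaleN1r addrC.
Qed.

Lemma pencil0 l : pencil l 0 = 0.
Proof. by rewrite -(subrr 0) pencilB ?subrr//; exact: DS.1. Qed.

(** In the variables [x] and [f = y - l x] the matrix is triangular up to an exchange of rows, and
    [pencil l] is the only entry to invert. Every comparison below is read off from this
    identity. *)
Lemma op_minusA l x y : D x -> cV y -> A (x, y) - l *: ((x, y) : E * E) =
  (y - l *: x, pencil l x + (2 * 'i) *: M (y - l *: x) - l *: (y - l *: x)).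
Proof.
move=> Dx Vy; rewrite actA//.
set f := y - l *: x; have -> : (y, L x + (2 * 'i) *: M y) - l *: (x, y) =
  (f, L x + (2 * 'i) *: M y - l *: y) by [].
congr pair; have Vf : cV f by apply: (linsubB cS) => //; apply: (linsubZ cS); exact: DV.
have -> : y = l *: x + f by rewrite /f addrC subrK.
rewrite M_lin//; last exact: DV.
move: f Vf => f Vf.
rewrite /pencil !scalerDr !opprD !scalerA -expr2 !addrA.
by rewrite [LHS](ACl (1 * 2 * 4 * 3 * 5)%AC).
Qed.

Lemma op_minusS l x : D x -> S l x - 0 *: x = l^-1 *: pencil l x.
Proof. by move=> Dx; rewrite actS// scale0r subr0. Qed.

(** The common meaning, on either side, of [l] being in the resolvent set. The bound is in the norm
    of [H] only; [pencil_ge] upgrades it to the norm of [V]. *)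
Definition pencil_inv l := [/\ forall h, exists2 x, D x & pencil l x = h,
  forall x, D x -> pencil l x = 0 -> x = 0 &
  exists C : R, forall x, D x -> hnorm H x <= C * hnorm H (pencil l x)].

Lemma resolventS l : l != 0 -> resolvent_set (S l) 0 <-> pencil_inv l.
Proof.
move=> l0; have nl0 : 0 < normc l.
  rewrite lt_def normc_ge0 andbT; apply: contra_neq l0.
  exact: ComplexField.Normc.eq0_normc.
rewrite /resolvent_set /= domS; split=> [[[_ inj sur] [C hC]]|[sur inj [C hC]]].
  split=> [h|x Dx px|].
  - have [//|x Dx] := sur (l^-1 *: h); rewrite op_minusS// => e; exists x => //.
    by apply: (scalerI _ e); rewrite invr_eq0.
  - apply: inj; rewrite ?inE//; first exact: DS.1.
    rewrite !op_minusS//; last exact: DS.1.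
    by rewrite px -[in RHS](subrr x) pencilB// px subrr.
  - exists (C * normc l^-1) => x Dx.
    by have := hC x Dx; rewrite op_minusS// ihnormZ// mulrA.
split; last first.
  exists (C * normc l) => x Dx.
  rewrite op_minusS// ihnormZ// -mulrA [normc l * _]mulrA.
  by rewrite -ComplexField.Normc.normcM divff// ComplexField.Normc.normc1 mul1r hC.
split=> //.
- move=> x y /set_mem Dx /set_mem Dy; rewrite !op_minusS// => e.
  have {}e : pencil l x = pencil l y by apply: (scalerI _ e); rewrite invr_eq0.
  apply/eqP; rewrite -subr_eq0; apply/eqP; apply: inj; first exact: linsubB.
  by rewrite pencilB// e subrr.
- move=> h _; have [x Dx px] := sur (l *: h); exists x => //.
  by rewrite op_minusS// px scalerA mulVf// scale1r.
Qed.

Let HA := direct_sum_preHilbert HV HH.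

(** Right-hand sides [(0, h)] correspond to pairs [(x, l x)] and isolate the pencil. Conversely [x]
    is found from [pencil l x = g - 2 i M f + l f], and [y = f + l x]. The first component is
    measured in [V], which is where [pencil_ge] enters. *)
Lemma resolventA l : resolvent_set A l <-> pencil_inv l.
Proof.
rewrite /resolvent_set /= domA; split=> [[[_ inj sur] [C hC]]|[sur inj [C hC]]].
  split=> [h|x Dx px|].
  - have [|[x y] [/= Dx Vy]] := sur (0, h); first by split=> //; exact: cS.1.
    by rewrite op_minusA// => -[-> <-]; exists x => //;
      rewrite M_zero !scaler0 subr0 addr0.
  - have Vx := DV Dx; suff [] : (x, l *: x) = (0, 0) by [].
    apply: inj; rewrite ?inE.
    + by split=> //=; exact: linsubZ.
    + by split; [exact: DS.1|exact: cS.1].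
    rewrite !op_minusA//; try exact: DS.1; try exact: cS.1; last exact: linsubZ.
    by rewrite scaler0 !subrr px pencil0.
  - exists `|C| => x Dx; have Vx := DV Dx.
    have Vlx := linsubZ cS l Vx.
    have := hC (x, l *: x) (conj Dx Vlx).
    rewrite op_minusA// subrr M_zero !scaler0 subr0 addr0 => h.
    apply: le_trans (VH Vx) _.
    apply: le_trans (hnorm_direct_sum1 HH _) (le_trans h _); first by split.
    apply: le_trans (ler_wpM2r (hnorm_ge0 _) (ler_norm C)) _.
    rewrite ler_wpM2l//; apply: le_trans (hnorm_direct_sum_le HV HH _) _ => /=.
      by split=> //; exact: cS.1.
    by rewrite ihnorm0// add0r.
split; first split.
- move=> [x y] [/= Dx Vy].
  change ((cV `*` [set: E]) (A (x, y) - l *: ((x, y) : E * E))).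
  rewrite op_minusA//; split=> //=.
  by apply: (linsubB cS) => //; apply: (linsubZ cS); exact: DV.
- move=> [x y] [x' y'] /set_mem[/= Dx Vy] /set_mem[/= Dx' Vy'].
  rewrite !op_minusA// => -[ef]; rewrite ef => /addIr/addIr e.
  have xx : x = x'.
    apply/eqP; rewrite -subr_eq0; apply/eqP; apply: inj; first exact: linsubB.
    by rewrite pencilB// e subrr.
  by move: ef; rewrite xx => /addIr ->.
- move=> [f g] [/= Vf _].
  have [x Dx px] := sur (g - (2 * 'i) *: M f + l *: f); have Vx := DV Dx.
  have Vy : cV (f + l *: x) by apply: (linsubD cS) => //; exact: (linsubZ cS).
  exists (x, f + l *: x) => //; rewrite op_minusA// addrK px.
  by rewrite addrAC addrK subrK.
have [C1 C10 hC1] := pencil_ge l.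
(* [P] collects the norms of [g], [2 i M f] and [l f]; [Q] then bounds [x] in [V]. In the final
   constant, [Q] is for [x] and [1 + |l| Q] for [y = f + l x]. *)
pose P := 1 + 2 + normc l; pose Q := C1 * (1 + `|C|) * P.
exists (Q + (1 + normc l * Q)) => -[x y] [/= Dx Vy].
have Vx := DV Dx; rewrite op_minusA//.
set f := y - l *: x; set g := _ - l *: f.
have Vf : cV f by apply: (linsubB cS) => //; exact: (linsubZ cS).
have cfg : carrier (direct_sum V H) (f, g) by [].
have f_le := hnorm_direct_sum1 HH cfg; have g_le := hnorm_direct_sum2 HV cfg.
set N := hnorm (direct_sum V H) (f, g) in f_le g_le *.
have p_le : nH (pencil l x) <= P * N.
  have -> : pencil l x = g - (2 * 'i) *: M f + l *: f.
    by rewrite /g addrAC subrK addrK.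
  apply: le_trans (nHD _ _) _.
  rewrite ihnormZ//; apply: le_trans (lerD (nHB _ _) (lexx _)) _.
  have -> : P * N = N + 2 * N + normc l * N by rewrite /P 2!mulrDl mul1r.
  rewrite ihnormZ//; apply: lerD; first apply: lerD => //.
  - rewrite -[2 * 'i]mulr1 normc_2i ComplexField.Normc.normc1 mulr1 ler_wpM2l//.
    exact: le_trans (M_le Vf) f_le.
  - by rewrite ler_wpM2l ?normc_ge0//; exact: le_trans (VH Vf) f_le.
have x_le : nV x <= Q * N.
  apply: le_trans (hC1 x Dx) _; rewrite /Q -!mulrA ler_wpM2l//.
  apply: (@le_trans _ _ ((1 + `|C|) * nH (pencil l x))).
    rewrite mulrDl mul1r lerD2l; apply: le_trans (hC _ Dx) _.
    by rewrite ler_wpM2r ?hnorm_ge0// ler_norm.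
  by rewrite ler_wpM2l// addr_ge0.
apply: le_trans (hnorm_direct_sum_le HV HH _) _ => //.
rewrite mulrDl lerD//= .
have -> : y = f + l *: x by rewrite subrK.
apply: le_trans (nHD _ _) _; rewrite mulrDl mul1r lerD//.
  exact: le_trans (VH Vf) f_le.
rewrite ihnormZ// -mulrA ler_wpM2l ?normc_ge0//.
exact: le_trans (VH Vx) x_le.
Qed.

(** The pencil at 0 is [L] itself, invertible by coercivity and surjectivity; this is what puts 0 in
    the resolvent set of [A]. *)
Lemma pencil_inv0 : pencil_inv 0.
Proof.
have p0 x : pencil 0 x = L x.
  by rewrite /pencil mulr0 expr0n !scale0r addr0 subr0.
split=> [h|x Dx|].
- by have [x Dx Lx] := L_surj h; exists x; rewrite ?p0.
- rewrite p0 => Lx0; have := L_le Dx; rewrite Lx0 ihnorm0//.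
  rewrite pmulr_rle0// => h; apply: (hnorm_eq0 HV); first exact: DV.
  by apply/eqP; rewrite eq_le h hnorm_ge0.
- exists cL^-1 => x Dx; rewrite p0 mulrC ler_pdivlMr// mulrC.
  by apply: le_trans (L_le Dx); rewrite ler_pM2l// VH//; exact: DV.
Qed.

Lemma resolventA0 : resolvent_set A 0.
Proof. exact/resolventA/pencil_inv0. Qed.

Lemma closed_op_minus (T : operator (direct_sum V H)) l :
  (forall p, dom T p -> carrier (direct_sum V H) p /\
     carrier (direct_sum V H) (T p)) ->
  closed_operator T -> closed_operator (op_minus T l).
Proof.
move=> dT cT u x y du cx cy ux Tux.
have AS := carrier_sub HA.
have clx := linsubZ AS l cx.
have cu k : carrier (direct_sum V H) (u k) by have [] := dT _ (du k).
have [||dx Tx] // := cT u x (y + l *: x) du cx (linsubD AS cy clx).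
- rewrite (_ : (fun k => _) = (fun k => op_minus T l (u k) + l *: u k)).
    apply: hcvgD => //.
    + move=> k; apply: (linsubB AS); first by have [] := dT _ (du k).
      exact: (linsubZ AS).
    + by move=> k; exact: (linsubZ AS).
    + exact: hcvgZ.
  by apply/funext => k; rewrite /op_minus /= subrK.
by split=> //; rewrite /op_minus /= Tx addrK.
Qed.

(** An operator with a bounded everywhere defined inverse is closed: if [A u_k] tends to [y = A z],
    then [u_k] tends to [z], so the given limit of [u_k] is [z]. *)
Lemma A_closed : closed_operator A.
Proof.
have AS := carrier_sub HA.
have [[_ _ sur] [C hC]] := resolventA0.
have A0E p : op_minus A 0 p = A p by rewrite /op_minus /= scale0r subr0.
move=> u x y du cx cy ux Aux.
have [z dz] := sur _ cy; rewrite A0E => Az.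
suff uz : hcvg (direct_sum V H) u z.
  have dc p : dom A p -> carrier (direct_sum V H) p.
    by rewrite domA => -[/= /DV].
  by have -> : x = z by apply: (hcvg_unique HA _ _ _ ux uz) => //; [move=> k|];
    exact: dc.
apply/hcvgP => e e0; have p0 : 0 < `|C| + 1 by rewrite ltr_wpDl.
have /hcvgP Aux' := Aux; have [|N hN] := Aux' (e / (`|C| + 1)).
  by rewrite divr_gt0.
exists N => k /hN; rewrite ltr_pdivlMr// => h; apply: le_lt_trans h.
have du' : dom A (u k - z).
  move: (du k) dz; rewrite domA; case: (u k) z {Az} =>
    [a b] [a' b'] [/= Da Vb] [/= Da' Vb'].
  by split; [exact: linsubB|exact: (linsubB cS)].
apply: le_trans (hC _ du') _; rewrite A0E.
have -> : A (u k - z) = A (u k) - y.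
  rewrite -Az; move: (du k) dz; rewrite domA.
  case: (u k) z {du' Az} => [a b] [a' b'] [/= Da Vb] [/= Da' Vb'].
  rewrite (_ : (a, b) - (a', b') = (a - a', b - b'))// !actA//; last 2 first.
  + exact: linsubB.
  + exact: (linsubB cS).
  rewrite [a - a']addrC -[- a']scaleN1r L_lin//.
  rewrite [in M _]addrC -[in M _]scaleN1r M_lin// !scaleN1r.
  have -> (p q p' q' : E) : (p, q) - (p', q') = (p - p', q - q') by [].
  congr pair; rewrite scalerDr scalerN opprD addrACA.
  by rewrite addrC.
by rewrite [leRHS]mulrC ler_wpM2r ?hnorm_ge0// (le_trans (ler_norm C))// lerDl.
Qed.

(** Kernel vectors of [A - l] are the pairs [(x, l x)] with [x] in the kernel of [pencil l]; the
    value 0, left out of the family, is no eigenvalue of [A]. *)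
Lemma point_spectrumE :
  point_spectrum _ A = family_spectrum (@point_spectrum R) S.
Proof.
have A0 : ~ point_spectrum _ A 0.
  move=> [[x y] p0 []]; rewrite /= domA => -[/= Dx Vy].
  rewrite op_minusA// scale0r subr0 => -[y0];
    rewrite y0 M_zero !scaler0 addr0 subr0 => px.
  have [_ inj _] := pencil_inv0; move/eqP: p0; apply.
  by rewrite y0 (inj _ Dx px).
apply/seteqP; split=> l.
  have [->//|l0] := eqVneq l 0.
  move=> [[x y] p0 []]; rewrite /= domA => -[/= Dx Vy].
  rewrite op_minusA// => -[f0]; rewrite f0 M_zero !scaler0 addr0 subr0 => px.
  split=> //; exists x.
    apply: contra_neq p0 => x0; move/eqP: f0; rewrite x0 scaler0 subr0 => /eqP ->.
    by [].
  by split; rewrite /= ?domS// op_minusS// px scaler0.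
move=> [l0 [x x0 []]]; rewrite /= domS => Dx; rewrite op_minusS// => px.
have Vx := DV Dx; have {}px : pencil l x = 0.
  by apply: (@scalerI _ _ l^-1); rewrite ?invr_eq0// px scaler0.
exists (x, l *: x); first by apply: contra_neq x0 => -[].
have Vlx := linsubZ cS l Vx.
split; first by rewrite /= domA.
by rewrite /op_minus /= op_minusA// subrr M_zero !scaler0 px addr0 subr0.
Qed.

Lemma spectrumE : spectrum _ A = family_spectrum (@spectrum R) S.
Proof.
apply/seteqP; split=> l.
  have [->|l0] := eqVneq l 0; first by move=> /(_ resolventA0).
  by move=> nA; split=> // /(resolventS l0)/resolventA.
by move=> [l0 nS] /resolventA/(resolventS l0).
Qed.

(** The a priori estimate makes the sequence Cauchy in [V]. Thus [M u_k] converges, hence so does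
    [L u_k], and coercivity identifies the limit of [u_k] as a point of [D]. *)
Lemma S_closed l : l != 0 -> closed_operator (op_minus (S l) 0).
Proof.
move=> l0 u x y; rewrite /= domS => Du _ _ ux.
rewrite (_ : (fun k => _) = (fun k => l^-1 *: pencil l (u k))); last first.
  by apply/funext => k; rewrite op_minusS.
move=> /(hcvgZ HH l) Pu.
have {}Pu : hcvg H (fun k => pencil l (u k)) (l *: y).
  rewrite (_ : (fun k => _) = (fun k => l *: (l^-1 *: pencil l (u k)))).
    exact: Pu.
  by apply/funext => k; rewrite scalerA divff// scale1r.
have Vu k := DV (Du k).
have [C C0 hC] := pencil_ge l.
have [//||x' Vx' ux'] := cplV (u := u).
  move=> e e0; have C1 : 0 < C + 1 by rewrite ltr_wpDl.
  have e' : 0 < e / (C + 1) / 2 by rewrite !divr_gt0.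
  have [N hN] := hcvg_cauchy HH (fun=> I) I Pu e'.
  have [M' hM] := hcvg_cauchy HH (fun=> I) I ux e'.
  exists (maxn N M') => i j; rewrite !geq_max => /andP[Ni Mi] /andP[Nj Mj].
  apply: le_lt_trans (hC _ (linsubB DS (Du i) (Du j))) _.
  rewrite pencilB//.
  have : nH (pencil l (u i) - pencil l (u j)) + nH (u i - u j) < e / (C + 1).
    by rewrite [ltRHS]splitr ltrD// ?hN ?hM.
  rewrite ltr_pdivlMr// => h; apply: le_lt_trans h.
  by rewrite mulrC ler_wpM2l ?lerDl// addr_ge0// hnorm_ge0.
have VH_cvg (v : nat -> E) (z : E) : (forall k, cV (v k)) -> cV z ->
    hcvg V v z -> hcvg H v z.
  move=> Vv Vz /hcvgP h; apply/hcvgP => e /h[N hN]; exists N => k /hN.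
  by apply: le_lt_trans; apply: VH; exact: (linsubB cS).
have xx : x = x' by apply: (hcvg_unique HH _ _ _ ux) => //; exact: VH_cvg.
rewrite -{x'}xx in Vx' ux'.
have Mu : hcvg H (fun k => M (u k)) (M x).
  apply/hcvgP => e; have /hcvgP h := ux'; move=> /h[N hN]; exists N => k /hN.
  apply: le_lt_trans; have -> : M (u k) - M x = M (u k - x).
    by rewrite addrC -scaleN1r -M_lin// scaleN1r addrC.
  by apply: M_le; exact: (linsubB cS).
(* The right-hand side is the limit of [L u_k]; its preimage [z] under [L] turns out to be the limit
   of [u_k]. *)
have [z Dz Lz] := L_surj (l *: y + (- (2 * 'i * l)) *: M x + l ^+ 2 *: x).
have Lu : hcvg H (fun k => L (u k)) (L z).
  rewrite Lz (_ : (fun k => _) = (fun k =>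
      (pencil l (u k) + (- (2 * 'i * l)) *: M (u k)) + l ^+ 2 *: u k)).
    by apply: (hcvgD HH) => //; [apply: (hcvgD HH) => //|]; exact: (hcvgZ HH).
  by apply/funext => k; rewrite /pencil scaleNr addrAC subrK addrK.
have uz : hcvg V u z.
  apply/hcvgP => e e0; have /hcvgP h := Lu.
  have [N hN] := h (cL * e) (mulr_gt0 cL_gt0 e0); exists N => k /hN.
  move=> hk; rewrite -(ltr_pM2l cL_gt0); apply: le_lt_trans hk.
  have -> : L (u k) - L z = L (u k - z).
    by rewrite addrC -scaleN1r -L_lin// scaleN1r addrC.
  by apply: L_le; exact: linsubB.
have xz : x = z by apply: (hcvg_unique HV _ _ _ ux' uz) => //; exact: DV.
rewrite xz; split; first by [].
rewrite /= op_minusS// /pencil Lz xz scaleNr addrAC addrK subrK.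
by rewrite scalerA mulVf// scale1r.
Qed.

(** Forwards, [(u_k, l u_k)] is sent to a pair with first entry 0 and second entry [pencil l u_k].
    Backwards, the first component [F k] converges in [V], so [M (F k)] converges in [H] and can be
    subtracted from the second component, leaving the pencil at the first entry of [u k]. *)
Lemma closed_rangeE l : l != 0 ->
  closed_range (op_minus A l) <-> closed_range (op_minus (S l) 0).
Proof.
move=> l0; split=> h.
  move=> u y; rewrite /= domS => Du _ Su.
  have Vu k := DV (Du k); have Vlu k := linsubZ cS l (Vu k).
  have [||| [x z]] := h (fun k => (u k, l *: u k)) (0, l *: y).
  - by move=> k; rewrite /= domA; split; [exact: Du|exact: Vlu].
  - by split=> //; exact: cS.1.
  - rewrite (_ : (fun k => _) = (fun k => (0, l *: (S l (u k) - 0 *: u k)))).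
      apply/(hcvg_direct_sum HV HH) => /=.
      + by move=> k; split=> //; exact: cS.1.
      + by split=> //; exact: cS.1.
      split; last exact: (hcvgZ HH).
      by apply/hcvgP => e e0; exists 0%N => k _; rewrite subrr ihnorm0.
    apply/funext => k; rewrite /op_minus /= op_minusS// (op_minusA l (Du k) (Vlu k))
      subrr M_zero !scaler0.
    by rewrite addr0 subr0 scalerA divff// scale1r.
  rewrite /= domA => -[/= Dx Vz]; rewrite op_minusA// => -[->].
  rewrite M_zero !scaler0 addr0 subr0 => px; exists x => //.
  by rewrite op_minusS// px scalerA mulVf// scale1r.
move=> u [f g]; rewrite /= domA => du [/= Vf _] Au.
have AS := carrier_sub HA.
have cAu k : carrier (direct_sum V H) (op_minus A l (u k)).
  move: (du k); case: (u k) => [x y] [/= Dx Vy].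
  change (carrier (direct_sum V H) (A (x, y) - l *: ((x, y) : E * E))).
  rewrite op_minusA//; split=> //=.
  by apply: (linsubB cS) => //; apply: (linsubZ cS); exact: DV.
have /(hcvg_direct_sum HV HH)[//|//|] := Au.
set F := fun k => (op_minus A l (u k)).1; set G := fun k => _.2 => /= Ff Gg.
have VF k : cV (F k) by have [] := cAu k.
have VH_cvg (v : nat -> E) (z : E) : (forall k, cV (v k)) -> cV z ->
    hcvg V v z -> hcvg H v z.
  move=> Vv Vz /hcvgP h'; apply/hcvgP => e /h'[N hN]; exists N => k /hN.
  by apply: le_lt_trans; apply: VH; exact: (linsubB cS).
have Mu : hcvg H (fun k => M (F k)) (M f).
  apply/hcvgP => e; have /hcvgP h' := Ff; move=> /h'[N hN]; exists N => k /hN.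
  apply: le_lt_trans; have -> : M (F k) - M f = M (F k - f).
    by rewrite addrC -scaleN1r -M_lin// scaleN1r addrC.
  by apply: M_le; exact: (linsubB cS).
have [||| x] := h (fun k => (u k).1) (l^-1 *: (g + (- (2 * 'i)) *: M f + l *: f)).
- by move=> k; rewrite /= domS; have [] := du k.
- by [].
- rewrite (_ : (fun k => _) =
     (fun k => l^-1 *: (G k + (- (2 * 'i)) *: M (F k) + l *: F k))).
    apply: (hcvgZ HH) => //; apply: (hcvgD HH) => //; last first.
      by apply: (hcvgZ HH) => //; exact: VH_cvg.
    by apply: (hcvgD HH) => //; exact: (hcvgZ HH).
  apply/funext => k; rewrite /F /G; move: (du k); case: (u k) => x y [/= Dx Vy].
  have e := op_minusA l Dx Vy; rewrite /op_minus /= op_minusS//.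
  rewrite (congr1 fst e : (A (x, y)).1 - l *: x = _).
  rewrite (congr1 snd e : (A (x, y)).2 - l *: y = _) /=; congr (_ *: _).
  by rewrite scaleNr addrAC subrK addrK.
rewrite /= domS => Dx; rewrite op_minusS// => px.
have {}px : pencil l x = g + (- (2 * 'i)) *: M f + l *: f.
  by apply: (@scalerI _ _ l^-1); rewrite ?invr_eq0.
have Vx := DV Dx.
have Vy : cV (f + l *: x) by apply: (linsubD cS) => //; exact: (linsubZ cS).
exists (x, f + l *: x) => //.
by rewrite /= op_minusA// addrK px scaleNr addrAC addrK subrK.
Qed.

Lemma op_kernelA l x y : op_kernel (op_minus A l) (x, y) <->
  [/\ D x, y = l *: x & pencil l x = 0].
Proof.
rewrite /op_kernel /= domA; split=> [[[/= Dx Vy]]|[Dx -> px]].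
  rewrite op_minusA// => -[f0]; rewrite f0 M_zero !scaler0 addr0 subr0.
  by split=> //; move/eqP: f0; rewrite subr_eq0 => /eqP.
have Vlx := linsubZ cS l (DV Dx); split=> //.
by rewrite /op_minus /= op_minusA// subrr M_zero !scaler0 px addr0 subr0.
Qed.

Lemma op_kernelS l x : l != 0 -> op_kernel (op_minus (S l) 0) x <->
  D x /\ pencil l x = 0.
Proof.
move=> l0; rewrite /op_kernel /= domS; split=> -[Dx]; rewrite op_minusS//.
  by move=> e; split=> //; apply: (@scalerI _ _ l^-1); rewrite ?invr_eq0// e scaler0.
by move=> ->; rewrite scaler0.
Qed.

(** The map [x -> (x, l x)] identifies the two kernels, with the first projection as inverse; either
    map transports a spanning family. *)
Lemma finite_dimE l : l != 0 -> finite_dimensional (op_kernel (op_minus A l)) <->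
  finite_dimensional (op_kernel (op_minus (S l) 0)).
Proof.
move=> l0; split=> -[k [b hb]].
  exists k, (fun i => (b i).1) => x /(op_kernelS _ l0)[Dx px].
  have [|c e] := hb (x, l *: x); first exact/op_kernelA.
  exists c; have := congr1 fst e; rewrite /= => ->.
  by rewrite (raddf_sum (@fst E E)).
exists k, (fun i => (b i, l *: b i)) => -[x y] /op_kernelA[Dx -> px].
have [|c e] := hb x; first exact/op_kernelS.
exists c; rewrite [RHS]surjective_pairing (raddf_sum (@fst E E)).
rewrite (raddf_sum (@snd E E)) /= -e; congr pair; rewrite e scaler_sumr.
by apply: eq_bigr => i _; rewrite !scalerA mulrC.
Qed.

(** For [l != 0] closedness holds on both sides, so only range and kernel have to be compared; at 0
    the bijectivity of [A] settles both. *)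
Lemma essential_spectrumE :
  essential_spectrum2 _ A = family_spectrum (@essential_spectrum2 R) S.
Proof.
have dT p : dom A p -> carrier (direct_sum V H) p /\
    carrier (direct_sum V H) (A p).
  by case: p => x y; rewrite domA => -[/= Dx Vy]; rewrite actA//; split=> //;
    split=> //; exact: DV.
have cA l : closed_operator (op_minus A l) := closed_op_minus dT A_closed.
apply/seteqP; split=> l.
  move=> nA; have [l0|l0] := eqVneq l 0.
    rewrite l0 in nA.
    exfalso; apply: nA; split; first exact: cA.
      move=> u y _ cy _; have [[_ _ sur] _] := resolventA0.
      exact: sur.
    exists 0%N, (fun=> 0) => -[x y] /op_kernelA[Dx ->].
    rewrite scale0r; have [_ inj _] := pencil_inv0 => /(inj _ Dx) ->.
    by exists (fun=> 0); rewrite big_ord0.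
  split=> // -[_ /(closed_rangeE l0) cr /(finite_dimE l0) fd].
  by apply: nA; split=> //; exact: cA.
move=> [l0 nS] [_ /(closed_rangeE l0) cr /(finite_dimE l0) fd].
by apply: nS; split=> //; exact: S_closed.
Qed.

End pencil.

(** * Real and complex square integrable functions *)

Section real_L2.
Context d (T : measurableType d) (R : realType).
Variable mu : {measure set T -> \bar R}.
Implicit Types u v w : T -> R.

Local Notation L2r := (Lfun mu 2%:E).

Lemma Lfun2_measurable u : u \in L2r -> measurable_fun setT u.
Proof. by rewrite inE => /andP[]; rewrite inE. Qed.

Lemma Lfun2_sqr_lty u : u \in L2r -> (\int[mu]_x (u x ^+ 2)%:E < +oo)%E.
Proof.
move=> /Lfun2_integrable_sqr /integrableP[_]; apply: le_lt_trans.
rewrite le_eqVlt; apply/orP; left; apply/eqP; apply: eq_integral => x _ /=.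
by rewrite ger0_norm// sqr_ge0.
Qed.

Lemma measurable_sqr u : measurable_fun setT u ->
  measurable_fun setT (EFin \o (fun x => u x ^+ 2)).
Proof. by move=> mu0; apply/measurable_EFinP; exact: measurable_funX. Qed.

Lemma Lfun2I u : measurable_fun setT u ->
  (\int[mu]_x (u x ^+ 2)%:E < +oo)%E -> u \in L2r.
Proof.
move=> mu0 ufin; rewrite inE; apply/andP; split; rewrite inE//=.
rewrite /finite_norm unlock /= poweR_lty//.
rewrite (eq_integral (fun x => (u x ^+ 2)%:E))// => x _.
by rewrite /= powR_mulrn ?normr_ge0// real_normK// num_real.
Qed.

Lemma Lfun2_le u v : measurable_fun setT u -> (forall x, `|u x| <= `|v x|) ->
  v \in L2r -> u \in L2r.
Proof.
move=> mu0 uv vL; apply: Lfun2I => //.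
apply: le_lt_trans (Lfun2_sqr_lty vL); apply: ge0_le_integral => //.
- by move=> x _; rewrite lee_fin sqr_ge0.
- exact: measurable_sqr.
- exact/measurable_sqr/Lfun2_measurable.
- move=> x _; rewrite lee_fin -(real_normK (num_real (u x))).
  by rewrite -(real_normK (num_real (v x))) lerXn2r ?nnegrE.
Qed.

Lemma Lfun2_ae u v : measurable_fun setT u -> {ae mu, forall x, u x = v x} ->
  v \in L2r -> u \in L2r.
Proof.
move=> mu0 uv vL; apply: Lfun2I => //.
rewrite (ge0_ae_eq_integral (g := fun x => (v x ^+ 2)%:E))//.
- exact: Lfun2_sqr_lty.
- exact: measurable_sqr.
- exact/measurable_sqr/Lfun2_measurable.
- by move=> x _; rewrite lee_fin sqr_ge0.
- by move=> x _; rewrite lee_fin sqr_ge0.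
- by apply: filterS uv => x -> _.
Qed.

Lemma Lfun2_0 : (fun=> 0) \in L2r.
Proof. exact: (Lfun_submod_closed mu (lee1n 2)).1. Qed.

Lemma Lfun2D u v : u \in L2r -> v \in L2r -> (fun x => u x + v x) \in L2r.
Proof.
move=> uL vL; have := (Lfun_submod_closed mu (lee1n 2)).2 1 u v uL vL.
by rewrite scale1r.
Qed.

Lemma Lfun2Z a u : u \in L2r -> (fun x => a * u x) \in L2r.
Proof.
move=> uL; have := (Lfun_submod_closed mu (lee1n 2)).2 a u _ uL Lfun2_0.
rewrite (_ : _ + _ = (fun x => a * u x))//.
by apply/funext => x; rewrite /= fctE addr0.
Qed.

Lemma Lfun2B u v : u \in L2r -> v \in L2r -> (fun x => u x - v x) \in L2r.
Proof.
move=> uL vL; have := Lfun2D uL (Lfun2Z (-1) vL).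
by rewrite (_ : (fun x => _) = (fun x => u x - v x))//; apply/funext => x;
  rewrite mulN1r.
Qed.

Lemma integrable_mul u v : u \in L2r -> v \in L2r ->
  mu.-integrable setT (fun x => (u x * v x)%:E).
Proof. by move=> uL vL; exact/Lfun1_integrable/Lfun2_mul_Lfun1. Qed.

Lemma sqr_integralE u : u \in L2r ->
  (\int[mu]_x (u x ^+ 2)%:E = (\int[mu]_x (u x ^+ 2))%:E)%E.
Proof.
move=> uL; rewrite /Rintegral fineK// ge0_fin_numE ?Lfun2_sqr_lty//.
by apply: integral_ge0 => x _; rewrite lee_fin sqr_ge0.
Qed.

Lemma sqr_addr_le (a b : R) : (a + b) ^+ 2 <= 2 * a ^+ 2 + 2 * b ^+ 2.
Proof. by have := sqr_ge0 (a - b); lra. Qed.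

Lemma integral_sqrD_le u v : u \in L2r -> v \in L2r ->
  (\int[mu]_x ((u x + v x) ^+ 2)%:E <=
   2%:E * \int[mu]_x (u x ^+ 2)%:E + 2%:E * \int[mu]_x (v x ^+ 2)%:E)%E.
Proof.
move=> uL vL; have mu0 := Lfun2_measurable uL; have mv := Lfun2_measurable vL.
have sq0 w x : (0 <= (w x ^+ 2)%:E)%E by rewrite lee_fin sqr_ge0.
rewrite -!ge0_integralZl//; try exact: measurable_sqr.
rewrite -ge0_integralD//.
- apply: ge0_le_integral => //.
  + by move=> x _; rewrite lee_fin sqr_ge0.
  + by apply: measurable_sqr; exact: measurable_funD.
  + by apply: emeasurable_funD; apply: measurable_funeM; exact: measurable_sqr.
  + by move=> x _; rewrite -!EFinM -EFinD lee_fin sqr_addr_le.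
- by move=> x _; rewrite mule_ge0.
- by apply: measurable_funeM; exact: measurable_sqr.
- by move=> x _; rewrite mule_ge0.
- by apply: measurable_funeM; exact: measurable_sqr.
Qed.

(* Summability of [4^k g_k]: Borel-Cantelli with a rate. *)
Lemma ae_geometric_bound (g : nat -> T -> R) :
  (forall k, measurable_fun setT (g k)) -> (forall k x, 0 <= g k x) ->
  (forall k, \int[mu]_x (g k x)%:E <= (4 ^- k / (2 ^ k.+1)%:R)%:E)%E ->
  exists G, [/\ measurable G, mu (~` G) = 0 &
    forall x, G x -> exists s : R, forall k, g k x <= s * 4 ^- k].
Proof.
move=> mg g0 gi; pose h k x := ((4 ^+ k) * g k x)%:E.
have h0 k x : (0 <= h k x)%E by rewrite lee_fin mulr_ge0// exprn_ge0.
have mh k : measurable_fun setT (h k).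
  by apply/measurable_EFinP; exact: measurable_funM.
pose F x := (\sum_(0 <= k <oo) h k x)%E.
have mF : measurable_fun setT F.
  exact: (@ge0_emeasurable_sum _ _ _ _ _ xpredT).
have F0 x : (0 <= F x)%E by exact: nneseries_ge0.
have intF : (\int[mu]_x F x <= 1%:E)%E.
  rewrite integral_nneseries//.
  (* With the weight [4 ^+ k] the k-th integral is at most [2 ^- k.+1], and these sum to 1; so [F]
     is integrable and finite almost everywhere. *)
  apply: le_trans (epsilon_trick0 xpredT ler01).
  apply: lee_nneseries => [k _ _|k _]; first exact: integral_ge0.
  under eq_integral do rewrite /h EFinM.
  rewrite ge0_integralZl_EFin ?exprn_ge0//; last 2 first.
  - by move=> x _; rewrite lee_fin.
  - exact/measurable_EFinP.
  apply: (@le_trans _ _ ((4 ^+ k)%:E * (4 ^- k / (2 ^ k.+1)%:R)%:E)%E).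
    by rewrite lee_wpmul2l// lee_fin exprn_ge0.
  by rewrite -EFinM lee_fin mulrA mulfV// expf_neq0.
have iF : mu.-integrable setT F.
  apply/integrableP; split => //.
  under eq_integral do rewrite gee0_abs//.
  exact: le_lt_trans intF (ltry _).
exists [set x | (F x < +oo)%E]; split.
- rewrite -[X in measurable X]setTI.
  by apply: emeasurable_fun_infty_o => //.
- have [N [mN N0 sN]] := integrable_ae measurableT iF.
  apply/eqP; rewrite -measure_le0 -N0 le_measure ?inE//.
    apply: measurableC; rewrite -[X in measurable X]setTI.
    exact: emeasurable_fun_infty_o.
  move=> x /= Fx; apply: sN => /= /(_ I).
  by rewrite ge0_fin_numE.
move=> x /= Fx; exists (fine (F x)) => k.
rewrite ler_pdivlMr ?exprn_gt0// mulrC -lee_fin fineK ?ge0_fin_numE//.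
rewrite -/(h k x) /F (nneseriesD1 (n := k))//.
  by rewrite leeDl// nneseries_ge0.
Qed.

Lemma limn_einf_le (a : nat -> \bar R) (c : \bar R) (N : nat) :
  (forall k, (N <= k)%N -> (a k <= c)%E) -> (limn_einf a <= c)%E.
Proof.
move=> ac; rewrite limn_einf_lim; apply: lime_le.
  exact: is_cvg_einfs.
by exists 0%N => // k _; apply: (le_trans (y := a (maxn k N)));
  [apply: ereal_inf_lbound; exists (maxn k N) => //=; exact: leq_maxl|
   apply: ac; exact: leq_maxr].
Qed.

Lemma ae_setP (G : set T) (P : T -> Prop) : measurable G -> mu (~` G) = 0 ->
  (forall x, G x -> P x) -> {ae mu, forall x, P x}.
Proof.
move=> mG G0 GP; exists (~` G); split => //; first exact: measurableC.
by move=> x /= nP Gx; apply: nP; exact: GP.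
Qed.

(** Squared distances, kept as extended real integrals so that Fatou applies directly. *)
Definition cauchy2 (u : nat -> T -> R) := forall e : R, 0 < e ->
  exists N, forall i j, (N <= i)%N -> (N <= j)%N ->
    (\int[mu]_x ((u i x - u j x) ^+ 2)%:E <= e%:E)%E.

Definition cvg2 (u : nat -> T -> R) v := forall e : R, 0 < e ->
  exists N, forall k, (N <= k)%N ->
    (\int[mu]_x ((u k x - v x) ^+ 2)%:E <= e%:E)%E.

(** The rate asked for by [ae_geometric_bound]: [4 ^- k] becomes [2 ^- k] after a square root, and
    the other factor makes the integrals summable. *)
Let rate k : R := 4 ^- k / (2 ^ k.+1)%:R.

Let rate_gt0 k : 0 < rate k.
Proof. by rewrite divr_gt0// ?invr_gt0 ?exprn_gt0// ltr0n expn_gt0. Qed.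

Lemma sqr_le_rate (a s : R) k : a ^+ 2 <= s * 4 ^- k ->
  `|a| <= Num.sqrt s * 2^-1 ^+ k.
Proof.
move=> h; have s0 : 0 <= s.
  by have := le_trans (sqr_ge0 a) h; rewrite pmulr_lge0// invr_gt0 exprn_gt0.
rewrite -(@ler_pXn2r _ 2)// ?nnegrE ?mulr_ge0 ?exprn_ge0 ?sqrtr_ge0 ?invr_ge0//.
rewrite real_normK ?num_real// exprMn sqr_sqrtr//; apply: le_trans h _.
rewrite -exprVn ler_wpM2l// -exprM mulnC exprM.
by rewrite (_ : 2^-1 ^+ 2 = 4^-1)//; field.
Qed.

(** The indices [n k] are chosen for the decay [rate k] of the squared distance alone and need not
    increase; the pointwise distance is then geometric outside a null set. *)
Lemma cvg2_ae_subseq (u : nat -> T -> R) v :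
  (forall k, u k \in L2r) -> v \in L2r -> cvg2 u v ->
  exists n : nat -> nat, {ae mu, forall x, (fun k => u (n k) x) @ \oo --> v x}.
Proof.
move=> uL vL uv.
have /choice[n hn] k : exists N, forall j, (N <= j)%N ->
    (\int[mu]_x ((u j x - v x) ^+ 2)%:E <= (rate k)%:E)%E.
  exact: uv (rate_gt0 k).
exists n; pose g k x := (u (n k) x - v x) ^+ 2.
have mg k : measurable_fun setT (g k).
  by apply: measurable_funX; apply: measurable_funB; exact: Lfun2_measurable.
have [k x|k|G [mG G0 GP]] := ae_geometric_bound mg.
- by rewrite sqr_ge0.
- exact: (hn k _ (leqnn _)).
apply: (ae_setP mG G0) => x /GP[s hs].
have hb k : `|u (n k) x - v x| <= geometric (Num.sqrt s) 2^-1 k.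
  exact: sqr_le_rate (hs k).
apply/cvgrPdistC_le => e e0.
have h21 : `|2^-1 : R| < 1 by rewrite ger0_norm// invf_lt1// ltr1n.
have /cvgrPdistC_le/(_ e e0) := cvg_geometric (Num.sqrt s) h21.
apply: filterS => k; rewrite subr0 => h.
exact: le_trans (hb k) (le_trans (ler_norm _) h).
Qed.

(** Riesz-Fischer: a fast subsequence converges geometrically off a null set, and Fatou bounds its
    distance to the pointwise limit. *)
Lemma Lfun2_complete (u : nat -> T -> R) :
  (forall k, u k \in L2r) -> cauchy2 u -> exists2 v, v \in L2r & cvg2 u v.
Proof.
move=> uL uc; have /choice[N hN] k := uc _ (rate_gt0 k).
(* Indices that dominate [N k] and are monotone in [k]. *)
pose m k := (k + \sum_(i < k.+1) N i)%N.
have Nm k : (N k <= m k)%N by rewrite /m big_ord_recr/= addnA leq_addl.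
have mS : {homo m : j k / (j <= k)%N}.
  apply: (homo_leq leqnn leq_trans) => k.
  by rewrite /m [in leqRHS]big_ord_recr/= leq_add// leq_addr.
pose w k := u (m k).
have wL k : w k \in L2r by exact: uL.
have mw k := Lfun2_measurable (wL k).
have wr k l : (k <= l)%N ->
    (\int[mu]_x ((w k x - w l x) ^+ 2)%:E <= (rate k)%:E)%E.
  by move=> kl; apply: hN => //; exact: leq_trans (Nm k) (mS _ _ kl).
pose g k x := (w k x - w k.+1 x) ^+ 2.
have mg k : measurable_fun setT (g k).
  by apply: measurable_funX; exact: measurable_funB.
have [k x|k|G [mG G0 GP]] := ae_geometric_bound mg.
- by rewrite sqr_ge0.
- exact: wr.
have h21 : `|2^-1 : R| < 1 by rewrite ger0_norm// invf_lt1// ltr1n.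
have Gcvg x : G x -> cvgn (fun k => w k x).
  move=> /GP[s hs]; have hb k : `|w k.+1 x - w k x| <= geometric (Num.sqrt s) 2^-1 k.
    by rewrite distrC; exact: sqr_le_rate (hs k).
  have : cvgn (series (telescope (fun k => w k x))).
    apply: normed_cvg; apply: (@series_le_cvg _ _ (geometric (Num.sqrt s) 2^-1)) => //.
    - by move=> k; rewrite /= normr_ge0.
    - by move=> k; rewrite /geometric /= mulr_ge0 ?sqrtr_ge0// exprn_ge0.
    - exact: is_cvg_geometric_series.
  rewrite telescopeK => /(is_cvgD (is_cvg_cst (w 0%N x))).
  rewrite (_ : _ + _ = (fun k => w k x))//.
  by apply/funext => k; rewrite !fctE addrC subrK.
(* Set to zero off [G], the sequence converges everywhere, so its limit is measurable. *)
pose w' k := (w k) \_ G.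
have mw' k : measurable_fun setT (w' k).
  by apply/(measurable_restrictT _ mG)/measurable_funTS; exact: mw.
have w'cvg x : cvgn (fun k => w' k x).
  have [xG|xG] := boolP (x \in G).
    suff -> : w'^~ x = w^~ x by exact: Gcvg (set_mem xG).
    by apply/funext => k; rewrite /w' /patch xG.
  suff -> : w'^~ x = (fun=> 0) by exact: is_cvg_cst.
  by apply/funext => k; rewrite /w' /patch (negbTE xG).
pose f x := limn (fun k => w' k x).
have mf : measurable_fun setT f.
  by apply: (measurable_fun_cvg mw') => x _; exact: w'cvg.
have fG x : G x -> (fun k => w k x) @ \oo --> f x.
  move=> Gx; suff <- : w'^~ x = w^~ x by exact: w'cvg.
  by apply/funext => k; rewrite /w' /patch (mem_set Gx).
have wf k : (\int[mu]_x ((w k x - f x) ^+ 2)%:E <= (rate k)%:E)%E.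
  pose h l x := ((w' k x - w' l x) ^+ 2)%:E.
  have mh l : measurable_fun setT (h l).
    by apply: measurable_sqr; exact: measurable_funB.
  have h0 l x : setT x -> (0 <= h l x)%E by rewrite lee_fin sqr_ge0.
  have hE x : limn_einf (h^~ x) = ((w' k x - f x) ^+ 2)%:E.
    have hx : (h^~ x) @ \oo --> ((w' k x - f x) ^+ 2)%:E.
      apply: cvg_EFin; first exact: nearW.
      rewrite /comp /=; under eq_fun do rewrite expr2.
      rewrite expr2; apply: cvgM; apply: cvgB; by [exact: cvg_cst|exact: w'cvg].
    by rewrite is_cvg_limn_einfE; [exact: (cvg_lim _ hx)|exact: cvgP hx].
  have -> : (\int[mu]_x ((w k x - f x) ^+ 2)%:E = \int[mu]_x limn_einf (h^~ x))%E.
    under [RHS]eq_integral do rewrite hE.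
    apply: ge0_ae_eq_integral => //.
    - by apply: measurable_sqr; exact: measurable_funB.
    - by apply: measurable_sqr; exact: measurable_funB.
    - by move=> x _; rewrite lee_fin sqr_ge0.
    - by move=> x _; rewrite lee_fin sqr_ge0.
    by apply: (ae_setP mG G0) => x Gx _; rewrite /w' /patch (mem_set Gx).
  apply: le_trans (fatou mu measurableT mh h0) _.
  apply: (@limn_einf_le _ _ k) => l kl; apply: le_trans (wr _ _ kl).
  apply: ge0_le_integral => //.
  - by move=> x _; exact: h0.
  - by apply: measurable_sqr; exact: measurable_funB.
  - move=> x _; rewrite /h /w' /patch; case: ifPn => // _.
    by rewrite subrr expr0n lee_fin sqr_ge0.
have wfL k : (fun x => w k x - f x) \in L2r.
  apply: Lfun2I; first exact: measurable_funB.
  exact: le_lt_trans (wf k) (ltry _).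
exists f.
  have := Lfun2B (wL 0%N) (wfL 0%N).
  by rewrite (_ : (fun x => _) = f)//; apply/funext => x; rewrite subKr.
move=> e e0; have e4 : 0 < e / 4 by rewrite divr_gt0.
have [k hk] : exists k, forall q, (k <= q)%N -> rate q <= e / 4.
  have /cvgrPdistC_le/(_ _ e4)[k _ hk] := cvg_geometric 1 h21.
  exists k => q /hk; rewrite /= subr0 /geometric /= mul1r => h.
  apply: le_trans (le_trans (ler_norm _) h).
  rewrite /rate -exprVn ler_pdivrMr ?ltr0n ?expn_gt0//.
  apply: (@le_trans _ _ (2^-1 ^+ q)).
    by rewrite lerXn2r ?nnegrE// lef_pV2 ?posrE// ler_nat.
  by rewrite ler_peMr ?exprn_ge0// ler1n expn_gt0.
have [M hM] := uc _ e4; pose q := maxn M k.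
exists M => j Mj.
have -> : (fun x => ((u j x - f x) ^+ 2)%:E) =
    (fun x => (((u j x - w q x) + (w q x - f x)) ^+ 2)%:E).
  by apply/funext => x; rewrite addrA subrK.
apply: le_trans (integral_sqrD_le _ _) _ => //; first exact: Lfun2B.
rewrite [e](_ : e = 2 * (e / 4) + 2 * (e / 4)); last by field.
rewrite (EFinD (2 * (e / 4))) (EFinM 2) leeD// lee_wpmul2l//.
  apply: hM => //; apply: leq_trans (leq_addr _ _); exact: leq_maxl.
by apply: le_trans (wf q) _; rewrite lee_fin hk// leq_maxr.
Qed.

End real_L2.

(** * The complex space L2 over a measure space *)

Section complex_L2.
Context d (T : measurableType d) (R : realType).
Variable mu : {measure set T -> \bar R}.
Local Notation L2r := (Lfun mu 2%:E).
Local Notation L2c := (L2 mu).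
Implicit Types (f g h : L2 mu) (u v : T -> R).

Definition L2re f : T -> R := fun x => Re (f x).
Definition L2im f : T -> R := fun x => Im (f x).

Lemma cLfun2E (F : T -> R[i]) : (F \in cLfun2 mu) =
  (Re \o F \in L2r) && (Im \o F \in L2r).
Proof. by []. Qed.

Lemma L2_fun_cLfun2 f : (f : T -> R[i]) \in cLfun2 mu.
Proof. exact: (valP (repr f)). Qed.

Lemma L2reP f : L2re f \in L2r.
Proof. by have := L2_fun_cLfun2 f; rewrite cLfun2E => /andP[]. Qed.

Lemma L2imP f : L2im f \in L2r.
Proof. by have := L2_fun_cLfun2 f; rewrite cLfun2E => /andP[]. Qed.

Lemma L2_pi_ae (g : cLfun2Type mu) :
  {ae mu, forall x, L2_fun (\pi_(L2 mu)%qT g) x = g x}.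
Proof.
have : (\pi_(L2 mu) (repr (\pi_(L2 mu) g)) == \pi_(L2 mu) g)%qT by rewrite reprK.
rewrite -Quotient.idealrBE => /asboolP; apply: filterS => x.
by rewrite (_ : (repr _ - g) x = repr (\pi_(L2 mu) g)%qT x - g x)// => /eqP;
  rewrite subr_eq0 => /eqP.
Qed.

Lemma L2_eqP f g : f = g <-> {ae mu, forall x, f x = g x}.
Proof.
split=> [->|fg]; first exact: nearW.
rewrite -(reprK f) -(reprK g); apply/eqP; rewrite -Quotient.idealrBE.
apply/asboolP; apply: filterS fg => x fg.
by rewrite (_ : (repr f - repr g) x = f x - g x)// fg subrr.
Qed.

Lemma L2_funDZ a f g : {ae mu, forall x, (a *: f + g : L2 mu) x = a * f x + g x}.
Proof.
have -> : a *: f + g = \pi_(L2 mu)%qT (a *: repr f + repr g).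
  rewrite -{1}(reprK f) -{1}(reprK g).
  by rewrite -[a *: _]/(L2_scale a _) L2_piZ -raddfD.
exact: L2_pi_ae.
Qed.

Lemma L2_exists (F : T -> R[i]) : F \in cLfun2 mu ->
  exists f, {ae mu, forall x, f x = F x}.
Proof. by move=> FL; exists (\pi_(L2 mu)%qT (CLfun2 FL)); exact: L2_pi_ae. Qed.

Lemma cLfun2_ae (F : T -> R[i]) f :
  measurable_fun setT (fun x => Re (F x)) ->
  measurable_fun setT (fun x => Im (F x)) ->
  {ae mu, forall x, f x = F x} -> F \in cLfun2 mu.
Proof.
move=> mr mi fF; rewrite cLfun2E; apply/andP; split.
  by apply: Lfun2_ae (L2reP f) => //; apply: filterS fF => x; rewrite /L2re /= => ->.
by apply: Lfun2_ae (L2imP f) => //; apply: filterS fF => x; rewrite /L2im /= => ->.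
Qed.

Lemma Rintegral_ae u v : measurable_fun setT u -> measurable_fun setT v ->
  {ae mu, forall x, u x = v x} -> \int[mu]_x u x = \int[mu]_x v x.
Proof.
move=> mu0 mv uv; congr fine; apply: ae_eq_integral => //.
- exact/measurable_EFinP.
- exact/measurable_EFinP.
- by apply: filterS uv => x -> _.
Qed.

Definition ip u v : R := \int[mu]_x (u x * v x).

Lemma ipC u v : ip u v = ip v u.
Proof. by apply: eq_Rintegral => x _; rewrite mulrC. Qed.

Lemma ipDl u v w : u \in L2r -> v \in L2r -> w \in L2r ->
  ip (fun x => u x + v x) w = ip u w + ip v w.
Proof.
move=> uL vL wL; rewrite /ip.
under eq_Rintegral do rewrite mulrDl.
by rewrite RintegralD//; exact: integrable_mul.
Qed.

Lemma ipZl a u w : u \in L2r -> w \in L2r ->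
  ip (fun x => a * u x) w = a * ip u w.
Proof.
move=> uL wL; rewrite /ip; under eq_Rintegral do rewrite -mulrA.
by rewrite RintegralZl//; exact: integrable_mul.
Qed.

Lemma ip_ae u u' v v' : u \in L2r -> u' \in L2r -> v \in L2r -> v' \in L2r ->
  {ae mu, forall x, u x = u' x} -> {ae mu, forall x, v x = v' x} ->
  ip u v = ip u' v'.
Proof.
move=> /Lfun2_measurable uL /Lfun2_measurable uL' /Lfun2_measurable vL.
move=> /Lfun2_measurable vL' uu vv; apply: Rintegral_ae.
- exact: measurable_funM.
- exact: measurable_funM.
by apply: filterS2 uu vv => x -> ->.
Qed.

Lemma ip_ge0 u : 0 <= ip u u.
Proof. by apply: Rintegral_ge0 => x _; rewrite -expr2 sqr_ge0. Qed.

Lemma ip_sqrE u : u \in L2r -> (\int[mu]_x (u x ^+ 2)%:E = (ip u u)%:E)%E.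
Proof. exact: sqr_integralE. Qed.

Lemma ip_eq0 u : u \in L2r -> ip u u = 0 -> {ae mu, forall x, u x = 0}.
Proof.
move=> uL u0; have := ip_sqrE uL; rewrite u0 => i0.
have mu0 := Lfun2_measurable uL.
have : (\int[mu]_x `|(u x ^+ 2)%:E| = 0)%E.
  by rewrite -[RHS]i0; apply: eq_integral => x _; rewrite gee0_abs// lee_fin sqr_ge0.
move=> /(ae_eq_integral_abs mu measurableT (measurable_sqr mu0)).
by apply: filterS => x /(_ I)[] /eqP; rewrite sqrf_eq0 => /eqP.
Qed.

Lemma L2_innerE f g : L2_inner f g =
  (ip (L2re f) (L2re g) + ip (L2im f) (L2im g))
  +i* (ip (L2im f) (L2re g) - ip (L2re f) (L2im g)).
Proof.
have [fr fi] := (L2reP f, L2imP f); have [gr gi] := (L2reP g, L2imP g).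
rewrite /L2_inner /cintegral; congr (_ +i* _).
  rewrite /ip -RintegralD//; [|exact: integrable_mul..].
  apply: eq_Rintegral => x _; rewrite /L2re /L2im.
  by case: (f x) (g x) => [a b] [a' b'] /=; rewrite mulrN opprK.
rewrite /ip -RintegralB//; [|exact: integrable_mul..].
apply: eq_Rintegral => x _; rewrite /L2re /L2im.
by case: (f x) (g x) => [a b] [a' b'] /=; rewrite mulrN addrC.
Qed.

Lemma L2reDZ a f g : {ae mu, forall x, L2re (a *: f + g) x =
  Re a * L2re f x + (- Im a) * L2im f x + L2re g x}.
Proof.
apply: filterS (L2_funDZ a f g) => x; rewrite /L2re /L2im => ->.
by case: a (f x) (g x) => [? ?] [? ?] [? ?] /=; rewrite mulNr.
Qed.

Lemma L2imDZ a f g : {ae mu, forall x, L2im (a *: f + g) x =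
  Re a * L2im f x + Im a * L2re f x + L2im g x}.
Proof.
apply: filterS (L2_funDZ a f g) => x; rewrite /L2re /L2im => ->.
by case: a (f x) (g x) => [? ?] [? ?] [? ?].
Qed.

Lemma ip_L2reDZ a f g u : u \in L2r -> ip (L2re (a *: f + g)) u =
  Re a * ip (L2re f) u - Im a * ip (L2im f) u + ip (L2re g) u.
Proof.
move=> uL; have [fr fi] := (L2reP f, L2imP f); have gr := L2reP g.
have Zr := Lfun2Z (Re a) fr; have Zi := Lfun2Z (- Im a) fi.
rewrite (ip_ae (L2reP _) (Lfun2D (Lfun2D Zr Zi) gr) uL uL (L2reDZ a f g)).
  by rewrite ipDl ?ipDl ?ipZl ?mulNr//; exact: Lfun2D.
exact: nearW.
Qed.

Lemma ip_L2imDZ a f g u : u \in L2r -> ip (L2im (a *: f + g)) u =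
  Re a * ip (L2im f) u + Im a * ip (L2re f) u + ip (L2im g) u.
Proof.
move=> uL; have [fr fi] := (L2reP f, L2imP f); have gi := L2imP g.
have Zi := Lfun2Z (Re a) fi; have Zr := Lfun2Z (Im a) fr.
rewrite (ip_ae (L2imP _) (Lfun2D (Lfun2D Zi Zr) gi) uL uL (L2imDZ a f g)).
  by rewrite ipDl ?ipDl ?ipZl//; exact: Lfun2D.
exact: nearW.
Qed.

(** The same data as [L2_space], for an arbitrary measure; for Lebesgue measure the two are
    convertible. *)
Definition L2_innerSpace : innerSpace R :=
  @InnerSpace R (L2 mu) setT (@L2_inner _ _ _ mu).

Lemma L2_space_innerE f g : inner L2_innerSpace f g =
  (ip (L2re f) (L2re g) + ip (L2im f) (L2im g))
  +i* (ip (L2im f) (L2re g) - ip (L2re f) (L2im g)).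
Proof. exact: L2_innerE. Qed.

Lemma L2_preHilbert : preHilbert L2_innerSpace.
Proof.
split.
- exact: (conj I (fun _ _ _ _ _ => I)).
- move=> a x y z _ _ _; rewrite !L2_space_innerE.
  rewrite !ip_L2reDZ ?ip_L2imDZ ?L2reP ?L2imP//.
  by case: a => [a b]; apply/eqP; rewrite eq_complex /=; apply/andP; split;
    apply/eqP; ring.
- move=> x y _ _; rewrite !L2_space_innerE.
  rewrite (ipC (L2re y)) (ipC (L2im y)) (ipC (L2im y)) (ipC (L2re y) (L2im x)).
  by congr (_ +i* _); rewrite opprB.
- by move=> x _; rewrite L2_space_innerE addr_ge0// ip_ge0.
- move=> x _; rewrite L2_space_innerE /= => /eqP.
  rewrite paddr_eq0 ?ip_ge0// => /andP[/eqP /(ip_eq0 (L2reP x)) r0].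
  move=> /eqP /(ip_eq0 (L2imP x)) i0; apply/L2_eqP.
  have := L2_pi_ae (0 : cLfun2Type mu).
  rewrite raddf0 => z0; near=> t.
  rewrite (near z0 t)// (_ : (0 : cLfun2Type mu) t = 0)//.
  have := near r0 t; have := near i0 t; rewrite /L2re /L2im.
  by case: (L2_fun x t) => a b /= -> // -> //.
Unshelve. all: by end_near.
Qed.

Lemma L2_hnormE f : hnorm L2_innerSpace f ^+ 2 =
  ip (L2re f) (L2re f) + ip (L2im f) (L2im f).
Proof. by rewrite (hnorm_sqr L2_preHilbert)// /rin L2_space_innerE. Qed.

Lemma L2_sqr_diff f g : hnorm L2_innerSpace (f - g) ^+ 2 =
  ip (fun x => L2re f x - L2re g x) (fun x => L2re f x - L2re g x) +
  ip (fun x => L2im f x - L2im g x) (fun x => L2im f x - L2im g x).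
Proof.
have er : {ae mu, forall x, L2re (f - g) x = L2re f x - L2re g x}.
  have := L2reDZ (-1) g f; rewrite scaleN1r addrC; apply: filterS => x ->.
  by rewrite (_ : Re (-1) = -1)// (_ : Im (-1) = 0) /= ?oppr0// mulN1r mul0r addr0
    addrC.
have ei : {ae mu, forall x, L2im (f - g) x = L2im f x - L2im g x}.
  have := L2imDZ (-1) g f; rewrite scaleN1r addrC; apply: filterS => x ->.
  by rewrite (_ : Re (-1) = -1)// (_ : Im (-1) = 0) /= ?oppr0// mulN1r mul0r addr0
    addrC.
rewrite L2_hnormE; congr (_ + _); apply: ip_ae => //;
  by [exact: L2reP|exact: L2imP|apply: Lfun2B; exact: L2reP|
      apply: Lfun2B; exact: L2imP].
Qed.

Lemma L2_hcvgP (u : nat -> L2 mu) f : hcvg L2_innerSpace u f <->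
  cvg2 mu (fun k => L2re (u k)) (L2re f) /\ cvg2 mu (fun k => L2im (u k)) (L2im f).
Proof.
have Lr k : (fun x => L2re (u k) x - L2re f x) \in L2r by apply: Lfun2B; exact: L2reP.
have Li k : (fun x => L2im (u k) x - L2im f x) \in L2r by apply: Lfun2B; exact: L2imP.
split=> [/hcvgP h|[h1 h2]].
  split=> e e0; have e' : 0 < Num.sqrt e by rewrite sqrtr_gt0.
    have [N hN] := h _ e'; exists N => k /hN hk.
    rewrite ip_sqrE// lee_fin; apply: (@le_trans _ _ (hnorm L2_innerSpace (u k - f)
      ^+ 2)).
      by rewrite L2_sqr_diff lerDl ip_ge0.
    by rewrite -[leRHS]sqr_sqrtr ?(ltW e0)// lerXn2r ?nnegrE ?hnorm_ge0 ?(ltW e')// ltW.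
  have [N hN] := h _ e'; exists N => k /hN hk.
  rewrite ip_sqrE// lee_fin; apply: (@le_trans _ _ (hnorm L2_innerSpace (u k - f) ^+
    2)).
    by rewrite L2_sqr_diff lerDr ip_ge0.
  by rewrite -[leRHS]sqr_sqrtr ?(ltW e0)// lerXn2r ?nnegrE ?hnorm_ge0 ?(ltW e')// ltW.
apply/hcvgP => e e0; have e4 : 0 < e ^+ 2 / 4 by rewrite divr_gt0// exprn_gt0.
have [N hN] := h1 _ e4; have [M hM] := h2 _ e4.
exists (maxn N M) => k; rewrite geq_max => /andP[/hN + /hM].
rewrite !ip_sqrE// !lee_fin => hr hi.
rewrite -(@ltr_pXn2r _ 2)// ?nnegrE ?hnorm_ge0 ?(ltW e0)//.
rewrite L2_sqr_diff; apply: le_lt_trans (lerD hr hi) _.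
have e20 : 0 < e ^+ 2 by rewrite exprn_gt0.
lra.
Qed.

Lemma L2_complete : hcomplete L2_innerSpace.
Proof.
move=> u _ uc.
have Lr i j : (fun x => L2re (u i) x - L2re (u j) x) \in L2r by apply: Lfun2B;
  exact: L2reP.
have Li i j : (fun x => L2im (u i) x - L2im (u j) x) \in L2r by apply: Lfun2B;
  exact: L2imP.
have [|r rL hr] := @Lfun2_complete _ _ _ mu (fun k => L2re (u k)) (fun k => L2reP _).
  move=> e e0; have e' : 0 < Num.sqrt e by rewrite sqrtr_gt0.
  have [N hN] := uc _ e'; exists N => i j Ni Nj; have hk := hN i j Ni Nj.
  rewrite ip_sqrE// lee_fin; apply: (@le_trans _ _ (hnorm L2_innerSpace (u i - u j)
    ^+ 2)).
    by rewrite L2_sqr_diff lerDl ip_ge0.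
  by rewrite -[leRHS]sqr_sqrtr ?(ltW e0)// lerXn2r ?nnegrE ?hnorm_ge0 ?(ltW e')// ltW.
have [|s sL hs] := @Lfun2_complete _ _ _ mu (fun k => L2im (u k)) (fun k => L2imP _).
  move=> e e0; have e' : 0 < Num.sqrt e by rewrite sqrtr_gt0.
  have [N hN] := uc _ e'; exists N => i j Ni Nj; have hk := hN i j Ni Nj.
  rewrite ip_sqrE// lee_fin; apply: (@le_trans _ _ (hnorm L2_innerSpace (u i - u j)
    ^+ 2)).
    by rewrite L2_sqr_diff lerDr ip_ge0.
  by rewrite -[leRHS]sqr_sqrtr ?(ltW e0)// lerXn2r ?nnegrE ?hnorm_ge0 ?(ltW e')// ltW.
have FL : (fun x => r x +i* s x) \in cLfun2 mu by rewrite cLfun2E; apply/andP; split.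
have [f fF] := L2_exists FL; exists f => //; apply/L2_hcvgP; split=> e e0.
  have [N hN] := hr e e0; exists N => k /hN; rewrite ip_sqrE;
    last exact: Lfun2B (L2reP _) rL.
  rewrite ip_sqrE; last by apply: Lfun2B; exact: L2reP.
  rewrite (ip_ae (u' := fun x => L2re (u k) x - L2re f x) (v' := fun x =>
    L2re (u k) x - L2re f x))//;
    try by [apply: Lfun2B => //; exact: L2reP|
    apply: filterS fF => x; rewrite /L2re => ->].
have [N hN] := hs e e0; exists N => k /hN; rewrite ip_sqrE;
  last exact: Lfun2B (L2imP _) sL.
rewrite ip_sqrE; last by apply: Lfun2B; exact: L2imP.
rewrite (ip_ae (u' := fun x => L2im (u k) x - L2im f x) (v' := fun x =>
  L2im (u k) x - L2im f x))//;
  try by [apply: Lfun2B => //; exact: L2imP|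
    apply: filterS fF => x; rewrite /L2im => ->].
Qed.

End complex_L2.

(** * Smooth functions *)

Section Ck.
Variables (R : realType) (E : normedModType R) (I : Type) (e : I -> E).
Implicit Types f g : E -> R.

(** Derivatives are taken along the directions [e] only, and the innermost one is peeled off first,
    so that sums, products and compositions go through by induction on [k]. Two families serve: the
    single direction 1 on the line, and the coordinate directions on R^n. *)
Fixpoint Ck (k : nat) f : Prop := continuous f /\
  if k is k'.+1 then forall i, (forall x, derivable f x (e i)) /\
    Ck k' (fun x => 'D_(e i) f x) else True.

Lemma Ck_cont k f : Ck k f -> continuous f.
Proof. by case: k => [|k] []. Qed.

Lemma CkS k f : Ck k.+1 f -> Ck k f.
Proof.
elim: k f => [|k IH] f /= [cf Df]; split=> // i.
by have [df Dk] := Df i; split=> //; exact: IH.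
Qed.

Lemma Ck_cst k (c : R) : Ck k (fun=> c).
Proof.
elim: k c => [|k IH] c /=; split=> //; try exact: cst_continuous.
move=> i; split=> [x|]; first exact: derivable_cst.
suff -> : 'D_(e i) (fun=> c) = (fun=> 0 : R) by exact: IH.
by apply/funext => x; exact: derive_cst.
Qed.

Lemma CkD k f g : Ck k f -> Ck k g -> Ck k (fun x => f x + g x).
Proof.
elim: k f g => [|k IH] f g /= [cf Df] [cg Dg]; split=> //.
- by move=> x; apply: cvgD; [exact: cf|exact: cg].
- by move=> x; apply: cvgD; [exact: cf|exact: cg].
move=> i; have [df Dk] := Df i; have [dg Dl] := Dg i.
split=> [x|]; first exact: derivableD.
rewrite (_ : (fun x => _) = (fun x => 'D_(e i) f x + 'D_(e i) g x)).
  exact: IH.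
by apply/funext => x; exact: deriveD.
Qed.

Lemma CkM k f g : Ck k f -> Ck k g -> Ck k (fun x => f x * g x).
Proof.
elim: k f g => [|k IH] f g /= [cf Df] [cg Dg]; split=> //.
- by move=> x; apply: cvgM; [exact: cf|exact: cg].
- by move=> x; apply: cvgM; [exact: cf|exact: cg].
move=> i; have [df Dk] := Df i; have [dg Dl] := Dg i.
split=> [x|]; first exact: derivableM.
rewrite (_ : (fun x => _) = (fun x => f x * 'D_(e i) g x + g x * 'D_(e i) f x)).
  by apply: CkD; apply: IH => //; exact: CkS.
by apply/funext => x; exact: deriveM.
Qed.

Lemma CkN k f : Ck k f -> Ck k (fun x => - f x).
Proof.
move=> fk; rewrite (_ : (fun x => _) = (fun x => (-1) * f x)).
  by apply: CkM => //; exact: Ck_cst.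
by apply/funext => x; rewrite mulN1r.
Qed.

Lemma CkV k f : (forall x, f x != 0) -> Ck k f -> Ck k (fun x => (f x)^-1).
Proof.
move=> f0; elim: k => [|k IH] /= [cf Df]; split=> //.
- by move=> x; apply: cvgV => //; exact: cf.
- by move=> x; apply: cvgV => //; exact: cf.
move=> i; have [df Dk] := Df i.
split=> [x|]; first exact: derivableV.
have fk : Ck k f by apply: CkS; split.
rewrite (_ : (fun x => _) = (fun x => - ((f x)^-1 * (f x)^-1 * 'D_(e i) f x))).
  by apply: CkN; apply: CkM => //; apply: CkM; exact: IH.
by apply/funext => x; rewrite deriveV// -invfM -expr2 /GRing.scale /= mulNr.
Qed.

Lemma Ck_prod (T : finType) (P : pred T) k (F : T -> E -> R) :
  (forall t, Ck k (F t)) -> Ck k (fun x => \prod_(t | P t) F t x).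
Proof.
move=> FC; rewrite (_ : (fun x => _) = \big[(fun f g x =>
  f x * g x)/(fun=> 1)]_(t | P t) F t).
  elim/big_ind : _ => //; [exact: Ck_cst|exact: CkM].
by apply/funext => x; elim/big_rec2 : _ => // t y f _ ->.
Qed.

End Ck.

Section Ck_comp.
Variables (R : realType) (E : normedModType R).

(** Only directional derivatives are known, so the chain rule is applied on a line, where the
    function has one variable. *)
Lemma is_derive_lineP (f : E -> R) x v (l : R) :
  is_derive x v f l <-> is_derive (0 : R) 1 (fun h : R => f (h *: v + x)) l.
Proof.
have e : 'D_1 (fun h : R => f (h *: v + x)) 0 = 'D_v f x.
  rewrite /derive; set a := (X in lim (X @ _)); set b := (X in _ = lim (X @ _)).
  suff -> : a = b by []; apply/funext => h.
  by rewrite /a /b /= addr0 scale0r add0r [_%:A]mulr1.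
split=> -[d1 d2]; split.
- by move/derivable1P : d1.
- by rewrite e.
- by apply/derivable1P.
- by rewrite -e.
Qed.

Lemma is_derive_comp_dir (r : R -> R) (f : E -> R) x v (df dr : R) :
  is_derive x v f df -> is_derive (f x) 1 r dr ->
  is_derive x v (fun y => r (f y)) (dr * df).
Proof.
move=> /is_derive_lineP dF hr; apply/is_derive_lineP.
apply: (@is_derive1_comp _ r (fun h : R => f (h *: v + x))).
by rewrite scale0r add0r.
Qed.

Lemma Ck_comp (I : Type) (e : I -> E) k (r : R -> R) (f : E -> R) :
  Ck (fun _ : unit => 1 : R) k r -> Ck e k f -> Ck e k (fun x => r (f x)).
Proof.
elim: k r f => [|k IH] r f /= [cr Dr] [cf Df]; split=> //.
- by move=> x; apply: continuous_comp; [exact: cf|exact: cr].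
- by move=> x; apply: continuous_comp; [exact: cf|exact: cr].
move=> i; have [df Dk] := Df i; have [dr Dl] := Dr tt.
have D x : is_derive x (e i) (fun y => r (f y)) ('D_1 r (f x) * 'D_(e i) f x).
  by apply: is_derive_comp_dir; exact: DeriveDef.
split=> [x|]; first by have [] := D x.
rewrite (_ : (fun x => _) = (fun x => 'D_1 r (f x) * 'D_(e i) f x)).
  apply: CkM => //; apply: (IH (fun y => 'D_1 r y)) => //.
  by apply: CkS; split.
by apply/funext => x; have [_] := D x.
Qed.

End Ck_comp.

Section smooth_step.
Variable R : realType.
Local Notation Cinf := (fun r : R -> R => forall k, Ck (fun _ : unit => 1 : R) k r).

(* [t ^- j * expR (- t^-1)] extended by [0] to [t <= 0]; this family is stable
   under derivation. *)
Definition flat j (t : R) : R := if 0 < t then t^-1 ^+ j * expR (- t^-1) else 0.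

Lemma flat_ge0 j t : 0 <= flat j t.
Proof.
by rewrite /flat; case: ifPn => // t0; rewrite mulr_ge0 ?expR_ge0// exprn_ge0//
  invr_ge0 ltW.
Qed.

(** A single term of the exponential series at [t^-1], the one of degree [j.+2], beats the pole of
    order [j] with [t ^+ 2] to spare; the square yields the derivative 0 at the origin. *)
Lemma flat_le j t : flat j t <= (j.+2)`!%:R * t ^+ 2.
Proof.
rewrite /flat; case: ifPn => t0; last by rewrite mulr_ge0// sqr_ge0.
have s0 : 0 < t^-1 by rewrite invr_gt0.
have := expR_ge1Dxn j.+1 (ltW s0) => h.
have {}h : t^-1 ^+ j.+2 / (j.+2)`!%:R <= expR t^-1.
  by apply: le_trans h; rewrite lerDr.
rewrite expRN ler_pdivrMr ?expR_gt0//.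
have fp : 0 < (j.+2)`!%:R :> R by rewrite ltr0n fact_gt0.
have -> : t^-1 ^+ j = (j.+2)`!%:R * t ^+ 2 * (t^-1 ^+ j.+2 / (j.+2)`!%:R).
  by rewrite !exprS; field; rewrite !gt_eqF.
by rewrite ler_wpM2l// mulr_ge0// ?sqr_ge0// ltW.
Qed.

(** A quadratic remainder determines the derivative. Besides [flat] at 0, this serves for
    convolutions, where the remainder of the kernel is uniform and can be integrated. *)
Lemma is_derive_quadratic (E : normedModType R) (f : E -> R) x v (l C : R) :
  (forall h : R, `|h| <= 1 ->
     `|f (h *: v + x) - f x - h * l| <= C * h ^+ 2) ->
  is_derive x v f l.
Proof.
move=> H; have C0 : 0 <= C.
  have /H : `|1 : R| <= 1 by rewrite normr1.
  by rewrite expr1n mulr1; apply: le_trans.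
suff cv : (fun h : R => h^-1 *: (f (h *: v + x) - f x)) @ 0^' --> l.
  by split; [apply/cvg_ex; exists l|exact: cvg_lim cv].
apply/cvgrPdistC_le => e e0.
have d0 : 0 < Num.min 1 (e / (C + 1)).
  by rewrite lt_min ltr01 divr_gt0// ltr_wpDl.
exists (Num.min 1 (e / (C + 1))) => //= h;
  rewrite /= sub0r normrN lt_min => /andP[h1 he] h0.
have nh : 0 < `|h| by rewrite normr_gt0.
rewrite -(ler_pM2l nh) -normrM mulrBr mulrA mulfV// mul1r.
apply: le_trans (H h (ltW h1)) _; rewrite -real_normK ?num_real// expr2.
rewrite mulrCA ler_wpM2l//; move: he; rewrite ltr_pdivlMr ?ltr_wpDl// => he.
by apply: le_trans (ltW he); rewrite mulrC ler_wpM2l// lerDl.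
Qed.

Lemma flat_derive j (t : R) : is_derive t 1 (flat j) (flat j.+2 t - j%:R * flat j.+1 t).
Proof.
have [t0|t0|->] := ltgtP t 0.
- rewrite (_ : _ - _ = 0); last by rewrite /flat ltNge (ltW t0)/= mulr0 subr0.
  apply: (@near_eq_is_derive _ _ _ (fun=> 0) (flat j)).
  + near=> s; rewrite /flat ifF//; apply/negbTE; rewrite -leNgt.
    by apply: ltW; near: s; exact: lt_nbhsl.
- pose g (s : R) := s^-1 ^+ j * expR (- s^-1).
  apply: (@near_eq_is_derive _ _ _ g (flat j)).
  + by near=> s; rewrite /flat ifT//; near: s; exact: lt_nbhsr.
  have tn0 : t != 0 by rewrite gt_eqF.
  have dV : is_derive t 1 (fun s : R => s^-1) (- t ^- 2).
    have := @is_deriveV _ id t 1 1 tn0 (is_derive_id t 1).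
    by rewrite /= [_ *: _]mulr1.
  have d1 := @is_deriveX _ _ (fun s : R => s^-1) j t 1 _ dV.
  have d2 : is_derive t 1 (fun s : R => expR (- s^-1)) (expR (- t^-1) * t ^- 2).
    apply: is_derive1_comp; rewrite -[t ^- 2]opprK; exact: is_deriveN.
  have := is_deriveM d1 d2.
  rewrite (_ : _ * _ = g); last by apply/funext => s; rewrite /g exprfctE.
  move=> dg; apply: is_derive_eq dg _.
  rewrite /flat t0 exprfctE /GRing.scale /= !exprS.
  case: j {g d1} => [|j] /=; first by rewrite !mul0r expr0; field.
  by rewrite exprS; field.
- rewrite (_ : _ - _ = 0); last by rewrite /flat ltxx mulr0 subr0.
  apply: (@is_derive_quadratic _ _ _ _ _ (j.+2)`!%:R) => h _.
  rewrite mulr0 subr0 addr0 [_%:A]mulr1 /flat ltxx subr0 -/(flat j h).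
  by rewrite ger0_norm ?flat_ge0// flat_le.
Unshelve. all: by end_near.
Qed.

Lemma derivable_continuous (f : R -> R) :
  (forall x, derivable f x 1) -> continuous f.
Proof. by move=> df x; apply/differentiable_continuous/derivable1_diffP. Qed.

Lemma Ck_flat j : Cinf (flat j).
Proof.
move=> k; elim: k j => [|k IH] j.
  split=> //; apply: derivable_continuous => x.
  by have [] := flat_derive j x.
split.
  apply: derivable_continuous => x.
  by have [] := flat_derive j x.
move=> _; split=> [x|]; first by have [] := flat_derive j x.
rewrite (_ : (fun x => _) = (fun x => flat j.+2 x + - (j%:R * flat j.+1 x))).
  by apply: CkD => //; apply: CkN; apply: CkM => //; exact: Ck_cst.
by apply/funext => x; have [_] := flat_derive j x.
Qed.

(** [1 + t] and [1 - t] are never both nonpositive, so the sum is positive and [step] is a smooth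
    passage from 0 at -1 to 1 at 1. *)
Definition step_den (t : R) : R := flat 0 (1 + t) + flat 0 (1 - t).

Lemma flat_gt0 j t : 0 < t -> 0 < flat j t.
Proof. by move=> t0; rewrite /flat t0 mulr_gt0 ?expR_gt0// exprn_gt0// invr_gt0. Qed.

Lemma flat_eq0 j t : t <= 0 -> flat j t = 0.
Proof. by move=> t0; rewrite /flat ltNge t0. Qed.

Lemma step_den_gt0 t : 0 < step_den t.
Proof.
have [t0|t0] := leP 0 t.
  by rewrite ltr_pwDl ?flat_ge0// flat_gt0// ltr_pwDl.
by rewrite ltr_wpDl ?flat_ge0// flat_gt0// subr_gt0 (lt_trans t0).
Qed.

Definition step (t : R) : R := flat 0 (1 + t) / step_den t.

(** The quotient rule for [step], with [flat 2] as derivative of [flat 0], arranged so that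
    positivity is visible. It is a bump on [-1, 1] of integral 1, from which the mollifiers are
    built. *)
Definition dstep (t : R) : R :=
  (flat 2 (1 + t) * flat 0 (1 - t) + flat 0 (1 + t) * flat 2 (1 - t))
  / step_den t ^+ 2.

Lemma step_ge0 t : 0 <= step t.
Proof. by rewrite divr_ge0 ?flat_ge0// ltW ?step_den_gt0. Qed.

Lemma step_le1 t : step t <= 1.
Proof. by rewrite ler_pdivrMr ?step_den_gt0// mul1r lerDl flat_ge0. Qed.

Lemma step0 t : t <= -1 -> step t = 0.
Proof. by move=> t1; rewrite /step flat_eq0 ?mul0r//; lra. Qed.

Lemma step1 t : 1 <= t -> step t = 1.
Proof.
move=> t1; rewrite /step /step_den [flat 0 (1 - t)]flat_eq0 ?addr0 ?divff//; last lra.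
by rewrite gt_eqF// flat_gt0//; lra.
Qed.

Lemma dstep_ge0 t : 0 <= dstep t.
Proof. by rewrite divr_ge0 ?sqr_ge0// addr_ge0// mulr_ge0// flat_ge0. Qed.

Lemma dstep0 t : 1 <= `|t| -> dstep t = 0.
Proof.
rewrite ler_normr => /orP[] t1; rewrite /dstep.
  by rewrite ![flat _ (1 - t)]flat_eq0 ?mulr0 ?addr0 ?mul0r//; lra.
by rewrite ![flat _ (1 + t)]flat_eq0 ?mul0r ?addr0 ?mul0r//; lra.
Qed.

Lemma Ck_id : Cinf id.
Proof.
case=> [|k]; split=> //; try by move=> x; exact: cvg_id.
move=> _; split=> [x|]; first exact: derivable_id.
suff -> : 'D_1 (id : R -> R) = (fun=> 1 : R) by exact: Ck_cst.
by apply/funext => x; exact: derive_id.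
Qed.

Lemma Ck_affine (a b : R) : Cinf (fun t => a + b * t).
Proof.
by move=> k; apply: CkD; [exact: Ck_cst|apply: CkM; [exact: Ck_cst|exact: Ck_id]].
Qed.

Lemma is_derive_affine (a b t : R) : is_derive t 1 (fun s : R => a + b * s) b.
Proof.
apply: (@is_derive_quadratic _ _ _ _ _ 0) => h _.
by rewrite [_%:A]mulr1 (_ : _ - _ = 0) ?normr0 ?mul0r//; ring.
Qed.

Lemma Ck_step : Cinf step.
Proof.
move=> k; have C1 : Ck (fun _ : unit => 1 : R) k (fun t : R => flat 0 (1 + t)).
  rewrite (_ : (fun t => _) = (fun t => flat 0 (1 + 1 * t))).
    by apply: (Ck_comp (r := flat 0) (Ck_flat 0 k)); exact: Ck_affine.
  by apply/funext => t; rewrite mul1r.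
have C2 : Ck (fun _ : unit => 1 : R) k (fun t : R => flat 0 (1 - t)).
  rewrite (_ : (fun t => _) = (fun t => flat 0 (1 + (-1) * t))).
    by apply: (Ck_comp (r := flat 0) (Ck_flat 0 k)); exact: Ck_affine.
  by apply/funext => t; rewrite mulN1r.
apply: CkM => //; apply: CkV; last exact: CkD.
by move=> t; rewrite gt_eqF// step_den_gt0.
Qed.

Lemma step_derive (t : R) : is_derive t 1 step (dstep t).
Proof.
have D1 : is_derive t 1 (fun t : R => flat 0 (1 + t)) (flat 2 (1 + t)).
  rewrite -[flat 2 _]mulr1; apply: (@is_derive1_comp _ (flat 0) (fun s : R =>
    1 + s)); last first.
    by have := is_derive_affine 1 1 t; under eq_fun do rewrite mul1r.
  by have := flat_derive 0 (1 + t); rewrite mul0r subr0.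
have D2 : is_derive t 1 (fun t : R => flat 0 (1 - t)) (- flat 2 (1 - t)).
  rewrite -mulrN1; apply: (@is_derive1_comp _ (flat 0) (fun s : R => 1 - s));
    last first.
    by have := is_derive_affine 1 (-1) t; under eq_fun do rewrite mulN1r.
  by have := flat_derive 0 (1 - t); rewrite mul0r subr0.
have den0 : step_den t != 0 by rewrite gt_eqF// step_den_gt0.
have D3 := is_deriveV den0 (is_deriveD D1 D2).
have H := is_deriveM D1 D3; set l := (X in is_derive _ _ _ X) in H.
suff -> : dstep t = l by exact: H.
by rewrite /l /dstep /GRing.scale /= /step_den in den0 *; field.
Qed.

Lemma Ck_dstep : Cinf dstep.
Proof.
move=> k; have [_ /(_ tt)[_]] := Ck_step k.+1.
suff -> : 'D_1 step = dstep by [].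
by apply/funext => t; have [_] := step_derive t.
Qed.

End smooth_step.

(** * Integration on R^n *)

Section rV_topology.
Variables (R : realType) (n : nat).
Local Notation E := 'rV[R]_n.
Implicit Types x y : E.

Lemma rV_entry_le x i : `|x ord0 i| <= `|x|.
Proof.
rewrite [leRHS]/Num.norm /= mx_normrE; apply/bigmax_geP; right => /=.
by exists (ord0, i).
Qed.

Lemma rV_norm_le x (e : R) : 0 <= e -> (forall i, `|x ord0 i| <= e) -> `|x| <= e.
Proof.
move=> e0 xe; rewrite [leLHS]/Num.norm /= mx_normrE; apply/bigmax_leP; split=> //.
by move=> [i j] _ /=; rewrite ord1.
Qed.

(** For [0 <= M] the closed ball of the sup norm, described by coordinates to suit product
    measures. *)
Definition box (M : R) : set E := [set x | forall i, `|x ord0 i| <= M].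

Lemma subset_box (M N : R) : M <= N -> box M `<=` box N.
Proof. by move=> MN x xM i; exact: le_trans (xM i) MN. Qed.

Lemma compact_subset_box (K : set E) : compact K -> exists M, K `<=` box M.
Proof.
move=> /compact_bounded[M [_ hM]]; exists (M + 1) => x Kx i.
by apply: le_trans (rV_entry_le x i) _; apply: hM => //; rewrite ltrDl.
Qed.

Lemma compact_box (M : R) : compact (box M).
Proof.
rewrite (_ : box M = [set v : E | forall i, v ord0 i \in `[- M, M]]).
  by apply: (@rV_compact _ _ (fun=> `[- M, M]%classic)) => _; exact: segment_compact.
by apply/seteqP; split=> x xM i; have := xM i; rewrite in_itv/= ler_norml.
Qed.

Lemma measurable_coord_preimage i (A : set R) : measurable A ->
  measurable [set x : E | A (x ord0 i)].
Proof.
move=> mA; have := measurable_rV_coord i measurableT mA.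
by rewrite setTI.
Qed.

Lemma measurable_forall_coord (A : 'I_n -> set R) :
  (forall i, measurable (A i)) -> measurable [set x : E | forall i, A i (x ord0 i)].
Proof.
move=> mA; rewrite (_ : [set x | _] = \bigcap_(i in [set: 'I_n]) [set x : E | A i (x
  ord0 i)]).
  by apply: fin_bigcap_measurable; [exact: finite_finset|move=> i _;
    exact: measurable_coord_preimage].
by apply/seteqP; split=> [x h i _|x h i]; exact: h.
Qed.

Lemma measurable_box (M : R) : measurable (box M).
Proof.
rewrite (_ : box M = [set x : E | forall i, `[- M, M]%classic (x ord0 i)]).
  apply: (@measurable_forall_coord (fun=> `[- M, M]%classic)) => i.
  exact: measurable_itv.
by apply/seteqP; split=> x xM i; have := xM i; rewrite /= in_itv/= ler_norml.
Qed.

(** Measurable sets are generated by coordinates, so an open set is written as the countable union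
    of those cells with rational centre and radius [k.+1^-1] that it contains. *)
Lemma open_measurable_rV (U : set E) : open U -> measurable U.
Proof.
move=> oU; pose cell (p : 'rV[rat]_n * nat) : set E :=
  [set x | forall i, `](ratr (p.1 ord0 i) - p.2.+1%:R^-1),
    (ratr (p.1 ord0 i) + p.2.+1%:R^-1)[%classic (x ord0 i)].
have mcell p : measurable (cell p).
  apply: (@measurable_forall_coord (fun i =>
    `](ratr (p.1 ord0 i) - p.2.+1%:R^-1), (ratr (p.1 ord0 i) +
    p.2.+1%:R^-1)[%classic)) => i.
  exact: measurable_itv.
pose F p := if `[< cell p `<=` U >] then cell p else set0.
rewrite (_ : U = \bigcup_p F p).
  apply: countable_bigcupT_measurable; first exact: countableP.
  by move=> p; rewrite /F; case: ifP.
apply/seteqP; split=> [x Ux|x [p _]]; last first.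
  by rewrite /F; case: ifP => // /asboolP; exact.
have /nbhs_ballP[e /= e0 xe] : nbhs x U by rewrite nbhsE; exists U.
have e2 : 0 < e / 2 by rewrite divr_gt0.
have /cvgrPdist_lt/(_ _ e2)[k _ /(_ k (leqnn k))] := @cvg_harmonic R.
rewrite /= sub0r normrN ger0_norm /harmonic//= => hk.
have k0 : 0 < k.+1%:R^-1 :> R by rewrite invr_gt0.
(* The rational centre is within [k.+1^-1] of [x] in each coordinate, so points of its cell are at
   distance at most [2 / k.+1 < e] from [x]. *)
have /choice[q hq] i : exists r : rat, ratr r \in `](x ord0 i - k.+1%:R^-1),
  (x ord0 i + k.+1%:R^-1)[.
  by apply: rat_in_itvoo; rewrite ltrD2l gt0_cp.
exists (\row_i q i, k) => //; rewrite /F ifT; last first.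
  apply/asboolP => y cy; apply: xe; rewrite mx_norm_ball /ball_ /=.
  apply: le_lt_trans (_ : 2 * k.+1%:R^-1 < e); last first.
    by rewrite mulrC -ltr_pdivlMr.
  apply: rV_norm_le => [|i]; first by rewrite mulr_ge0// ltW.
  have := cy i; have := hq i; rewrite /= !mxE !in_itv/=.
  move: (k.+1%:R^-1) => z /andP[h1 h2] /andP[h3 h4].
  by rewrite ler_norml; apply/andP; split; lra.
move=> i; have := hq i; rewrite /= !mxE !in_itv/=.
by move: (k.+1%:R^-1) => z /andP[h1 h2]; apply/andP; split; lra.
Qed.

Lemma continuous_measurable_rV (f : E -> R) : continuous f -> measurable_fun setT f.
Proof.
move=> cf; apply: (measurability (@RGenOInfty.G R)).
  exact: RGenOInfty.measurableE.
move=> _ [_ [x ->] <-]; rewrite setTI; apply: open_measurable_rV.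
by apply: open_comp => //; exact: interval_open.
Qed.

End rV_topology.

(** * Fubini along the first coordinate *)

Section rV_fubini.
Variables (R : realType).
Local Notation mu n := (lebesgue_rV R n).
Local Notation leb := (@lebesgue_measure R).

(* [lebesgue_measure] lives on [measurableTypeR R], whose measurable sets are
   those of [R] but whose display differs. *)
Lemma measurable_funR d (T : measurableType d) (f : R -> T) :
  measurable_fun [set: R] f -> measurable_fun [set: measurableTypeR R] f.
Proof. by move=> mf _ Y mY; exact: (mf measurableT Y mY). Qed.

Lemma measurable_funR_prod d d' (T : measurableType d) (T' : measurableType d')
    (f : R * T -> T') :
  measurable_fun [set: R * T] f -> measurable_fun [set: measurableTypeR R * T] f.
Proof. by move=> mf _ Y mY; exact: (mf measurableT Y mY). Qed.

Lemma measurable_rV_consR n :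
  measurable_fun [set: measurableTypeR R * 'rV[R]_n] (@rV_cons R n).
Proof. exact: (measurable_funR_prod (@measurable_rV_cons R n)). Qed.

Section lebesgue_rVS_integral.
Variables (n : nat) (nu : {sigma_finite_measure set 'rV[R]_n -> \bar R}).
Variable f : 'rV[R]_n.+1 -> \bar R.

Let m12 : {measure set (measurableTypeR R * 'rV[R]_n) -> \bar R} := (leb \x nu)%E.

Lemma ge0_integral_lebesgue_rVS :
  measurable_fun setT f -> (forall x, (0 <= f x)%E) ->
  (\int[lebesgue_rVS nu]_x f x = \int[leb \x nu]_p f (rV_cons p))%E.
Proof.
move=> mf f0.
have e := ge0_integral_pushforward (@measurable_rV_consR n) m12
  measurableT mf (fun x _ => f0 x).
by rewrite preimage_setT in e.
Qed.

Lemma integral_lebesgue_rVS : (lebesgue_rVS nu).-integrable setT f ->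
  (\int[lebesgue_rVS nu]_x f x = \int[leb \x nu]_p f (rV_cons p))%E.
Proof.
move=> fi.
have [mf fy] := integrableP _ _ _ fi.
have mf' : measurable_fun [set: measurableTypeR R * 'rV[R]_n] (f \o @rV_cons R n).
  by apply: measurableT_comp => //; exact: measurable_rV_consR.
have fi' : (leb \x nu)%E.-integrable setT (f \o @rV_cons R n).
  apply/integrableP; split=> //.
  have e := ge0_integral_pushforward (@measurable_rV_consR n) m12
    measurableT (measurableT_comp (@abse_measurable R setT) mf) (fun x _ => abse_ge0 _).
  by rewrite preimage_setT in e; rewrite -[X in (X < _)%E]e.
have e := integral_pushforward (mu := m12) (@measurable_rV_consR n) mf fi' measurableT.
by rewrite preimage_setT in e.
Qed.

End lebesgue_rVS_integral.

Lemma ge0_integral_rVS n (f : 'rV[R]_n.+1 -> \bar R) :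
  measurable_fun setT f -> (forall x, (0 <= f x)%E) ->
  (\int[mu n.+1]_x f x = \int[leb]_t \int[mu n]_v f (rV_cons (t, v)))%E.
Proof.
move=> mf f0; rewrite [LHS](ge0_integral_lebesgue_rVS (mu n) mf f0).
have mf' : measurable_fun [set: measurableTypeR R * 'rV[R]_n] (f \o @rV_cons R n).
  by apply: measurableT_comp => //; exact: measurable_rV_consR.
exact: (fubini_tonelli1 (m1 := leb) (m2 := mu n) (f \o @rV_cons R n) mf' (fun p =>
  f0 _)).
Qed.

Lemma integrable_rVS n (f : 'rV[R]_n.+1 -> \bar R) :
  (mu n.+1).-integrable setT f ->
  (leb \x mu n)%E.-integrable setT (f \o @rV_cons R n).
Proof.
move=> /integrableP[mf fi]; apply/integrableP; split.
  by apply: measurableT_comp => //; exact: measurable_rV_consR.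
have e := ge0_integral_lebesgue_rVS (mu n) (f := fun x => `|f x|%E)
  (measurableT_comp (@abse_measurable R setT) mf) (fun x => abse_ge0 _).
rewrite -[X in (X < _)%E]e; exact: fi.
Qed.

Lemma integral_rVS n (f : 'rV[R]_n.+1 -> \bar R) :
  (mu n.+1).-integrable setT f ->
  (\int[mu n.+1]_x f x = \int[leb]_t \int[mu n]_v f (rV_cons (t, v)))%E.
Proof.
move=> fi; have fi' := integrable_rVS fi.
rewrite [LHS](integral_lebesgue_rVS (nu := mu n) fi).
exact/esym/(integral12_prod_meas1 (m1 := leb) (m2 := mu n) fi').
Qed.

(** The order with the first coordinate innermost, used when a derivative along that coordinate is
    integrated. *)
Lemma integral_rVS2 n (f : 'rV[R]_n.+1 -> \bar R) :
  (mu n.+1).-integrable setT f ->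
  (\int[mu n.+1]_x f x = \int[mu n]_v \int[leb]_t f (rV_cons (t, v)))%E.
Proof.
move=> fi; have fi' := integrable_rVS fi.
rewrite [LHS](integral_lebesgue_rVS (nu := mu n) fi).
exact/esym/(integral21_prod_meas1 (m1 := leb) (m2 := mu n) fi').
Qed.

(** Tonelli splits off one coordinate at a time; this computes the mass of tensor product
    kernels. *)
Lemma ge0_integral_prod n (F : 'I_n -> R -> R) :
  (forall i, measurable_fun setT (F i)) -> (forall i t, 0 <= F i t) ->
  (\int[mu n]_x (\prod_i F i (x ord0 i))%:E =
   \prod_i \int[leb]_t (F i t)%:E)%E.
Proof.
elim: n F => [|n IH] F mF F0.
  rewrite big_ord0 /= (eq_integral (fun=> 1%E)) => [|x _]; last by rewrite big_ord0.
  by rewrite integral_dirac// diracT mul1e.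
have mprod k (G : 'I_k -> R -> R) : (forall i, measurable_fun setT (G i)) ->
    measurable_fun setT (fun x : 'rV[R]_k => (\prod_i G i (x ord0 i))).
  move=> mG; apply: measurable_prod => i _.
  by apply: measurableT_comp => //; exact: measurable_rV_coord.
rewrite ge0_integral_rVS; last 2 first.
- by apply/measurable_EFinP; apply: (mprod _ F).
- by move=> x; rewrite lee_fin prodr_ge0.
rewrite [RHS]big_ord_recl -IH//.
transitivity (\int[leb]_t ((F ord0 t)%:E *
    \int[mu n]_v (\prod_(i < n) F (lift ord0 i) (v ord0 i))%:E))%E.
  apply: eq_integral => t _; rewrite -ge0_integralZl_EFin//.
  - apply: eq_integral => v _.
    by rewrite big_ord_recl rV_cons0 EFinM; under eq_bigr do rewrite rV_consS.
  - by move=> v _; rewrite lee_fin prodr_ge0.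
  - by apply/measurable_EFinP; apply: (mprod _ (fun i => F (lift ord0 i))) => i.
rewrite ge0_integralZr//.
- apply: (measurable_funR (f := fun t => (F ord0 t)%:E)).
  exact/measurable_EFinP.
- by move=> t _; rewrite lee_fin.
- by apply: integral_ge0 => v _; rewrite lee_fin prodr_ge0.
Qed.

Lemma box_lty n (M : R) : (mu n (box M) < +oo)%E.
Proof.
elim: n => [|n IH].
  rewrite /= diracE; by case: (_ \in _); rewrite ltry.
have -> : mu n.+1 (box M) = (leb \x mu n)%E (`[- M, M] `*` box M).
  rewrite /= /lebesgue_rVS /pushforward; congr (_ _).
  apply/seteqP; split=> [[t v] h|[t v] [h1 h2] i].
    split=> [|i]; first by have := h ord0; rewrite rV_cons0 /= in_itv/= ler_norml.
    by have := h (lift ord0 i); rewrite rV_consS.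
  have [j ->|->] := unliftP ord0 i; first by rewrite rV_consS; exact: h2.
  by rewrite rV_cons0; move: h1; rewrite /= in_itv/= ler_norml.
rewrite (product_measure1E leb (mu n) (measurable_itv _) (measurable_box M)).
have fl : (leb `[(- M)%R, M]%classic < +oo)%E.
  by rewrite lebesgue_measure_itv/=; case: ifP => // _; rewrite -EFinB ltry.
by apply: lte_mul_pinfty => //; rewrite ge0_fin_numE.
Qed.

End rV_fubini.

(** * Test functions *)

Section test_functions.
Variables (R : realType) (n : nat).
Local Notation E := 'rV[R]_n.
Local Notation mu := (lebesgue_rV R n).
Local Notation e_ i := (delta_mx ord0 i : E).
Local Notation CkE := (Ck (fun i : 'I_n => e_ i)).
Implicit Types (phi f g b : E -> R) (M C : R).

Lemma smooth_partial phi i : smooth phi -> smooth (partial i phi).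
Proof. by move=> sphi s; have := sphi (rcons s i); rewrite foldr_rcons. Qed.

(** [foldr] applies the last entry of [s] first, so induction from the right end matches [Ck], which
    peels off the innermost derivative. *)
Lemma smoothP phi : smooth phi <-> forall k, CkE k phi.
Proof.
split=> [sphi k|cphi s].
  elim: k phi sphi => [|k IH] phi sphi; split=> //; try by have [] := sphi [::].
  move=> i; split=> [x|]; first by have [_] := sphi [::]; exact.
  by apply: IH; exact: smooth_partial.
elim/last_ind: s phi cphi => [|s i IH] phi cphi.
  split=> [|i x] /=; first exact: Ck_cont (cphi 0%N).
  by have [_ /(_ i)[+ _]] := cphi 1%N; exact.
by rewrite foldr_rcons; apply: IH => k; have [_ /(_ i)[]] := cphi k.+1.
Qed.

Lemma smoothM f g : smooth f -> smooth g -> smooth (fun x => f x * g x).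
Proof. by move=> /smoothP sf /smoothP sg; apply/smoothP => k; exact: CkM. Qed.

Lemma smoothD f g : smooth f -> smooth g -> smooth (fun x => f x + g x).
Proof. by move=> /smoothP sf /smoothP sg; apply/smoothP => k; exact: CkD. Qed.

(** Compact support in quantitative form: sums, products, derivatives and reflections keep it with
    an explicit radius. *)
Definition bsupp M f := forall x, ~ box M x -> f x = 0.

Lemma closed_box M : closed (@box R n M).
Proof. by apply: compact_closed; [exact: norm_hausdorff|exact: compact_box]. Qed.

Lemma bsupp_partial M phi i : bsupp M phi -> bsupp M (partial i phi).
Proof.
move=> bM x xM; rewrite /partial.
have /near_eq_derive -> : \forall y \near x, phi y = cst 0 y.
  have : nbhs x (~` @box R n M).
    by apply: open_nbhs_nbhs; split=> //; exact/closed_openC/closed_box.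
  by apply: filterS => y /bM ->.
exact: derive_cst.
Qed.

Lemma test_functionP phi : test_function phi <->
  smooth phi /\ exists M, bsupp M phi.
Proof.
split=> [[sphi cphi]|[sphi [M bM]]]; split=> //.
  have [M hM] := compact_subset_box cphi; exists M => x xM.
  apply/eqP/negP => /negP px; apply: xM; apply: hM.
  exact: subset_closure.
apply: (subclosed_compact _ (@compact_box R n M)); first exact: closed_closure.
rewrite closureE => x; apply; split; first exact: closed_box.
by move=> y /= py; apply: contrapT => /bM y0; rewrite y0 eqxx in py.
Qed.

Lemma test_function_partial phi i : test_function phi -> test_function (partial i phi).
Proof.
move=> /test_functionP[sphi [M bM]]; apply/test_functionP; split.
  exact: smooth_partial.
by exists M; exact: bsupp_partial.
Qed.

Lemma smooth_continuous phi : smooth phi -> continuous phi.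
Proof. by move=> /(_ [::])[]. Qed.

Lemma smooth_measurable phi : smooth phi -> measurable_fun setT phi.
Proof. by move=> /smooth_continuous; exact: continuous_measurable_rV. Qed.

Lemma bsupp_bounded M f : continuous f -> bsupp M f ->
  exists C, forall x, `|f x| <= C.
Proof.
move=> cf bM.
have := continuous_compact (continuous_subspaceT cf) (@compact_box R n M).
move=> /compact_bounded[C [_ hC]]; exists (`|C| + 1) => x.
have [xM|xM] := pselect (box M x); last by rewrite bM// normr0 addr_ge0.
apply: (hC (`|C| + 1)); last by exists x.
by rewrite ltr_pwDr// ler_norm.
Qed.

Lemma bsuppM M f g : bsupp M f -> bsupp M (fun x => f x * g x).
Proof. by move=> bM x /bM ->; rewrite mul0r. Qed.

Definition L1loc f := measurable_fun setT f /\
  forall M, mu.-integrable (box M) (EFin \o f).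

Lemma L1loc_mul f b M C : L1loc f -> measurable_fun setT b ->
  (forall x, `|b x| <= C) -> bsupp M b ->
  mu.-integrable setT (fun x => (f x * b x)%:E).
Proof.
move=> [mf fi] mb bC bM.
have -> : (fun x => (f x * b x)%:E) = (fun x => (f x * b x)%:E) \_ (box M).
  apply/funext => x; rewrite patchE; case: ifPn => // /negP xM.
  by rewrite bM ?mulr0// => xB; apply: xM; rewrite inE.
apply/(integrable_mkcond _ (measurable_box M)).
have C0 : 0 <= C by exact: le_trans (bC 0).
apply: (@le_integrable _ _ _ _ _ (measurable_box M) _ (fun x => C%:E * (f x)%:E)%E).
- by apply/measurable_EFinP/measurable_funTS; exact: measurable_funM.
- by move=> x _; rewrite -EFinM lee_fin !normrM [`|C|]ger0_norm// mulrC ler_wpM2r.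
- by apply: integrableZl => //; exact: measurable_box.
Qed.

Lemma integrable_cst_box M C : mu.-integrable (box M) (fun=> C%:E).
Proof.
apply/integrableP; split; first exact: measurable_cst.
rewrite (integral_cst mu (measurable_box M) `|C|%:E).
by apply: lte_mul_pinfty => //; exact: box_lty.
Qed.

Lemma L1loc_cst C : L1loc (fun=> C).
Proof. by split=> // M; exact: integrable_cst_box. Qed.

Lemma integrable_bsupp b M C : measurable_fun setT b ->
  (forall x, `|b x| <= C) -> bsupp M b -> mu.-integrable setT (EFin \o b).
Proof.
move=> mb bC bM; have := L1loc_mul (L1loc_cst 1) mb bC bM.
by under eq_fun do rewrite mul1r.
Qed.

Lemma Lfun2_bsupp b M C : measurable_fun setT b ->
  (forall x, `|b x| <= C) -> bsupp M b -> b \in Lfun mu 2%:E.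
Proof.
move=> mb bC bM; apply: Lfun2I => //.
have C0 : 0 <= C by exact: le_trans (bC 0).
have /integrableP[_] : mu.-integrable setT (EFin \o (fun x => b x ^+ 2)).
  apply: (@integrable_bsupp _ M (C ^+ 2)).
  - exact: measurable_funX.
  - by move=> x; rewrite normrX lerXn2r ?nnegrE.
  - by move=> x /bM ->; rewrite expr0n.
apply: le_lt_trans; apply: ge0_le_integral => //.
- by move=> x _; rewrite lee_fin sqr_ge0.
- exact: measurable_sqr.
- by apply: measurableT_comp => //; exact: measurable_sqr.
- by move=> x _; rewrite lee_fin ler_norm.
Qed.

Lemma indic_box_Lfun2 M : (\1_(box M) : E -> R) \in Lfun mu 2%:E.
Proof.
apply: (@Lfun2_bsupp _ M 1); first exact: measurable_indic (measurable_box M).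
- by move=> x; rewrite indicE; case: (_ \in _); rewrite ?normr1 ?normr0.
- by move=> x xM; rewrite indicE memNset.
Qed.

Lemma L1loc_Lfun2_mul f g : f \in Lfun mu 2%:E -> g \in Lfun mu 2%:E ->
  L1loc (fun x => f x * g x).
Proof.
move=> fL gL; split=> [|M].
  by apply: measurable_funM; [exact: Lfun2_measurable fL|exact: Lfun2_measurable gL].
apply: (integrableS measurableT (measurable_box M) (@subsetT _ _)).
exact: integrable_mul.
Qed.

(** Meant for [f = W]: it makes [W g] locally integrable, hence a distribution, for every square
    integrable [g]. *)
Lemma L1loc_mulL2loc f g : measurable_fun setT f ->
  (forall M, (fun x => f x * \1_(box M) x) \in Lfun mu 2%:E) ->
  g \in Lfun mu 2%:E -> L1loc (fun x => f x * g x).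
Proof.
move=> mf fL gL; split=> [|M].
  by apply: measurable_funM => //; exact: Lfun2_measurable gL.
have : mu.-integrable (box M) (fun x => (f x * \1_(box M) x * g x)%:E).
  apply: (integrableS measurableT (measurable_box M) (@subsetT _ _)).
  exact: integrable_mul.
apply: eq_integrable; first exact: measurable_box.
by move=> x xM; rewrite /= indicE xM mulr1.
Qed.

Lemma L1loc_Lfun2 f : f \in Lfun mu 2%:E -> L1loc f.
Proof.
move=> fL; rewrite (_ : f = (fun x => 1 * f x)); last first.
  by apply/funext => x; rewrite mul1r.
apply: L1loc_mulL2loc => // M.
by under eq_fun do rewrite mul1r; exact: indic_box_Lfun2.
Qed.

Lemma L2_loc_box f : L2_loc f -> forall M, (fun x =>
  f x * \1_(box M) x) \in Lfun mu 2%:E.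
Proof.
move=> [mf fi] M; apply: Lfun2I.
  by apply: measurable_funM => //; exact: measurable_indic (measurable_box M).
apply: le_lt_trans (fi _ (@compact_box R n M)).
rewrite [leRHS]integral_mkcond le_eqVlt; apply/orP; left; apply/eqP.
apply: eq_integral => x _; rewrite patchE indicE.
by case: (x \in box M); rewrite ?mulr1// mulr0 expr0n.
Qed.

End test_functions.
Arguments bsupp {R n} M f.

(** * Integration by parts on R^n *)

Section integration_by_parts_rV.
Variable R : realType.
Local Notation mu n := (lebesgue_rV R n).
Local Notation leb := (@lebesgue_measure R).

Lemma integral_derive_itv (F f : R -> R) (a b : R) : a < b ->
  (forall t : R, is_derive t 1 F (f t)) -> continuous f ->
  (\int[leb]_(t in `[a, b]) (f t)%:E = (F b - F a)%:E)%E.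
Proof.
move=> ab dF cf; have cF : continuous F.
  by apply: derivable_continuous => t; have [] := dF t.
rewrite EFinB (@continuous_FTC2 _ f F a b)//.
- exact: continuous_subspaceT.
- split.
  + by move=> t _; have [] := dF t.
  + by apply: cvg_at_right_filter; exact: cF.
  + by apply: cvg_at_left_filter; exact: cF.
- by move=> t _; rewrite derive1E; have [_] := dF t.
Qed.

Lemma integral_derive_support (F f : R -> R) (a b : R) : a < b ->
  (forall t : R, is_derive t 1 F (f t)) -> continuous f ->
  (forall t, t \notin `[a, b] -> f t = 0) ->
  (\int[leb]_t (f t)%:E = (F b - F a)%:E)%E.
Proof.
move=> ab dF cf f0; rewrite -(integral_derive_itv ab dF cf).
rewrite [RHS]integral_mkcond; apply: eq_integral => t _; rewrite patchE.
by case: ifPn => // tab; rewrite f0// ; apply: contra tab; rewrite inE.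
Qed.

Lemma is_derive_shift_line (E : normedModType R) (phi : E -> R) (v x : E) (t l : R) :
  is_derive (t *: v + x) v phi l -> is_derive t 1 (fun s : R => phi (s *: v + x)) l.
Proof.
move=> /is_derive_lineP H; apply/is_derive_lineP; move: H.
rewrite (_ : (fun h : R => phi (h *: v + (t *: v + x))) =
  (fun h : R => phi ((h *: 1 + t) *: v + x)))//.
by apply/funext => h; rewrite addrA -scalerDl [_%:A]mulr1.
Qed.


Lemma continuous_line (E : normedModType R) (f : E -> R) (v x : E) :
  continuous f -> continuous (fun t : R => f (t *: v + x)).
Proof.
move=> cf t; apply: (continuous_comp (f := fun t : R => t *: v + x) (g := f));
  last exact: cf.
by apply: cvgD; [apply: cvgZr_tmp; exact: cvg_id|exact: cvg_cst].
Qed.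

Lemma rV_cons_line0 n (t h : R) (v : 'rV[R]_n) :
  h *: delta_mx ord0 ord0 + rV_cons (t, v) = rV_cons (h + t, v).
Proof.
apply/rowP => i; rewrite 2!mxE mxE.
have [j ->|->] := unliftP ord0 i; first by rewrite !rV_consS mulr0 add0r.
by rewrite !rV_cons0 !eqxx mulr1.
Qed.

Lemma rV_cons_lineS n (t h : R) (v : 'rV[R]_n) j :
  h *: delta_mx ord0 (lift ord0 j) + rV_cons (t, v) = rV_cons (t,
    h *: delta_mx ord0 j + v).
Proof.
apply/rowP => i; rewrite 2!mxE mxE.
have [k ->|->] := unliftP ord0 i; last by rewrite !rV_cons0 mulr0 add0r.
by rewrite !rV_consS !mxE !eqxx (inj_eq (@lift_inj _ ord0)).
Qed.

Lemma bsupp_rV_cons n M (f : 'rV[R]_n.+1 -> R) t : bsupp M f ->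
  bsupp M (fun v => f (rV_cons (t, v))).
Proof.
move=> bM v vM; apply: bM => h; apply: vM => i.
by have := h (lift ord0 i); rewrite rV_consS.
Qed.

(** Induction on the dimension. A derivative along a later coordinate passes to the slices; one
    along the first coordinate is integrated by the fundamental theorem over an interval beyond the
    support. Differentiability is assumed in a single direction, which the slices inherit. *)
Lemma integral_partial0 n i M C (phi dphi : 'rV[R]_n -> R) :
  (forall x, is_derive x (delta_mx ord0 i) phi (dphi x)) ->
  (forall x, continuous (fun t : R => dphi (t *: delta_mx ord0 i + x))) ->
  measurable_fun setT dphi -> (forall x, `|dphi x| <= C) ->
  bsupp M phi -> bsupp M dphi -> (\int[mu n]_x (dphi x)%:E = 0)%E.
Proof.
elim: n i phi dphi => [[]//|n IH] i phi dphi dd dc md dC bphi bd.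
have di : (mu n.+1).-integrable setT (EFin \o dphi) by exact: integrable_bsupp bd.
have [j ij|i0] := unliftP ord0 i.
  rewrite integral_rVS//; apply: integral0_eq => t _.
  apply: (IH j (fun v => phi (rV_cons (t, v)))).
  - move=> v; have := dd (rV_cons (t, v)); rewrite ij.
    move=> /is_derive_lineP H; apply/is_derive_lineP; move: H.
    by under eq_fun do rewrite rV_cons_lineS.
  - move=> v; have := dc (rV_cons (t, v)); rewrite ij.
    by under eq_fun do rewrite rV_cons_lineS.
  - by apply: (measurableT_comp md); apply: (measurableT_comp (@measurable_rV_cons R
    n)).
  - by move=> v; exact: dC.
  - exact: bsupp_rV_cons.
  - exact: bsupp_rV_cons.
rewrite integral_rVS2//; apply: integral0_eq => v _.
have z (f : 'rV[R]_n.+1 -> R) (t : R) : bsupp M f -> t \notin `[- `|M|, `|M|] ->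
  f (rV_cons (t, v)) = 0.
  move=> bM tM; apply: bM => /(_ ord0); rewrite rV_cons0/= => tM'.
  move: tM; rewrite in_itv/= -ler_norml => /negP; apply.
  exact: le_trans (ler_norm _).
(* The absolute value is there because [M] may be negative; the extra 1 makes the interval
   nondegenerate and puts its endpoints outside the support. *)
have M0 : - (`|M| + 1) < `|M| + 1 :> R by have := normr_ge0 M; lra.
have z' (f : 'rV[R]_n.+1 -> R) (t : R) : bsupp M f ->
  t \notin `](- (`|M| + 1)), (`|M| + 1)[ -> f (rV_cons (t, v)) = 0.
  move=> bM tM; apply: z => //; apply: contra tM; rewrite !in_itv/=; lra.
have dF (t : R) : is_derive t 1 (fun t : R =>
  phi (rV_cons (t, v))) (dphi (rV_cons (t, v))).
  have := dd (rV_cons (t, v)); rewrite i0.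
  move=> /is_derive_lineP H; apply/is_derive_lineP; move: H.
  by under eq_fun do rewrite rV_cons_line0;
    under [X in _ -> is_derive _ _ X _]eq_fun do rewrite [_%:A]mulr1.
rewrite (integral_derive_support M0 dF).
- rewrite !z' ?subrr//; by rewrite in_itv/= ltxx// andbF.
- by have := dc (rV_cons (0, v)); rewrite i0;
  under eq_fun do rewrite rV_cons_line0 addr0.
- move=> t tM; apply: z' => //; apply: contra tM; rewrite !in_itv/=; lra.
Qed.

(** The sum of the two integrands is the derivative of [phi psi], whose support is bounded by that
    of [phi]. *)
Lemma integration_by_parts_rV n i (phi psi : 'rV[R]_n -> R) :
  test_function phi -> smooth psi ->
  \int[mu n]_x (partial i phi x * psi x) = - \int[mu n]_x (phi x * partial i psi x).
Proof.
move=> tphi spsi; have /test_functionP[sphi [M bM]] := tphi.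
have csm (f : 'rV[R]_n -> R) : smooth f -> continuous f by exact: smooth_continuous.
have dsm (f : 'rV[R]_n -> R) x : smooth f ->
  is_derive x (delta_mx ord0 i) f (partial i f x).
  by move=> sf; apply: DeriveDef => //; have [_] := sf [::]; exact.
have cm (f g : 'rV[R]_n -> R) : smooth f -> smooth g -> continuous (fun x => f x * g x).
  by move=> sf sg; apply: csm; exact: smoothM.
have ii (f g : 'rV[R]_n -> R) : smooth f -> smooth g -> bsupp M f ->
    (mu n).-integrable setT (fun x => (f x * g x)%:E).
  move=> sf sg bf; have [C hC] := bsupp_bounded (cm _ _ sf sg) (bsuppM g bf).
  apply: integrable_bsupp hC (bsuppM g bf).
  exact: continuous_measurable_rV (cm _ _ sf sg).
have sp (f : 'rV[R]_n -> R) : smooth f -> smooth (partial i f) by exact: smooth_partial.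
have bp : bsupp M (partial i phi) by exact: bsupp_partial.
apply/eqP; rewrite -addr_eq0 -RintegralD//; last 2 first.
- exact: ii (sp _ sphi) spsi bp.
- exact: ii sphi (sp _ spsi) bM.
pose d x := partial i phi x * psi x + phi x * partial i psi x.
have cd : continuous d.
  exact: (csm _ (smoothD (smoothM (sp _ sphi) spsi) (smoothM sphi (sp _ spsi)))).
have bd : bsupp M d by move=> x xM; rewrite /d bp// bM// !mul0r addr0.
have [C hC] := bsupp_bounded cd bd.
have dd x : is_derive x (delta_mx ord0 i) (fun x => phi x * psi x) (d x).
  have dphi := dsm _ x sphi; have dpsi := dsm _ x spsi.
  apply: is_derive_eq; rewrite /d.
  by rewrite -[X in X + _ = _]/(phi x * _) -[X in _ + X = _]/(psi x * _) addrC [psi x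
    * _]mulrC.
have cdl x : continuous (fun t : R => d (t *: delta_mx ord0 i + x)).
  exact: continuous_line.
by rewrite /Rintegral (integral_partial0 dd cdl (continuous_measurable_rV cd) hC
  (bsuppM psi bM) bd).
Qed.

End integration_by_parts_rV.

(** * The fundamental lemma of the calculus of variations *)

Section tensor.
Variables (R : realType) (n : nat).
Local Notation E := 'rV[R]_n.
Local Notation e_ i := (delta_mx ord0 i : E).
Local Notation CkE := (Ck (fun i : 'I_n => e_ i)).
Local Notation Cinf := (fun r : R -> R => forall k, Ck (fun _ : unit => 1 : R) k r).

Lemma is_derive_coord (x : E) i j :
  is_derive x (e_ j) (fun y : E => y ord0 i) (i == j)%:R.
Proof.
apply: (@is_derive_quadratic _ _ _ _ _ _ 0) => h _.
by rewrite !mxE eqxx/= addrK subrr normr0 mul0r.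
Qed.

Lemma Ck_coord k i : CkE k (fun x : E => x ord0 i).
Proof.
have cc : continuous (fun x : E => x ord0 i) by exact: coord_continuous.
case: k => [|k]; split=> // j; split=> [x|].
  by have [] := is_derive_coord x i j.
suff -> : 'D_(e_ j) (fun x : E => x ord0 i) = (fun=> (i == j)%:R) by exact: Ck_cst.
by apply/funext => x; have [_] := is_derive_coord x i j.
Qed.

Lemma smooth_tensor (r : 'I_n -> R -> R) : (forall i, Cinf (r i)) ->
  smooth (fun x : E => \prod_i r i (x ord0 i)).
Proof.
move=> rC; apply/smoothP => k; apply: Ck_prod => i.
by apply: (Ck_comp (r := r i) (f := fun x : E => x ord0 i));
  [exact: rC|exact: Ck_coord].
Qed.

Lemma bsupp_tensor (r : 'I_n -> R -> R) M :
  (forall i t, M < `|t| -> r i t = 0) -> bsupp M (fun x : E => \prod_i r i (x ord0 i)).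
Proof.
move=> r0 x xM; have [i xi] : exists i, M < `|x ord0 i|.
  by apply: contrapT => h; apply: xM => i; rewrite leNgt; apply/negP => ?; apply: h;
    exists i.
by rewrite (bigD1 i)//= r0// mul0r.
Qed.

End tensor.

Section fundamental_lemma.
Variables (R : realType) (n : nat).
Local Notation E := 'rV[R]_n.
Local Notation mu := (lebesgue_rV R n).
Local Notation Cinf := (fun r : R -> R => forall k, Ck (fun _ : unit => 1 : R) k r).
Implicit Types u : E -> R.

(** A class stable under intersection that generates the Borel sets, and whose indicators are limits
    of products of one-variable steps. *)
Definition orthant (a : E) : set E := [set x | forall i, a ord0 i < x ord0 i].

Lemma measurable_orthant a : measurable (orthant a).
Proof.
rewrite (_ : orthant a = [set x : E | forall i, `](a ord0 i), +oo[%classic (x ord0 i)]).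
  apply: (@measurable_forall_coord _ _ (fun i => `](a ord0 i), +oo[%classic)) => i.
  exact: measurable_itv.
apply/seteqP; split=> x h i; have := h i; by rewrite /= in_itv/= andbT.
Qed.

Lemma orthant_generate : @measurable _ E = <<s range orthant >>.
Proof.
apply/seteqP; split; last first.
  apply: smallest_sub; first exact: sigma_algebra_measurable.
  by move=> _ [a _ <-]; exact: measurable_orthant.
pose T := g_sigma_algebraType (range orthant).
have mo a : measurable (orthant a : set T) by apply: sub_sigma_algebra; exists a.
have mc i : measurable_fun setT (fun x : T => (x : E) ord0 i).
  apply: (measurability (@RGenOInfty.G R)); first exact: RGenOInfty.measurableE.
  move=> _ [_ [t ->] <-]; rewrite setTI.
  (* A half-space is the union of the orthants whose other corner coordinates are [- k]. *)
  rewrite (_ : _ @^-1` _ = \bigcup_k orthant (\row_j (if j == i then t else - k%:R))).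
    by apply: bigcup_measurable => k _; exact: mo.
  apply/seteqP; split=> [x|x [k _ /(_ i)]]; last by rewrite mxE eqxx /= in_itv/= andbT.
  rewrite /= in_itv/= andbT => tx; exists (Num.trunc `|x : E|).+1 => // j.
  rewrite mxE; case: eqP => [->//|_].
  rewrite ltrNl; apply: le_lt_trans (truncnS_gt _).
  by apply: le_trans (rV_entry_le _ j); rewrite -normrN ler_norm.
apply: smallest_sub; first exact: smallest_sigma_algebra.
rewrite -bigcup_seq => A [i _ [B mB <-]].
by have := mc i measurableT B mB.
Qed.

(** The shift by -1 makes [step (k s - 1)] vanish for [s <= 0] and equal 1 for [s >= 2 / k], so it
    tends to the indicator of [0 < s] at every point, boundary included. *)
Definition cutoff (a : R) (N : R) (k : nat) (t : R) : R :=
  step (k%:R * (t - a) - 1) * (step (k%:R * (t + N) - 1) * step (k%:R * (N - t) - 1)).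

Lemma Cinf_cutoff a N k : Cinf (cutoff a N k).
Proof.
move=> j; have H (b c : R) : Ck (fun _ : unit => 1 : R) j (fun t => step (b + c * t)).
  by apply: (Ck_comp (r := @step R)); [exact: Ck_step|exact: Ck_affine].
have -> : cutoff a N k = (fun t => step ((- (k%:R * a) - 1) + k%:R * t) *
    (step ((k%:R * N - 1) + k%:R * t) * step ((k%:R * N - 1) + (- k%:R) * t))).
  by apply/funext => t; rewrite /cutoff; congr (step _ * (step _ * step _)); ring.
by apply: CkM; [exact: H|apply: CkM; exact: H].
Qed.

Lemma cutoff_ge0 a N k t : 0 <= cutoff a N k t.
Proof. by apply: mulr_ge0; [|apply: mulr_ge0]; exact: step_ge0. Qed.

Lemma cutoff_le1 a N k t : cutoff a N k t <= 1.
Proof.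
have s01 (s : R) : 0 <= step s <= 1 by rewrite step_ge0 step_le1.
rewrite /cutoff; move: (s01 (k%:R * (t - a) - 1)) (s01 (k%:R * (t + N) - 1)) (s01
  (k%:R * (N - t) - 1)).
move: (step _) (step _) (step _) => x y z /andP[x0 x1] /andP[y0 y1] /andP[z0 z1].
by rewrite !mulr_ile1 ?mulr_ge0.
Qed.

Lemma cutoff0 a N k t : N < `|t| -> cutoff a N k t = 0.
Proof.
move=> tN; rewrite /cutoff; have k0 : 0 <= k%:R :> R by [].
have [t0|t0] := leP 0 t.
  rewrite ger0_norm// in tN.
  rewrite [step (k%:R * (N - t) - 1)]step0 ?mulr0//; nra.
rewrite ltr0_norm// in tN.
rewrite [step (k%:R * (t + N) - 1)]step0 ?mul0r ?mulr0//; nra.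
Qed.

Lemma step_cvg (s : R) :
  (fun k : nat => step (k%:R * s - 1)) @ \oo --> ((0 < s)%R%:R : R).
Proof.
apply: cvg_near_cst; case: (ltP 0 s) => s0 /=.
  near=> k; apply: step1; have : 2 / s <= k%:R.
    by near: k; exact: nbhs_infty_ger.
  by rewrite ler_pdivrMr// => h; lra.
apply: nearW => k; apply: step0.
by have k0 : 0 <= k%:R :> R by []; nra.
Unshelve. all: by end_near.
Qed.

Lemma cutoff_cvg (a N t : R) :
  (fun k => cutoff a N k t) @ \oo --> (((a < t) && (`|t| < N))%:R : R).
Proof.
have -> : ((a < t) && (`|t| < N))%:R = (0 < t - a)%R%:R * ((0 < t + N)%R%:R * (0 < N
  - t)%R%:R) :> R.
  rewrite -!natrM !mulnb ltr_norml !subr_gt0; congr (nat_of_bool (_ && (_ && _)))%:R.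
  by rewrite -[- N]sub0r ltrBlDr.
by apply: cvgM; [|apply: cvgM]; exact: step_cvg.
Qed.

Definition cell (N : R) : set E := [set x | forall i, `|x ord0 i| < N].

Lemma measurable_cell N : measurable (cell N).
Proof.
rewrite (_ : cell N = [set x : E | forall i, `](- N), N[%classic (x ord0 i)]).
  apply: (@measurable_forall_coord _ _ (fun i => `](- N), N[%classic)) => i.
  exact: measurable_itv.
by apply/seteqP; split=> x h i; have := h i; rewrite /= in_itv/= ltr_norml.
Qed.

Lemma tensor_cutoff_cvg (a : E) N (x : E) :
  (fun k => \prod_i cutoff (a ord0 i) N k (x ord0 i)) @ \oo -->
  (\1_(orthant a `&` cell N) x : R).
Proof.
have -> : \1_(orthant a `&` cell N) x = \prod_i ((a ord0 i < x ord0 i) && (`|x ord0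
  i| < N))%:R :> R.
  have [[h1 h2]|h] := pselect ((orthant a `&` cell N) x).
    rewrite indicE mem_set ?big1// => i _.
    by rewrite h1 h2.
  rewrite indicE memNset//.
  have [i xi] : exists i, ~ ((a ord0 i < x ord0 i) && (`|x ord0 i| < N)).
    by apply/existsNP => g; apply: h; split=> i; have /andP[] := g i.
  by rewrite (bigD1 i)//= (negbTE (introN idP xi)) mul0r.
apply: (@cvg_big _ _ _ _ _ (@mul_continuous R)) => i _; exact: cutoff_cvg.
Qed.

(** Dominated convergence along the tensor cutoffs, all supported in [box N], where [u] is
    integrable. *)
Lemma integral_orthant_cell u a N : L1loc u ->
  (forall phi, test_function phi -> \int[mu]_x (u x * phi x) = 0) ->
  (\int[mu]_(x in orthant a) (u x * \1_(cell N) x)%:E = 0)%E.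
Proof.
move=> [mu0 ui] u0; pose phi k (x : E) := \prod_i cutoff (a ord0 i) N k (x ord0 i).
have sphi k : smooth (phi k).
  by apply: (@smooth_tensor _ _ (fun i => cutoff (a ord0 i) N k)) => i;
    exact: Cinf_cutoff.
have bphi k : bsupp N (phi k) by apply: (@bsupp_tensor _ _ (fun i =>
  cutoff (a ord0 i) N k)) => i t; exact: cutoff0.
have tphi k : test_function (phi k) by apply/test_functionP; split=> //; exists N.
have phi01 k x : `|phi k x| <= 1.
  rewrite ger0_norm; last by apply: prodr_ge0 => i _; exact: cutoff_ge0.
  by apply: prodr_ile1 => i _; rewrite cutoff_ge0 cutoff_le1.
have gi : mu.-integrable setT (fun x => (`|u x| * \1_(box N) x)%:E).
  have := integrable_norm (ui N).
  move=> /(integrable_mkcond _ (measurable_box N)); apply: eq_integrable => // x _.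
  by rewrite patchE indicE; case: (x \in box N); rewrite /= ?mulr1 ?mulr0.
have mi (A : set E) : measurable A -> measurable_fun setT (\1_A : E ->
  R) by exact: measurable_indic.
have moc : measurable (orthant a `&` cell N).
  by apply: measurableI; [exact: measurable_orthant|exact: measurable_cell].
have hA k : measurable_fun setT (fun x => (u x * phi k x)%:E).
  apply/measurable_EFinP; apply: measurable_funM => //.
  exact: smooth_measurable.
have hB x : setT x -> (fun k => (u x * phi k x)%:E) @ \oo --> (u x * \1_(orthant a
  `&` cell N) x)%:E.
  move=> _; apply: cvg_EFin; first by apply: nearW.
  have H : (fun k => u x * phi k x) @ \oo --> u x * \1_(orthant a `&` cell N) x.
    by apply: cvgM; [exact: cvg_cst|exact: tensor_cutoff_cvg].
  exact: H.
have hC k x : setT x -> (`|(u x * phi k x)%:E| <= (`|u x| * \1_(box N) x)%:E)%E.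
  move=> _; rewrite abse_EFin lee_fin normrM ler_wpM2l// indicE.
  have [xN|xN] := pselect (box N x); first by rewrite mem_set.
  by rewrite memNset//= bphi// normr0.
have := dominated_cvg (g := fun x => (`|u x| * \1_(box N) x)%:E) measurableT hA hB
  (fun _ _ => isT) gi hC.
rewrite (_ : (fun k => _) = (fun=> 0%E)); last first.
  apply/funext => k; have /fineK <- : (\int[mu]_x (u x * phi k x)%:E \is a fin_num)%E.
    apply: integrable_fin_num => //.
    exact: (@L1loc_mul _ _ _ _ N 1 (conj mu0 ui) (smooth_measurable (sphi k)) (phi01
      k) (bphi k)).
  by have := u0 _ (tphi k); rewrite /Rintegral => ->.
move=> /(cvg_unique _ (cvg_cst _)) e; rewrite [RHS]e//.
rewrite [LHS]integral_mkcond; apply: eq_integral => x _.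
rewrite patchE indicE [in RHS]indicE in_setI; case: (x \in orthant a) => //=.
by rewrite mulr0.
Qed.

(** On each bounded cell the integrals of [u] over all Borel sets vanish, by Dynkin induction from
    the orthants; integrability on the cell handles complements and countable unions. The cells then
    exhaust the space. *)
Lemma ae_eq0_of_test u : L1loc u ->
  (forall phi, test_function phi -> \int[mu]_x (u x * phi x) = 0) ->
  {ae mu, forall x, u x = 0}.
Proof.
move=> uloc u0; have [mu0 ui] := uloc.
have vi N : mu.-integrable setT (fun x => (u x * \1_(cell N) x)%:E).
  apply: (L1loc_mul (M := N) (C := 1) uloc).
  - by apply: measurable_indic; exact: measurable_cell.
  - by move=> x; rewrite indicE; case: (_ \in _); rewrite ?normr1 ?normr0.
  - move=> x xN; rewrite indicE memNset// => h; apply: xN => i; exact: ltW (h i).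
(* The cell lies in the orthant with corner [- N]; this is the total integral from which complements
   are subtracted. *)
have vT N : (\int[mu]_x (u x * \1_(cell N) x)%:E = 0)%E.
  rewrite -(integral_orthant_cell (\row_i (- N)) N uloc u0) [RHS]integral_mkcond.
  apply: eq_integral => x _; rewrite patchE; case: ifPn => // /negP xo.
  rewrite indicE memNset ?mulr0// => h; apply: xo; rewrite inE => i; rewrite mxE.
  by have := h i; rewrite ltr_norml => /andP[].
have v0 N A : measurable A -> (\int[mu]_(x in A) (u x * \1_(cell N) x)%:E = 0)%E.
  rewrite orthant_generate; move: A.
  have mv A : measurable A -> measurable_fun A (fun x => (u x * \1_(cell N) x)%:E).
    by move=> _; apply: measurable_funTS; have /integrableP[] := vi N.
  apply: dynkin_induction => //.
  - exact: orthant_generate.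
  - move=> _ _ [a _ <-] [b _ <-]; exists (\row_i Num.max (a ord0 i) (b ord0 i)) => //.
    apply/seteqP; split=> x h; first by split=> i; have := h i;
      rewrite mxE gt_max => /andP[].
    by move=> i; have [h1 h2] := h; rewrite mxE gt_max h1 h2.
  - by move=> _ [a _ <-]; exact: integral_orthant_cell.
  - move=> A mA A0; have := vT N; rewrite -(setUv A) integral_setU//.
    + by rewrite A0 add0e.
    + exact: measurableC.
    + by apply: mv; apply: measurableU => //; exact: measurableC.
    + exact/disj_setPCl.
  - move=> F mF tF F0; rewrite integral_bigcup//.
      by apply: eseries0 => i _ _; exact: F0.
    exact: (integrableS measurableT (bigcup_measurable (fun k _ =>
      mF k)) (@subsetT _ _) (vi N)).
have : {ae mu, forall x, forall N : nat, (u x * \1_(cell N%:R) x)%:E = 0%E}.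
  apply: ae_foralln => N.
  have : ae_eq mu setT (fun x => (u x * \1_(cell N%:R) x)%:E) (cst 0%E).
    apply: integral_ae_eq => // A _ mA; rewrite v0//.
    by rewrite integral_cst// mul0e.
  by apply: filterS => x; exact.
apply: filterS => x /(_ (Num.trunc `|x|).+1) /eqP;
  rewrite eqe mulf_eq0 => /orP[/eqP//|].
rewrite indicE mem_set ?oner_eq0// => i.
by apply: le_lt_trans (truncnS_gt _); exact: rV_entry_le.
Qed.

End fundamental_lemma.

(** * Convolution and mollifiers *)

Section lipschitz.
Variables (R : realType).

(** The mean value inequality, with the bound asked only at points no farther from [s] than [t] is;
    [test_quadratic] applies it to a derivative that is small near [s]. *)
Lemma lipschitz_itv (F f : R -> R) (C s t : R) :
  (forall r : R, is_derive r 1 F (f r)) ->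
  (forall r, `|r - s| <= `|t - s| -> `|f r| <= C) -> `|F t - F s| <= C * `|t - s|.
Proof.
move=> dF fC; have cF : continuous F.
  by apply: derivable_continuous => r; have [] := dF r.
have [st|ts] := leP s t.
  have [r /itvP rst ->] := MVT_segment st (fun r _ => dF r) (continuous_subspaceT cF).
  rewrite normrM ler_wpM2r// fC// !ger0_norm ?subr_ge0 ?rst//.
  by rewrite lerD2r rst.
have [r /itvP rst e] := MVT_segment (ltW ts) (fun r _ =>
  dF r) (continuous_subspaceT cF).
rewrite distrC e normrM [`|t - s|]distrC ler_wpM2r// fC//.
rewrite !ler0_norm ?subr_le0 ?rst ?(ltW ts)//.
by rewrite lerN2 lerD2r rst.
Qed.

Lemma continuous_reflect (E : normedModType R) (f : E -> R) x :
  continuous f -> continuous (fun z => f (x - z)).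
Proof.
move=> cf z; apply: (continuous_comp (f := fun z : E => x - z) (g := f));
  last exact: cf.
by apply: continuousB; [exact: cst_continuous|move=> ?; exact: cvg_id].
Qed.

Lemma lipschitz_continuous_at (E : normedModType R) (f : E -> R) x A : 0 <= A ->
  (forall y, `|x - y| <= 1 -> `|f x - f y| <= A * `|x - y|) -> {for x, continuous f}.
Proof.
move=> A0 H; apply/cvgrPdist_le => e e0; near=> y.
have xy1 : `|x - y| <= Num.min 1 (e / (A + 1)).
  near: y; apply: cvgr_dist_le; first exact: cvg_id.
  by rewrite lt_min ltr01 divr_gt0// ltr_wpDl.
move: xy1; rewrite le_min => /andP[xy1]; rewrite ler_pdivlMr ?ltr_wpDl// => xy2.
by apply: le_trans (H _ xy1) _; have := normr_ge0 (x - y); nra.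
Unshelve. all: by end_near.
Qed.

Lemma rV_unconsK n : cancel (@rV_uncons R n) (@rV_cons R n).
Proof.
move=> x; apply/rowP => i; have [j ->|->] := unliftP ord0 i.
  by rewrite rV_consS mxE.
by rewrite rV_cons0.
Qed.

(** Coordinates are changed one at a time, which accounts for the factor [n]. *)
Lemma lipschitz_rV n (f : 'rV[R]_n -> R) (d : 'I_n -> 'rV[R]_n -> R) (C : R) :
  0 <= C -> (forall i x, is_derive x (delta_mx ord0 i) f (d i x)) ->
  (forall i x, `|d i x| <= C) -> forall x y, `|f x - f y| <= n%:R * C * `|x - y|.
Proof.
move=> C0; elim: n f d => [|n IH] f d df dC x y.
  by rewrite (thinmx0 x) (thinmx0 y) !subrr normr0 mul0r mul0r.
have xy : `|x ord0 ord0 - y ord0 ord0| <= `|x - y|.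
  by have := rV_entry_le (x - y) ord0; rewrite !mxE.
have xy' : `|(rV_uncons x).2 - (rV_uncons y).2| <= `|x - y|.
  apply: rV_norm_le => // i; rewrite !mxE.
  by have := rV_entry_le (x - y) (lift ord0 i); rewrite !mxE.
rewrite -{1}(rV_unconsK x) -{1}(rV_unconsK y).
move: xy xy'; rewrite -[x ord0 ord0]/(rV_uncons x).1 -[y ord0 ord0]/(rV_uncons y).1.
move: (rV_uncons x) (rV_uncons y) => [s v] [t w] /= xy xy'.
apply: le_trans (ler_distD (f (rV_cons (t, v))) _ _) _.
rewrite -natr1 mulrDl mul1r mulrDl addrC; apply: lerD.
  apply: le_trans (_ : n%:R * C * `|v - w| <= _); last by rewrite ler_wpM2l// mulr_ge0.
  apply: (IH (fun v => f (rV_cons (t, v))) (fun i v =>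
    d (lift ord0 i) (rV_cons (t, v)))) => // i z.
  have := df (lift ord0 i) (rV_cons (t, z)).
  move=> /is_derive_lineP H; apply/is_derive_lineP; move: H.
  by under eq_fun do rewrite rV_cons_lineS.
apply: le_trans (_ : C * `|s - t| <= _); last by rewrite ler_wpM2l.
apply: (@lipschitz_itv (fun t => f (rV_cons (t, v))) (fun t =>
  d ord0 (rV_cons (t, v)))) => // r.
have /is_derive_lineP H := df ord0 (rV_cons (r, v)); apply/is_derive_lineP; move: H.
by under eq_fun do rewrite rV_cons_line0; under [X in _ ->
  is_derive _ _ X _]eq_fun do rewrite [_%:A]mulr1.
Qed.

End lipschitz.

(** * Convolution with a test function *)

Section convolution.
Variables (R : realType) (n : nat).
Local Notation E := 'rV[R]_n.
Local Notation mu := (lebesgue_rV R n).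
Local Notation e_ i := (delta_mx ord0 i : E).
Local Notation CkE := (Ck (fun i : 'I_n => e_ i)).
Implicit Types (phi u p g : E -> R) (x y : E).

Lemma smooth_is_derive phi i x : smooth phi -> is_derive x (e_ i) phi (partial i phi x).
Proof. by move=> sf; apply: DeriveDef => //; have [_] := sf [::]; exact. Qed.

Lemma test_bounded phi : test_function phi ->
  exists2 C, 0 <= C & forall x, `|phi x| <= C.
Proof.
move=> /test_functionP[/smooth_continuous cphi [M bM]].
by have [C hC] := bsupp_bounded cphi bM; exists C => //; apply: le_trans (hC 0).
Qed.

Lemma test_lipschitz phi : test_function phi ->
  exists2 L, 0 <= L & forall x y, `|phi x - phi y| <= L * `|x - y|.
Proof.
move=> tphi; have /choice[C hC] i : exists C, 0 <= C /\ forall x,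
  `|partial i phi x| <= C.
  by have [C C0 hC] := test_bounded (test_function_partial i tphi); exists C.
have S0 : 0 <= \sum_i C i by apply: sumr_ge0 => i _; have [] := hC i.
exists (n%:R * \sum_i C i); first by rewrite mulr_ge0.
apply: (lipschitz_rV S0 (d := fun i => partial i phi)) => i x.
  by apply: smooth_is_derive; case: tphi.
apply: le_trans (_ : C i <= _); first by have [_] := hC i; exact.
by rewrite (bigD1 i)//= lerDl sumr_ge0// => j _; have [] := hC j.
Qed.

(** The mean value inequality for [phi (r e_i + x) - r partial i phi x], whose derivative in [r] is
    at most [L |r|] because [partial i phi] is Lipschitz. Being uniform in [x], the bound can be
    integrated in a convolution. *)
Lemma test_quadratic phi i : test_function phi -> exists2 L, 0 <= L &
  forall x h, `|phi (h *: e_ i + x) - phi x - h * partial i phi x| <= L * h ^+ 2.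
Proof.
move=> tphi; have [L L0 hL] := test_lipschitz (test_function_partial i tphi).
exists L => // x h.
have dF (r : R) : is_derive r 1 (fun r : R =>
  phi (r *: e_ i + x) + (- partial i phi x) * r)
    (partial i phi (r *: e_ i + x) + - partial i phi x).
  apply: is_deriveD; first by apply: is_derive_shift_line; apply: smooth_is_derive;
    case: tphi.
  by have := is_derive_affine 0 (- partial i phi x) r; under eq_fun do rewrite add0r.
have := @lipschitz_itv _ _ _ (L * `|h|) 0 h dF _.
rewrite subr0 mulr0 addr0 scale0r add0r => H.
apply: le_trans (_ : L * `|h| * `|h| <= _);
  last by rewrite -mulrA -expr2 real_normK// num_real.
apply: le_trans (H _); first by rewrite le_eqVlt; apply/orP; left; apply/eqP;
  congr `|_|; ring.
move=> r; rewrite subr0 => rh; apply: le_trans (hL _ _) _; rewrite addrK normrZ.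
rewrite ler_wpM2l//; apply: le_trans (_ : `|r| * 1 <= _); last by rewrite mulr1.
rewrite ler_wpM2l//; apply: rV_norm_le => // j; rewrite mxE; case: eqP => _ //=.
by case: eqP => _; rewrite ?normr1 ?normr0.
Qed.

Lemma reflect_is_derive phi x y i : smooth phi ->
  is_derive y (e_ i) (fun z => phi (x - z)) (- partial i phi (x - y)).
Proof.
move=> sphi; have /is_derive_lineP H := smooth_is_derive i (x - y) sphi.
apply/is_derive_lineP; rewrite -mulrN1.
have -> : (fun h : R => phi (x - (h *: e_ i + y))) =
    (fun h => (fun h : R => phi (h *: e_ i + (x - y))) (0 + (-1) * h)).
  by apply/funext => h; rewrite add0r mulN1r; congr phi; rewrite scaleNr opprD addrCA.
apply: (@is_derive1_comp _ (fun h : R => phi (h *: e_ i + (x - y))) (fun h =>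
  0 + (-1) * h)).
  by rewrite mulr0 addr0.
exact: is_derive_affine.
Qed.

Lemma reflect_smooth phi x : smooth phi -> smooth (fun z => phi (x - z)).
Proof.
move=> sphi; apply/smoothP => k; elim: k phi sphi => [|k IH] phi sphi.
  by split=> //; apply: continuous_reflect; exact: smooth_continuous.
split; first exact: Ck_cont (IH _ sphi).
move=> i; split=> [y|]; first by have [] := reflect_is_derive x y i sphi.
suff -> : 'D_(e_ i) (fun z => phi (x - z)) = (fun y => - partial i phi (x - y)).
  by apply: CkN; apply: IH; exact: smooth_partial.
by apply/funext => y; have [_] := reflect_is_derive x y i sphi.
Qed.

Lemma partial_reflect phi x i : smooth phi ->
  partial i (fun z => phi (x - z)) = (fun y => - partial i phi (x - y)).
Proof. by move=> sphi; apply/funext => y; have [_] := reflect_is_derive x y i sphi. Qed.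

Lemma bsupp_reflect M phi x : bsupp M phi -> bsupp (M + `|x|) (fun z => phi (x - z)).
Proof.
move=> bM y yM; apply: bM => h; apply: yM => i; have := h i; rewrite !mxE => xyi.
have := rV_entry_le x i; have := ler_distD (x ord0 i) 0 (y ord0 i).
by rewrite !sub0r !normrN; lra.
Qed.

Lemma reflect_test phi x : test_function phi -> test_function (fun z => phi (x - z)).
Proof.
move=> /test_functionP[sphi [M bM]]; apply/test_functionP; split.
  exact: reflect_smooth.
by exists (M + `|x|); exact: bsupp_reflect.
Qed.

Lemma bsuppS M N phi : M <= N -> bsupp M phi -> bsupp N phi.
Proof. by move=> MN bM x xN; apply: bM => xM; apply: xN; exact: subset_box xM. Qed.

Lemma test_functionD phi g : test_function phi -> test_function g ->
  test_function (fun x => phi x + g x).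
Proof.
move=> /test_functionP[sphi [M bM]] /test_functionP[sg [N bN]]; apply/test_functionP.
split; first exact: smoothD.
exists (Num.max M N) => x xMN.
have bM' : bsupp (Num.max M N) phi by apply: bsuppS bM; rewrite le_max lexx.
have bN' : bsupp (Num.max M N) g by apply: bsuppS bN; rewrite le_max lexx orbT.
by rewrite bM'// bN'// addr0.
Qed.

Lemma test_functionM phi g : smooth phi -> test_function g ->
  test_function (fun x => phi x * g x).
Proof.
move=> sphi /test_functionP[sg [N bN]]; apply/test_functionP.
split; first exact: smoothM.
by exists N => x /bN ->; rewrite mulr0.
Qed.

Lemma smooth_cst (c : R) : smooth (fun _ : E => c).
Proof. by apply/smoothP => k; exact: Ck_cst. Qed.

Lemma test_functionB phi g : test_function phi -> test_function g ->
  test_function (fun x => phi x - g x).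
Proof.
move=> tphi tg; have := test_functionD tphi (test_functionM (smooth_cst (-1)) tg).
by under eq_fun do rewrite mulN1r.
Qed.

Definition convol phi u x := \int[mu]_y (u y * phi (x - y)).

(** The local L1 norm, which is the constant in all estimates on convolutions. *)
Definition mass u M := \int[mu]_(y in box M) `|u y|.

Lemma L1loc_test u phi : L1loc u -> test_function phi ->
  mu.-integrable setT (fun y => (u y * phi y)%:E).
Proof.
move=> ul tphi; have [C _ hC] := test_bounded tphi.
have /test_functionP[sphi [M bM]] := tphi.
exact: L1loc_mul ul (smooth_measurable sphi) hC bM.
Qed.

Lemma mass_ge0 u M : 0 <= mass u M.
Proof. by apply: Rintegral_ge0. Qed.

Lemma Rintegral_mass_le u g M c : L1loc u -> measurable_fun setT g ->
  (forall y, `|g y| <= c) -> bsupp M g -> `|\int[mu]_y (u y * g y)| <= c * mass u M.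
Proof.
move=> ul mg gc bg; have [mu0 ui] := ul.
have gi := L1loc_mul ul mg gc bg.
apply: le_trans (le_normr_Rintegral _ gi) _ => //.
rewrite /mass -RintegralZl//; last 2 first.
- exact: measurable_box.
- exact: integrable_norm.
rewrite [leRHS]Rintegral_mkcond; apply: le_Rintegral => //.
- exact: integrable_norm gi.
- rewrite (_ : EFin \o _ = (EFin \o (fun y => c * `|u y|)) \_ (box M)); last first.
    by apply/funext => y; rewrite /= !patchE; case: ifP.
  apply/(integrable_mkcond _ (measurable_box M)).
  apply: (integrableZl (measurable_box M) _ (integrable_norm (ui M))).
- move=> y _; rewrite patchE normrM; case: ifPn => [_|/negP yM].
    by rewrite mulrC ler_wpM2r.
  by rewrite bg ?normr0 ?mulr0// => yB; apply: yM; rewrite inE.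
Qed.

Lemma convolB phi u x y : test_function phi -> L1loc u ->
  convol phi u x - convol phi u y = \int[mu]_z (u z * (phi (x - z) - phi (y - z))).
Proof.
move=> tphi ul; rewrite /convol -RintegralB//.
- by apply: eq_Rintegral => z _; rewrite mulrBr.
- exact: L1loc_test (reflect_test x tphi).
- exact: L1loc_test (reflect_test y tphi).
Qed.

Lemma convol_continuous phi u : test_function phi -> L1loc u ->
  continuous (convol phi u).
Proof.
move=> tphi ul x; have [L L0 hL] := test_lipschitz tphi.
have /test_functionP[sphi [M bM]] := tphi.
(* The box contains the supports of [z -> phi (y - z)] for all [y] with [|x - y| <= 1]. *)
pose A := L * mass u (M + (`|x| + 1)).
have H y : `|x - y| <= 1 -> `|convol phi u x - convol phi u y| <= A * `|x - y|.
  move=> xy; rewrite convolB// /A mulrAC.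
  apply: Rintegral_mass_le => //.
  - by apply: measurable_funB; apply: smooth_measurable; exact: reflect_smooth.
  - by move=> z; have := hL (x - z) (y - z); rewrite opprB addrA subrK.
  - move=> z zM; rewrite !(bsupp_reflect bM) ?subrr// => h; apply: zM.
      apply: subset_box h; rewrite lerD2l -[y](subrK x) addrC.
      by rewrite (le_trans (ler_normD _ _))// lerD2l distrC.
    by apply: subset_box h; rewrite lerD2l lerDl.
have A0 : 0 <= A by rewrite mulr_ge0// mass_ge0.
exact: lipschitz_continuous_at H.
Qed.

(** Differentiation under the integral sign: the quadratic remainder of [phi], uniform in the point,
    is integrated against [u] over a fixed box. *)
Lemma convol_is_derive phi u i x : test_function phi -> L1loc u ->
  is_derive x (e_ i) (convol phi u) (convol (partial i phi) u x).
Proof.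
move=> tphi ul; have [L L0 hL] := test_quadratic i tphi.
have /test_functionP[sphi [M bM]] := tphi.
apply: (@is_derive_quadratic _ _ _ _ _ _ (L * mass u (M + (`|x| + 1)))) => h h1.
have tp := test_function_partial i tphi.
rewrite convolB// /convol -RintegralZl//; last exact: L1loc_test (reflect_test x tp).
have tB : test_function (fun z => phi (h *: e_ i + x - z) - phi (x - z)).
  by apply: test_functionB; exact: reflect_test.
have tZ : test_function (fun z => h * partial i phi (x - z)).
  by apply: test_functionM (smooth_cst h) _; exact: reflect_test.
rewrite -RintegralB//; last 2 first.
- exact: L1loc_test tB.
- by have := L1loc_test ul tZ; under eq_fun do rewrite mulrCA.
have -> : \int[mu]_z (u z * (phi (h *: e_ i + x - z) - phi (x - z)) -
    h * (u z * partial i phi (x - z))) = \int[mu]_z (u z *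
    (phi (h *: e_ i + (x - z)) - phi (x - z) - h * partial i phi (x - z))).
  by apply: eq_Rintegral => z _; rewrite addrA; ring.
rewrite mulrAC; apply: Rintegral_mass_le => //.
- by have [/smooth_measurable] := test_functionB tB tZ;
  under eq_fun do rewrite -[_ + x - _]addrA.
have he : `|h *: e_ i + x| <= `|x| + 1.
  rewrite addrC (le_trans (ler_normD _ _))// lerD2l normrZ.
  apply: le_trans (_ : `|h| * 1 <= _); last by rewrite mulr1.
  rewrite ler_wpM2l//; apply: rV_norm_le => // j; rewrite mxE; case: eqP => _ //=.
  by case: eqP => _; rewrite ?normr1 ?normr0.
have x1 : `|x| <= `|x| + 1 by rewrite lerDl.
have bp : bsupp M (partial i phi) by exact: bsupp_partial.
move=> z zM; rewrite addrA (bsuppS _ (bsupp_reflect bM) zM) ?lerD2l//.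
by rewrite (bsuppS _ (bsupp_reflect bM) zM) ?(bsuppS _ (bsupp_reflect bp) zM)
  ?lerD2l// mulr0 !subr0.
Qed.

Lemma convol_smooth phi u : test_function phi -> L1loc u -> smooth (convol phi u).
Proof.
move=> tphi ul; apply/smoothP => k; elim: k phi tphi => [|k IH] phi tphi.
  by split=> //; exact: convol_continuous.
split; first exact: convol_continuous.
move=> i; split=> [y|]; first by have [] := convol_is_derive i y tphi ul.
suff -> : 'D_(e_ i) (convol phi u) = convol (partial i phi) u.
  by apply: IH; exact: test_function_partial.
by apply/funext => y; have [_] := convol_is_derive i y tphi ul.
Qed.

Definition weak_derivative i u p := forall phi, test_function phi ->
  \int[mu]_x (u x * partial i phi x) = - \int[mu]_x (p x * phi x).

(** The weak derivative is tested with the reflected kernel [z -> phi (x - z)]; the minus sign from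
    the reflection cancels the one in [weak_derivative]. *)
Lemma partial_convol phi u p i : test_function phi -> L1loc u ->
  weak_derivative i u p -> partial i (convol phi u) = convol phi p.
Proof.
move=> tphi ul up; apply/funext => x.
rewrite /partial; have [_ ->] := convol_is_derive i x tphi ul; rewrite /convol.
have sphi : smooth phi by case: tphi.
have := up _ (reflect_test x tphi); rewrite partial_reflect// => H.
rewrite -[RHS]opprK -H -[RHS]mulN1r -RintegralZl//; last first.
  have := L1loc_test ul (test_function_partial i (reflect_test x tphi)).
  by rewrite partial_reflect.
by apply: eq_Rintegral => y _; rewrite mulrN mulN1r opprK.
Qed.

End convolution.

(** * Density of test functions in L2 *)

Section test_L2.
Variables (R : realType) (n : nat).
Local Notation E := 'rV[R]_n.
Local Notation mu := (lebesgue_rV R n).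
Local Notation L2r := (Lfun mu 2%:E).
Implicit Types (phi psi u v : E -> R) (f g : L2 mu).

Lemma test_Lfun2 phi : test_function phi -> phi \in L2r.
Proof.
move=> tphi; have [C _ hC] := test_bounded tphi.
have /test_functionP[sphi [M bM]] := tphi.
exact: Lfun2_bsupp (smooth_measurable sphi) hC bM.
Qed.

Lemma ip_test_eq0 u : u \in L2r -> (forall phi, test_function phi -> ip mu u phi = 0) ->
  {ae mu, forall x, u x = 0}.
Proof. by move=> uL; apply: ae_eq0_of_test; exact: L1loc_Lfun2. Qed.

Lemma L2_exists_pair u v : u \in L2r -> v \in L2r ->
  exists f : L2 mu, {ae mu, forall x, f x = u x +i* v x}.
Proof.
move=> uL vL; apply: L2_exists; rewrite cLfun2E.
by apply/andP; split; [exact: uL|exact: vL].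
Qed.

Lemma L2_pairE f u v : {ae mu, forall x, f x = u x +i* v x} ->
  {ae mu, forall x, L2re f x = u x} /\ {ae mu, forall x, L2im f x = v x}.
Proof. by move=> fE; split; apply: filterS fE => x; rewrite /L2re /L2im => ->. Qed.

Lemma rin_L2_pair f g (s t : E -> R) : s \in L2r -> t \in L2r ->
  {ae mu, forall x, g x = s x +i* t x} ->
  rin (L2_innerSpace mu) f g = ip mu (L2re f) s + ip mu (L2im f) t.
Proof.
move=> sL tL /L2_pairE[gr gi]; rewrite /rin L2_space_innerE.
by congr (_ + _); apply: ip_ae => //; by [exact: L2reP|exact: L2imP|exact: nearW].
Qed.

Definition test_L2 : set (L2 mu) := [set f | exists phi psi,
  [/\ test_function phi, test_function psi & {ae mu, forall x, f x = phi x +i* psi x}]].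

Lemma test_function0 : test_function (fun _ : E => 0 : R).
Proof.
apply/test_functionP; split; first exact: smooth_cst.
by exists 0.
Qed.

Lemma L2_fun0 : {ae mu, forall x, (0 : L2 mu) x = 0}.
Proof.
have := L2_pi_ae (0 : cLfun2Type mu).
by rewrite raddf0; apply: filterS => x ->.
Qed.

Lemma test_L2_linsub : linsub (test_L2 : set (L2_innerSpace mu)).
Proof.
have Z c phi : test_function phi -> test_function (fun x => c * phi x).
  by move=> tphi; exact: test_functionM (smooth_cst c) tphi.
split.
  exists (fun=> 0), (fun=> 0); split; [exact: test_function0..|].
  exact: L2_fun0.
move=> [a b] f g [p1 [q1 [tp1 tq1 fE]]] [p2 [q2 [tp2 tq2 gE]]].
exists (fun x => (a * p1 x - b * q1 x) + p2 x), (fun x =>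
  (a * q1 x + b * p1 x) + q2 x); split.
- by apply: test_functionD => //; apply: test_functionB; exact: Z.
- by apply: test_functionD => //; apply: test_functionD; exact: Z.
near=> x; rewrite (near (L2_funDZ (a +i* b) f g) x)//.
by rewrite (near fE x)// (near gE x).
Unshelve. all: by end_near.
Qed.

(** A vector orthogonal to all test functions has vanishing real and imaginary parts, by the
    fundamental lemma applied to each. *)
Lemma test_L2_dense : hdense (L2_innerSpace mu) test_L2.
Proof.
apply: (dense_of_trivial_orthogonal (@L2_preHilbert _ _ _ mu) (@L2_complete _ _ _ mu)
  test_L2_linsub) => //.
move=> f _ f0; have ip0 u : u \in L2r -> ip mu u (fun=> 0) = 0.
  by move=> uL; rewrite /ip /Rintegral integral0_eq// => x _; rewrite mulr0.
have zL : (fun=> 0) \in L2r by exact: Lfun2_0.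
have re0 : {ae mu, forall x, L2re f x = 0}.
  apply: ip_test_eq0 => [|phi tphi]; first exact: L2reP.
  have pL := test_Lfun2 tphi.
  have [g gE] := L2_exists_pair pL zL.
  have := f0 g; rewrite (rin_L2_pair f pL zL gE) ip0 ?L2imP// addr0; apply.
  by exists phi, (fun=> 0); split=> //; exact: test_function0.
have im0 : {ae mu, forall x, L2im f x = 0}.
  apply: ip_test_eq0 => [|phi tphi]; first exact: L2imP.
  have pL := test_Lfun2 tphi.
  have [g gE] := L2_exists_pair zL pL.
  have := f0 g; rewrite (rin_L2_pair f zL pL gE) ip0 ?L2reP// add0r; apply.
  by exists (fun=> 0), phi; split=> //; exact: test_function0.
apply/L2_eqP; near=> x; rewrite (near L2_fun0 x)//.
have := near re0 x; have := near im0 x; rewrite /L2re /L2im.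
by case: (L2_fun f x) => a b /= -> // -> //.
Unshelve. all: by end_near.
Qed.

(** The function is viewed as the real part of an element of L2, and only the real part of the
    complex approximation is kept. *)
Lemma test_approx u (e : R) : u \in L2r -> 0 < e ->
  exists2 phi, test_function phi & (\int[mu]_x ((u x - phi x) ^+ 2)%:E <= e%:E)%E.
Proof.
move=> uL e0; have [f fE] := L2_exists_pair uL (Lfun2_0 mu).
have [fr fi] := L2_pairE fE.
have [_ /(_ f I (Num.sqrt e))[]] := test_L2_dense; first by rewrite sqrtr_gt0.
move=> g [phi [psi [tphi tpsi gE]]]; have [gr gi] := L2_pairE gE.
rewrite -(@ltr_pXn2r _ 2)// ?nnegrE ?sqrtr_ge0// ?hnorm_ge0// L2_sqr_diff.
rewrite sqr_sqrtr ?(ltW e0)// => fg; exists phi => //.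
have dL : (fun x => u x - phi x) \in L2r by apply: Lfun2B => //; exact: test_Lfun2.
rewrite (ip_sqrE dL) lee_fin; apply: le_trans (ltW fg).
rewrite -[leLHS]addr0 lerD ?ip_ge0// le_eqVlt; apply/orP; left; apply/eqP.
have h : {ae mu, forall x, u x - phi x = L2re f x - L2re g x}.
  by near=> x; rewrite (near fr x)// (near gr x).
by apply: ip_ae => //; apply: Lfun2B; exact: L2reP.
Unshelve. all: by end_near.
Qed.

End test_L2.

(** * Mollifiers *)

Section mollifier.
Variables (R : realType) (n : nat).
Local Notation E := 'rV[R]_n.
Local Notation mu := (lebesgue_rV R n).
Local Notation leb := (@lebesgue_measure R).
Local Notation L2r := (Lfun mu 2%:E).
Implicit Types (phi u : E -> R) (x y : E).

Lemma is_derive_step_affine (b c t : R) :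
  is_derive t 1 (fun s => step (b + c * s)) (dstep (b + c * t) * c).
Proof.
apply: (@is_derive1_comp _ (@step R) (fun s => b + c * s)).
  exact: step_derive.
exact: is_derive_affine.
Qed.

Lemma continuous_dstep_affine (b c : R) : continuous (fun s : R => dstep (b + c * s)).
Proof.
apply: (@Ck_cont _ _ _ _ 0%N); apply: (Ck_comp (r := @dstep R));
  [exact: Ck_dstep|exact: Ck_affine].
Qed.

(** The integrand is the derivative of [s * step (b + c * t)] with [s] the sign of [c], which spares
    a change of variables. Negative [c] occurs when a kernel is integrated in the variable that it
    subtracts. *)
Lemma integral_dstep (b c : R) : c != 0 ->
  (\int[leb]_t (`|c| * dstep (b + c * t))%:E = 1)%E.
Proof.
move=> c0; pose w := `|c|^-1; pose s := Num.sg c;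
  have w0 : 0 < w by rewrite invr_gt0 normr_gt0.
have cE : c = s * `|c| by rewrite -numEsg.
have ccE : `|c| = s * c by rewrite normrEsg.
have ss : s * s = 1 by rewrite -expr2 sqr_sg c0.
have cw : `|c| * w = 1 by rewrite mulfV// normr_eq0.
pose t0 := - b / c; have bt : b + c * t0 = 0 by rewrite /t0 mulrC divfK// subrr.
have ab : t0 - w < t0 + w by lra.
have dF (t : R) : is_derive t 1 (fun t => s * step (b + c * t)) (`|c| * dstep (b + c
  * t)).
  rewrite (_ : `|c| * _ = s * (dstep (b + c * t) * c)); last by rewrite ccE; ring.
  exact: (is_deriveZ s (is_derive_step_affine b c t)).
rewrite (integral_derive_support ab dF).
- have -> : b + c * (t0 + w) = s by rewrite mulrDr addrA bt add0r cE -mulrA cw mulr1.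
  have -> : b + c * (t0 - w) = - s by rewrite mulrBr addrA bt add0r cE -mulrA cw mulr1.
  rewrite /s; case: sgrP c0 => //= _ _.
    by rewrite (@step1 _ 1)// (@step0 _ (-1))// mulr0 subr0 mulr1.
  by rewrite opprK (@step1 _ 1)// (@step0 _ (-1))// mulr0 sub0r mulN1r opprK.
- move=> t; apply: cvgM; [exact: cvg_cst|exact: continuous_dstep_affine].
- move=> t; rewrite in_itv/= -ler_distl -ltNge => tt; rewrite dstep0 ?mulr0//.
  have -> : b + c * t = c * (t - t0) by rewrite mulrBr; move: bt => /eqP;
    rewrite addr_eq0 => /eqP ->; ring.
  by rewrite normrM -cw ler_wpM2l// ltW.
Qed.

(** [dstep] has integral 1, so no normalising constant appears; [k.+1] keeps the scale positive. *)
Definition mollifier (k : nat) : E -> R :=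
  fun x => \prod_i (k.+1%:R * dstep (k.+1%:R * x ord0 i)).

Lemma mollifier_ge0 k x : 0 <= mollifier k x.
Proof. by apply: prodr_ge0 => i _; rewrite mulr_ge0// dstep_ge0. Qed.

Lemma mollifier_bsupp k : bsupp (k.+1%:R^-1) (mollifier k).
Proof.
apply: (@bsupp_tensor _ _ (fun _ t => k.+1%:R * dstep (k.+1%:R * t))) => _ t tk.
rewrite dstep0 ?mulr0// normrM ger0_norm// -[leLHS](@mulfV _ k.+1%:R)// ler_wpM2l//.
exact: ltW.
Qed.

Lemma mollifier_test k : test_function (mollifier k).
Proof.
apply/test_functionP; split; last by exists (k.+1%:R^-1); exact: mollifier_bsupp.
apply: (@smooth_tensor _ _ (fun _ t => k.+1%:R * dstep (k.+1%:R * t))) => _ j.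
apply: CkM; first exact: Ck_cst.
rewrite (_ : (fun t => _) = (fun t => dstep (0 + k.+1%:R * t))).
  by apply: (Ck_comp (r := @dstep R)); [exact: Ck_dstep|exact: Ck_affine].
by apply/funext => t; rewrite add0r.
Qed.

(** Mass one in [y] is used for Jensen's inequality; mass one in [x], proved next, is used after
    exchanging integrals. *)
Lemma mollifier_intl k x : (\int[mu]_y (mollifier k (x - y))%:E = 1)%E.
Proof.
have H := @ge0_integral_prod R n (fun i t =>
  `| - k.+1%:R| * dstep (k.+1%:R * x ord0 i + (- k.+1%:R) * t)).
transitivity (\int[mu]_y (\prod_i (`| - k.+1%:R| * dstep (k.+1%:R * x ord0 i + (-
  k.+1%:R) * y ord0 i)))%:E)%E.
  apply: eq_integral => y _; congr EFin; apply: eq_bigr => i _.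
  by rewrite !mxE normrN ger0_norm// mulrBr mulNr.
rewrite H.
- by rewrite big1// => i _; apply: integral_dstep; rewrite oppr_eq0.
- move=> i; apply: continuous_measurable_fun => t.
  by apply: cvgM; [exact: cvg_cst|exact: continuous_dstep_affine].
- by move=> i t; rewrite mulr_ge0// dstep_ge0.
Qed.

Lemma mollifier_intr k y : (\int[mu]_x (mollifier k (x - y))%:E = 1)%E.
Proof.
have H := @ge0_integral_prod R n (fun i t =>
  `|k.+1%:R| * dstep (- (k.+1%:R * y ord0 i) + k.+1%:R * t)).
transitivity (\int[mu]_x (\prod_i (`|k.+1%:R| * dstep (- (k.+1%:R * y ord0 i) +
  k.+1%:R * x ord0 i)))%:E)%E.
  apply: eq_integral => x _; congr EFin; apply: eq_bigr => i _.
  by rewrite !mxE ger0_norm// mulrBr addrC.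
rewrite H.
- by rewrite big1// => i _; exact: integral_dstep.
- move=> i; apply: continuous_measurable_fun => t.
  by apply: cvgM; [exact: cvg_cst|exact: continuous_dstep_affine].
- by move=> i t; rewrite mulr_ge0// dstep_ge0.
Qed.

(** Jensen's inequality as nonnegativity of a variance: the kernel has mass one, and [c] is the mean
    of [u] with respect to it. *)
Lemma convol_sqr_le k u x : u \in L2r ->
  convol (mollifier k) u x ^+ 2 <= convol (mollifier k) (fun y => u y ^+ 2) x.
Proof.
move=> uL; set c := convol (mollifier k) u x.
have tK := reflect_test x (mollifier_test k).
have ul := L1loc_Lfun2 uL; have u2l := L1loc_Lfun2_mul uL uL.
have i2 : mu.-integrable setT (fun y => (u y ^+ 2 * mollifier k (x - y))%:E).
  exact: L1loc_test u2l tK.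
have i1 : mu.-integrable setT (fun y => (2 * c * (u y * mollifier k (x - y)))%:E).
  exact: (integrableZl measurableT (2 * c) (L1loc_test ul tK)).
have i0 := L1loc_test (L1loc_cst n (c ^+ 2)) tK.
have i21 : mu.-integrable setT (fun y => (u y ^+ 2 * mollifier k (x - y) - 2 * c * (u
  y * mollifier k (x - y)))%:E).
  exact: (integrableB measurableT i2 i1).
have H : 0 <= \int[mu]_y ((u y - c) ^+ 2 * mollifier k (x - y)).
  by apply: Rintegral_ge0 => y _; rewrite mulr_ge0 ?sqr_ge0 ?mollifier_ge0.
have e : \int[mu]_y ((u y - c) ^+ 2 * mollifier k (x - y)) =
    \int[mu]_y ((u y ^+ 2 * mollifier k (x - y) - 2 * c * (u y * mollifier k (x - y)))
      + c ^+ 2 * mollifier k (x - y)).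
  by apply: eq_Rintegral => y _; ring.
rewrite e RintegralD// RintegralB// RintegralZl//in H; last exact: L1loc_test ul tK.
rewrite RintegralZl// in H; last first.
  by have := L1loc_test (L1loc_cst n 1) tK; under eq_fun do rewrite mul1r.
rewrite [\int[mu]_y mollifier k (x - y)]/Rintegral mollifier_intl /= mulr1 -/(convol
  _ u x) -/c in H.
by rewrite /convol; lra.
Qed.

Lemma measurable_convol k u : L1loc u -> measurable_fun setT (convol (mollifier k) u).
Proof. by move=> ul; apply: smooth_measurable;
  exact: convol_smooth (mollifier_test k) ul. Qed.

(** Jensen pointwise, then Tonelli, as the kernel integrates to one in [x] too. Mollification is
    thus a contraction of L2. *)
Lemma convol_integral_sqr_le k u : u \in L2r ->
  (\int[mu]_x (convol (mollifier k) u x ^+ 2)%:E <= \int[mu]_x (u x ^+ 2)%:E)%E.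
Proof.
move=> uL; have mu0 := Lfun2_measurable uL.
have tK := mollifier_test k; have [sK _] := tK.
pose F (p : E * E) := (u p.2 ^+ 2 * mollifier k (p.1 - p.2))%:E.
have F0 p : (0 <= F p)%E by rewrite lee_fin mulr_ge0 ?sqr_ge0 ?mollifier_ge0.
have mF : measurable_fun setT F.
  apply/measurable_EFinP; apply: measurable_funM.
    by apply: measurable_funX; apply: measurableT_comp.
  apply: measurableT_comp; first exact: smooth_measurable.
  apply: measurable_fun_rVP => i.
  rewrite (_ : _ \o _ = (fun p : E * E => rV_coord i p.1 - rV_coord i p.2)); last first.
    by apply/funext => p; rewrite /= /rV_coord !mxE.
  by apply: measurable_funB; apply: measurableT_comp => //; exact: measurable_rV_coord.
apply: (@le_trans _ _ (\int[mu]_x \int[mu]_y F (x, y))%E).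
  apply: ge0_le_integral => //.
  - by move=> x _; rewrite lee_fin sqr_ge0.
  - by apply: measurable_sqr; apply: measurable_convol; exact: L1loc_Lfun2.
  - exact: (measurable_fun_fubini_tonelli_F (m2 := mu) F mF F0).
  - move=> x _; apply: le_trans (_ : (convol (mollifier k) (fun y =>
    u y ^+ 2) x)%:E <= _)%E.
      by rewrite lee_fin; exact: convol_sqr_le.
    rewrite /convol /Rintegral fineK//; apply: integrable_fin_num => //.
    exact: L1loc_test (L1loc_Lfun2_mul uL uL) (reflect_test x tK).
rewrite (fubini_tonelli (m1 := mu) (m2 := mu) F mF F0) le_eqVlt; apply/orP; left;
  apply/eqP.
apply: eq_integral => y _; rewrite /F /=; under eq_integral do rewrite EFinM.
rewrite ge0_integralZl//.
- by rewrite mollifier_intr mule1.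
- apply/measurable_EFinP; apply: measurableT_comp; first exact: smooth_measurable.
  apply: measurable_fun_rVP => i.
  rewrite (_ : _ \o _ = (fun x : E => rV_coord i x - y ord0 i)); last first.
    by apply/funext => p; rewrite /= /rV_coord !mxE.
  by apply: measurable_funB => //; exact: measurable_rV_coord.
- by move=> x _; rewrite lee_fin mollifier_ge0.
- by rewrite lee_fin sqr_ge0.
Qed.

Lemma convol_Lfun2 k u : u \in L2r -> convol (mollifier k) u \in L2r.
Proof.
move=> uL; apply: Lfun2I; first by apply: measurable_convol; exact: L1loc_Lfun2.
exact: le_lt_trans (convol_integral_sqr_le k uL) (Lfun2_sqr_lty uL).
Qed.

Lemma convol_test_dist k phi L x : 0 <= L -> test_function phi ->
  (forall x y, `|phi x - phi y| <= L * `|x - y|) ->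
  `|convol (mollifier k) phi x - phi x| <= L / k.+1%:R.
Proof.
move=> L0 tphi hL; have tK := reflect_test x (mollifier_test k).
have i1 : mu.-integrable setT (fun y => (mollifier k (x - y))%:E).
  by have := L1loc_test (L1loc_cst n 1) tK; under eq_fun do rewrite mul1r.
have i0 := L1loc_test (L1loc_Lfun2 (test_Lfun2 tphi)) tK.
have ic c : mu.-integrable setT (fun y => (c * mollifier k (x - y))%:E).
  exact: L1loc_test (L1loc_cst n c) tK.
have K1 c : \int[mu]_y (c * mollifier k (x - y)) = c.
  by rewrite RintegralZl// /Rintegral mollifier_intl /= mulr1.
rewrite -[X in _ - X](K1 (phi x)) /convol -RintegralB//; last exact: ic.
have ii : mu.-integrable setT (fun y => (phi y * mollifier k (x - y) - phi x *
  mollifier k (x - y))%:E).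
  exact: (integrableB measurableT i0 (ic _)).
apply: le_trans (le_normr_Rintegral _ ii) _ => //.
rewrite -[leRHS]K1; apply: le_Rintegral => //.
- exact: integrable_norm ii.
- exact: ic.
move=> y _; rewrite -mulrBl normrM [`|mollifier _ _|]ger0_norm ?mollifier_ge0//.
have [yk|yk] := pselect (box (k.+1%:R^-1) (x - y));
  last by rewrite mollifier_bsupp// !mulr0.
rewrite ler_wpM2r ?mollifier_ge0// distrC; apply: le_trans (hL _ _) _.
by rewrite ler_wpM2l//; apply: rV_norm_le => //; rewrite invr_ge0.
Qed.

Lemma convol_test_bsupp k phi M : bsupp M phi ->
  bsupp (M + 1) (convol (mollifier k) phi).
Proof.
move=> bM x xM; rewrite /convol /Rintegral integral0_eq// => y _.
have [yM|yM] := pselect (box M y); last by rewrite bM// mul0r.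
rewrite [mollifier _ _](mollifier_bsupp (k := k)) ?mulr0// => h; apply: xM => i.
have := h i; have := yM i; rewrite !mxE.
have : k.+1%:R^-1 <= 1 :> R by rewrite invf_le1// ler1n.
move: (k.+1%:R^-1) => z; have := ler_distD (y ord0 i) (x ord0 i) 0; rewrite !subr0; lra.
Qed.

Lemma convol_test_cvg phi : test_function phi ->
  cvg2 mu (fun k => convol (mollifier k) phi) phi.
Proof.
move=> tphi e e0; have [L L0 hL] := test_lipschitz tphi.
have /test_functionP[sphi [M bM]] := tphi.
pose B := fine (mu (box (M + 1))).
have B0 : 0 <= B by rewrite fine_ge0.
have muB : mu (box (M + 1)) = B%:E.
  by rewrite /B fineK// ge0_fin_numE// box_lty.
(* Chosen so that [L ^+ 2 * B / k.+1 <= e]; the estimate has the square of [k.+1] in the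
   denominator, and one factor is given away. *)
exists (Num.trunc (L ^+ 2 * B / e)) => k hk.
have ek : L ^+ 2 * B / k.+1%:R <= e.
  have this : L ^+ 2 * B / e <= k.+1%:R by apply: le_trans (ltW (truncnS_gt _)) _;
    rewrite ler_nat.
  by move: this; rewrite ler_pdivrMr// => h; rewrite ler_pdivrMr// [e * _]mulrC.
apply: (@le_trans _ _ (\int[mu]_x (((L / k.+1%:R) ^+ 2)%:E * (\1_(box (M + 1))
  x)%:E))%E).
  apply: ge0_le_integral => //.
  - by move=> x _; rewrite lee_fin sqr_ge0.
  - apply: measurable_sqr; apply: measurable_funB; last exact: smooth_measurable.
    by apply: measurable_convol; apply: L1loc_Lfun2; exact: test_Lfun2.
  - apply: measurable_funeM; apply/measurable_EFinP; apply: measurable_indic;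
    exact: measurable_box.
  - move=> x _; rewrite -EFinM lee_fin indicE; have [xM|xM] := pselect (box (M + 1) x).
      rewrite mem_set// mulr1 -real_normK ?num_real// lerXn2r ?nnegrE ?divr_ge0//.
      exact: convol_test_dist.
    rewrite (convol_test_bsupp k bM xM) (bsuppS _ bM xM) ?lerDl//.
    by rewrite subr0 expr0n mulr_ge0 ?sqr_ge0.
rewrite ge0_integralZl//; last 2 first.
- by apply/measurable_EFinP; apply: measurable_indic; exact: measurable_box.
- by rewrite lee_fin sqr_ge0.
rewrite integral_indic//; last exact: measurable_box.
rewrite setIT [X in (_ * X)%E]muB lee_fin; apply: le_trans ek.
have z0 : 0 <= k.+1%:R^-1 :> R by rewrite invr_ge0.
have z1 : k.+1%:R^-1 <= 1 :> R by rewrite invf_le1// ler1n.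
have -> : (L / k.+1%:R) ^+ 2 * B = L ^+ 2 * B / k.+1%:R * k.+1%:R^-1 by ring.
by rewrite ler_piMr// !mulr_ge0 ?sqr_ge0.
Qed.

(** The contraction property reduces the claim to the dense class of test functions, where
    convergence is uniform with supports in a fixed box. *)
Lemma convol_cvg u : u \in L2r -> cvg2 mu (fun k => convol (mollifier k) u) u.
Proof.
(* Splitting twice by [(a + b)^2 <= 2 a^2 + 2 b^2] costs [2 + 4 + 4 = 10]. *)
move=> uL e e0; have e10 : 0 < e / 10 by rewrite divr_gt0.
have [phi tphi hphi] := test_approx uL e10.
have [N hN] := convol_test_cvg tphi e10; exists N => k Nk.
have pL := test_Lfun2 tphi.
have tK x := reflect_test x (mollifier_test k).
have dL := Lfun2B uL pL.
have d1 := le_trans (convol_integral_sqr_le k dL) hphi.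
have d2 := hN k Nk.
have convB1 x : convol (mollifier k) (fun y => u y - phi y) x =
    convol (mollifier k) u x - convol (mollifier k) phi x.
  rewrite /convol -RintegralB//; last 2 first.
  - exact: L1loc_test (L1loc_Lfun2 uL) (tK x).
  - exact: L1loc_test (L1loc_Lfun2 pL) (tK x).
  by apply: eq_Rintegral => y _; rewrite mulrBl.
have L1 := convol_Lfun2 k dL; have L2 := Lfun2B (convol_Lfun2 k pL) pL.
have L3 := Lfun2B pL uL.
have -> : (fun x => ((convol (mollifier k) u x - u x) ^+ 2)%:E) =
    (fun x => ((convol (mollifier k) (fun y => u y - phi y) x +
      ((convol (mollifier k) phi x - phi x) + (phi x - u x))) ^+ 2)%:E).
  by apply/funext => x; congr ((_ ^+ 2)%:E); rewrite convB1; ring.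
apply: le_trans (integral_sqrD_le L1 (Lfun2D L2 L3)) _.
have d3 : (\int[mu]_x ((phi x - u x) ^+ 2)%:E <= (e / 10)%:E)%E.
  by under eq_integral do rewrite -sqrrN opprB.
have d4 := le_trans (integral_sqrD_le L2 L3) (leeD (lee_wpmul2l (lee0n 2) d2)
  (lee_wpmul2l (lee0n 2) d3)).
apply: (@le_trans _ _ (2%:E * (e / 10)%:E + 2%:E * (2%:E * (e / 10)%:E + 2%:E * (e /
  10)%:E))%E).
  by apply: leeD; apply: lee_wpmul2l.
change ((2 * (e / 10) + 2 * (2 * (e / 10) + 2 * (e / 10)))%:E <= e%:E)%E.
by rewrite lee_fin; lra.
Qed.

End mollifier.

(** * Uniqueness of weak solutions *)

Section atan.
Variable R : realType.

Lemma Ck_atan k : Ck (fun _ : unit => 1 : R) k (@atan R).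
Proof.
have ca : continuous (@atan R) by move=> x; exact: continuous_atan.
case: k => [|k]; split=> // i; split=> [x|]; first exact: derivable_atan.
have -> : 'D_(1 : R) (@atan R) = (fun x => (1 + x * x)^-1).
  by apply/funext => x; have [_] := is_derive1_atan x; rewrite expr2.
apply: CkV => [x|]; first by rewrite gt_eqF// ltr_pwDl// -expr2 sqr_ge0.
by apply: CkD; [exact: Ck_cst|apply: CkM; exact: Ck_id].
Qed.

(** Puts [atan u] in L2 along with [u], whence [u atan u] is integrable. *)
Lemma normr_atan_le (t : R) : `|atan t| <= `|t|.
Proof.
have := @lipschitz_itv R atan (fun x => (1 + x ^+ 2)^-1) 1 0 t (fun r =>
  is_derive1_atan r).
rewrite atan0 !subr0 mul1r; apply=> r _; rewrite ger0_norm ?invr_ge0 ?addr_ge0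
  ?sqr_ge0//.
by rewrite invf_le1 ?lerDl ?sqr_ge0// ltr_pwDl// sqr_ge0.
Qed.

Lemma normr_atan_pi2 (t : R) : `|atan t| <= pi / 2.
Proof. by rewrite ler_norml !ltW// ?atan_ltpi2 ?atan_gtNpi2. Qed.

Lemma mulr_atan_ge0 (t : R) : 0 <= t * atan t.
Proof.
have [t0|t0] := leP 0 t; first by rewrite mulr_ge0// -atan0 le_atan.
by rewrite mulr_le0 ?(ltW t0)// -atan0 le_atan// ltW.
Qed.

Lemma mulr_atan_eq0 (t : R) : t * atan t = 0 -> t = 0.
Proof.
move=> /eqP; rewrite mulf_eq0 => /orP[/eqP//|/eqP a0].
by rewrite -[t]atanK a0 tan0.
Qed.

End atan.

Section integral_sums.
Context d (T : measurableType d) (R : realType) (mu : {measure set T -> \bar R}).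

Lemma Rintegral_sum (I : Type) (s : seq I) (F : I -> T -> R) :
  (forall i, mu.-integrable setT (EFin \o F i)) ->
  mu.-integrable setT (fun x => (\sum_(i <- s) F i x)%:E) /\
  \int[mu]_x (\sum_(i <- s) F i x) = \sum_(i <- s) \int[mu]_x F i x.
Proof.
move=> Fi; elim: s => [|i s [IH1 IH2]].
  under eq_fun do rewrite big_nil; under eq_Rintegral do rewrite big_nil.
  rewrite big_nil; split; first exact: integrable0.
  by rewrite /Rintegral integral0.
under eq_fun do rewrite big_cons; under eq_Rintegral do rewrite big_cons.
rewrite big_cons; split; last by rewrite RintegralD// IH2.
exact: (integrableD measurableT (Fi i) IH1).
Qed.

Lemma integrable_mul_bounded (f b : T -> R) C : mu.-integrable setT (EFin \o f) ->
  measurable_fun setT b -> (forall x, `|b x| <= C) ->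
  mu.-integrable setT (fun x => (f x * b x)%:E).
Proof.
move=> fi mb bC; have [/measurable_EFinP mf _] := integrableP _ _ _ fi.
apply: (@le_integrable _ _ _ _ _ measurableT _ (fun x => C%:E * (f x)%:E)%E).
- by apply/measurable_EFinP; exact: measurable_funM.
- move=> x _; rewrite -EFinM lee_fin !normrM mulrC ler_wpM2r//.
  by apply: le_trans (bC x) _; exact: ler_norm.
- exact: integrableZl.
Qed.

Lemma Rintegral_eq0_ae (f : T -> R) : (forall x, 0 <= f x) ->
  mu.-integrable setT (EFin \o f) -> \int[mu]_x f x = 0 -> {ae mu, forall x, f x = 0}.
Proof.
move=> f0 fi if0; have [mf _] := integrableP _ _ _ fi.
have : (\int[mu]_x `|(f x)%:E| = 0)%E.
  rewrite -[RHS]/(0%:E) -if0 /Rintegral fineK; last exact: integrable_fin_num.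
  by apply: eq_integral => x _; rewrite abse_EFin ger0_norm.
move=> /(ae_eq_integral_abs _ measurableT mf); apply: filterS => x /(_ I) /eqP.
by rewrite eqe => /eqP.
Qed.

End integral_sums.

Section cutoff_functions.
Variables (R : realType) (n : nat).
Local Notation E := 'rV[R]_n.
Local Notation e_ i := (delta_mx ord0 i : E).
Implicit Types (phi : E -> R) (x : E).

Lemma scale_is_derive phi (a : R) x i : smooth phi ->
  is_derive x (e_ i) (fun z => phi (a *: z)) (partial i phi (a *: x) * a).
Proof.
move=> sphi; have /is_derive_lineP H := smooth_is_derive i (a *: x) sphi.
apply/is_derive_lineP.
have -> : (fun h : R => phi (a *: (h *: e_ i + x))) =
    (fun h => (fun h : R => phi (h *: e_ i + a *: x)) (0 + a * h)).
  by apply/funext => h; rewrite add0r scalerDr scalerA.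
apply: (@is_derive1_comp _ (fun h : R => phi (h *: e_ i + a *: x)) (fun h =>
  0 + a * h)).
  by rewrite mulr0 addr0.
exact: is_derive_affine.
Qed.

Lemma scale_smooth phi (a : R) : smooth phi -> smooth (fun z => phi (a *: z)).
Proof.
move=> sphi; apply/smoothP => k; elim: k phi sphi => [|k IH] phi sphi.
  split=> // z; apply: (continuous_comp (f := fun z : E => a *: z) (g := phi)).
    exact: scaler_continuous.
  exact: smooth_continuous.
split; first exact: Ck_cont (IH _ sphi).
move=> i; split=> [y|]; first by have [] := scale_is_derive a y i sphi.
suff -> : 'D_(e_ i) (fun z => phi (a *: z)) = (fun y => partial i phi (a *: y) * a).
  by apply: CkM; [apply: IH; exact: smooth_partial|exact: Ck_cst].
by apply/funext => y; have [_] := scale_is_derive a y i sphi.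
Qed.

Lemma partial_scale phi (a : R) i : smooth phi ->
  partial i (fun z => phi (a *: z)) = (fun y => partial i phi (a *: y) * a).
Proof. by move=> sphi; apply/funext => y; have [_] := scale_is_derive a y i sphi. Qed.

(** Rescaling a fixed cutoff divides its gradient by [r]. The profile [step (2 + t) * step (2 - t)]
    is 1 for [|t| <= 1] and 0 for [|t| >= 3]. *)
Lemma cutoff_family : exists (C : R) (chi : R -> E -> R), 0 <= C /\ forall r, 0 < r ->
  [/\ test_function (chi r), forall x, 0 <= chi r x <= 1,
      forall x, box r x -> chi r x = 1 & forall i x, `|partial i (chi r) x| <= C / r].
Proof.
pose c (t : R) := step (2 + t) * step (2 - t).
have c01 t : 0 <= c t <= 1.
  by rewrite mulr_ge0 ?step_ge0// mulr_ile1 ?step_ge0 ?step_le1.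
pose chi x := \prod_i c (x ord0 i).
have tchi : test_function chi.
  apply/test_functionP; split.
    apply: (@smooth_tensor _ _ (fun=> c)) => _ k.
    rewrite (_ : c = fun t => step (2 + 1 * t) * step (2 + (-1) * t)); last first.
      by apply/funext => t; rewrite mul1r mulN1r.
    by apply: CkM; apply: (Ck_comp (r := @step R));
      by [exact: Ck_step|exact: Ck_affine].
  exists 3; apply: (@bsupp_tensor _ _ (fun=> c)) => _ t; rewrite /c.
  have [t0|t0] := leP 0 t.
    by rewrite ger0_norm// => t3; rewrite [step (2 - t)]step0 ?mulr0//; lra.
  by rewrite ltr0_norm// => t3; rewrite [step (2 + t)]step0 ?mul0r//; lra.
have [schi _] := tchi.
have /choice[C hC] i : exists C, 0 <= C /\ forall x, `|partial i chi x| <= C.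
  by have [C C0 hC] := test_bounded (test_function_partial i tchi); exists C.
exists (\sum_i C i), (fun r x => chi (r^-1 *: x)); split.
  by apply: sumr_ge0 => i _; have [] := hC i.
move=> r r0; split.
- have /test_functionP[_ [M bM]] := tchi; apply/test_functionP; split;
  first exact: scale_smooth.
  exists (r * M) => x xM; apply: bM => h; apply: xM => i; have := h i.
  by rewrite mxE normrM ger0_norm ?invr_ge0 ?(ltW r0)// mulrC ler_pdivrMr// mulrC.
- move=> x; apply/andP; split; last by apply: prodr_ile1 => i _; exact: c01.
  by apply: prodr_ge0 => i _; have /andP[] := c01 ((r^-1 *: x) ord0 i).
- move=> x xr; rewrite /chi big1// => i _; rewrite mxE.
  have : `|r^-1 * x ord0 i| <= 1.
    by rewrite normrM ger0_norm ?invr_ge0 ?(ltW r0)// mulrC ler_pdivrMr// mul1r.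
  by move: (_ * _) => t; rewrite ler_norml => /andP[t1 t2];
    rewrite /c !step1 ?mulr1//; lra.
- move=> i x; rewrite partial_scale// normrM [`|r^-1|]ger0_norm ?invr_ge0 ?(ltW r0)//.
  rewrite ler_wpM2r ?invr_ge0 ?(ltW r0)//; apply: le_trans (_ : C i <= _).
    by have [_] := hC i; exact.
  by rewrite (bigD1 i)//= lerDl sumr_ge0// => j _; have [] := hC j.
Qed.

End cutoff_functions.

(** * Testing the weak equation with arctangents *)

Section weak_uniqueness.
Variables (R : realType) (n : nat).
Local Notation E := 'rV[R]_n.
Local Notation mu := (lebesgue_rV R n).
Local Notation L2r := (Lfun mu 2%:E).
Implicit Types (phi u v : E -> R) (x : E).

(** Thanks to this the [W^2] term of the weak equation is a product of two L2 functions, [W u] and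
    [W phi]. *)
Lemma L2_loc_test (W : E -> R) phi : L2_loc W -> test_function phi ->
  (fun x => W x * phi x) \in L2r.
Proof.
move=> WL tphi; have [C C0 hC] := test_bounded tphi.
have /test_functionP[sphi [M bM]] := tphi; have [mW _] := WL.
apply: Lfun2_le (Lfun2Z C (L2_loc_box WL M)).
  by apply: measurable_funM => //; exact: smooth_measurable.
move=> x; rewrite indicE; have [xM|xM] := pselect (box M x).
  rewrite mem_set//= mulr1 !normrM [`|C|]ger0_norm// mulrC ler_wpM2r//.
by rewrite bM// mulr0 normr0.
Qed.

Variables (m : R) (W u : E -> R) (p : 'I_n -> E -> R).
Hypotheses (m_gt0 : 0 < m) (W_loc : L2_loc W) (uL : u \in L2r).
Hypothesis pL : forall i, p i \in L2r.
Hypothesis WuL : (fun x => W x * u x) \in L2r.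
Hypothesis up : forall i, weak_derivative i u (p i).
Hypothesis weak_eq : forall phi, test_function phi ->
  \sum_i ip mu (p i) (partial i phi) +
  ip mu (fun x => W x * u x) (fun x => W x * phi x) + m ^+ 2 * ip mu u phi = 0.

(** For the test function [atan v * chi], [A] carries the terms without derivatives and [B] those
    where the derivative falls on [chi], both up to the factor [atan v]. *)
Let A chi x := W x * u x * (W x * chi x) + m ^+ 2 * (u x * chi x).
Let B chi i x := p i x * partial i chi x.

Let AL1 chi : test_function chi -> mu.-integrable setT (EFin \o A chi).
Proof.
move=> tchi.
have i1 := integrable_mul WuL (L2_loc_test W_loc tchi).
have i2 : mu.-integrable setT (fun x => (m ^+ 2 * (u x * chi x))%:E).
  exact: (integrableZl measurableT (m ^+ 2) (integrable_mul uL (test_Lfun2 tchi))).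
exact: (integrableD measurableT i1 i2).
Qed.

Let BL1 chi i : test_function chi -> mu.-integrable setT (EFin \o B chi i).
Proof.
by move=> tchi; exact: (integrable_mul (pL i) (test_Lfun2 (test_function_partial i
  tchi))).
Qed.

Let FL1 chi : test_function chi ->
  mu.-integrable setT (EFin \o (fun x => A chi x + \sum_i B chi i x)).
Proof.
move=> tchi; have [i1 _] := Rintegral_sum (index_enum 'I_n) (fun i => BL1 i tchi).
exact: (integrableD measurableT (AL1 tchi) i1).
Qed.

Lemma measurable_atan_comp v : measurable_fun setT v ->
  measurable_fun setT (fun x => atan (v x)).
Proof.
move=> mv; apply: (measurableT_comp (f := @atan R)) => //.
by apply: continuous_measurable_fun => t; exact: continuous_atan.
Qed.

Let atan_test chi v : test_function chi -> smooth v ->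
  [/\ test_function (fun x => atan (v x) * chi x) &
    forall i x, partial i (fun x => atan (v x) * chi x) x =
      (1 + v x ^+ 2)^-1 * partial i v x * chi x + atan (v x) * partial i chi x].
Proof.
move=> tchi sv; have sa : smooth (fun x => atan (v x)).
  move: sv => /smoothP sv; apply/smoothP => k.
  by apply: (Ck_comp (r := @atan R)); [exact: Ck_atan|exact: sv].
split; first exact: test_functionM.
move=> i x; have d1 := is_derive_comp_dir (smooth_is_derive i x sv) (is_derive1_atan
  (v x)).
have [schi _] := tchi; have d2 := smooth_is_derive i x schi.
have [_ H] := is_deriveM d1 d2; apply: etrans H _.
by rewrite addrC; congr (_ + _); rewrite /GRing.scale/= mulrC.
Qed.

(* Testing with [atan v * chi], where [v] approximates [u]. *)
Let tested chi v (q : 'I_n -> E -> R) (d : R) : 0 < d -> test_function chi ->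
  (forall x, 0 <= chi x <= 1) -> smooth v ->
  (forall i, partial i v = q i) -> (forall i, q i \in L2r) ->
  \int[mu]_x ((A chi x + \sum_i B chi i x) * atan (v x)) <=
  \sum_i (d / 2 * ip mu (p i) (p i) +
    (2 * d)^-1 * ip mu (fun x => q i x - p i x) (fun x => q i x - p i x)).
Proof.
move=> d0 tchi chi01 sv vq qL; have [tphi dphi] := atan_test tchi sv.
set phi := (fun x => atan (v x) * chi x) in tphi dphi.
have ma := measurable_atan_comp (smooth_measurable sv).
have ba x : `|atan (v x)| <= pi / 2 by exact: normr_atan_pi2.
have i1 := integrable_mul_bounded (AL1 tchi) ma ba.
have i2 i := integrable_mul_bounded (BL1 i tchi) ma ba.
have [i3 e3] := Rintegral_sum (index_enum 'I_n) i2.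
have e1 : \int[mu]_x ((A chi x + \sum_i B chi i x) * atan (v x)) =
    \int[mu]_x (A chi x * atan (v x)) + \sum_i \int[mu]_x (B chi i x * atan (v x)).
  rewrite -e3 -RintegralD//; apply: eq_Rintegral => x _.
  by rewrite mulrDl mulr_suml.
have eA : \int[mu]_x (A chi x * atan (v x)) =
    ip mu (fun x => W x * u x) (fun x => W x * phi x) + m ^+ 2 * ip mu u phi.
  rewrite /ip -RintegralZl//; last exact: integrable_mul uL (test_Lfun2 tphi).
  rewrite -RintegralD//; last 2 first.
  - exact: integrable_mul WuL (L2_loc_test W_loc tphi).
  - exact: (integrableZl measurableT (m ^+ 2) (integrable_mul uL (test_Lfun2 tphi))).
  by apply: eq_Rintegral => x _; rewrite /A /phi; ring.
(* The part where the derivative falls on [atan v]; with [q = p] it would be nonnegative. *)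
pose D i x := p i x * ((1 + v x ^+ 2)^-1 * q i x * chi x).
have DL i : mu.-integrable setT (EFin \o D i).
  have H : mu.-integrable setT (fun x => (p i x * partial i phi x - B chi i x * atan
    (v x))%:E).
    exact: (integrableB measurableT (integrable_mul (pL i) (test_Lfun2
      (test_function_partial i tphi))) (i2 i)).
  apply: eq_integrable H => // x _; congr EFin.
  by rewrite dphi vq /D /B; ring.
have eB i : \int[mu]_x (B chi i x * atan (v x)) =
    ip mu (p i) (partial i phi) - \int[mu]_x D i x.
  rewrite /ip -RintegralB//; last exact: integrable_mul (pL i) (test_Lfun2
    (test_function_partial i tphi)).
  by apply: eq_Rintegral => x _; rewrite dphi vq /D /B; ring.
rewrite e1 eA (eq_bigr _ (fun i _ => eB i)) sumrB.
(* The weak equation turns the left side into minus the sum of the integrals of [D]. *)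
have := weak_eq tphi => we.
have aux (a b c e : R) : c + a + b = 0 -> a + b + (c - e) = - e by lra.
rewrite (aux _ _ _ _ we).
rewrite -sumrN; apply: ler_sum => i _.
have pp := integrable_mul (pL i) (pL i).
have qpL := Lfun2B (qL i) (pL i).
have qq := integrable_mul qpL qpL.
rewrite /ip -RintegralZl// -RintegralZl// -RintegralD//; last 2 first.
- exact: (integrableZl measurableT (d / 2) pp).
- exact: (integrableZl measurableT (2 * d)^-1 qq).
rewrite -mulN1r -RintegralZl//; apply: le_Rintegral => //.
- exact: (integrableZl measurableT (-1) (DL i)).
- exact: (integrableD measurableT (integrableZl measurableT (d / 2) pp) (integrableZl
  measurableT (2 * d)^-1 qq)).
move=> x _; rewrite /D; have /andP[c0 c1] := chi01 x.
have g0 : 0 <= (1 + v x ^+ 2)^-1 by rewrite invr_ge0 addr_ge0// sqr_ge0.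
have g1 : (1 + v x ^+ 2)^-1 <= 1 by rewrite invf_le1 ?lerDl ?sqr_ge0// ltr_pwDl//
  sqr_ge0.
set a := (1 + v x ^+ 2)^-1 * chi x.
have a0 : 0 <= a by rewrite mulr_ge0.
have a1 : a <= 1 by rewrite mulr_ile1.
set s := p i x; set t := q i x.
have -> : -1 * (s * ((1 + v x ^+ 2)^-1 * t * chi x)) = - (a * (s * t)) by rewrite /a;
  ring.
have h : 0 <= (d * s + a * (t - s)) ^+ 2 by exact: sqr_ge0.
rewrite -subr_ge0.
(* A completed square in [s] and [t - s]; every term on the right is nonnegative because
   [0 <= a <= 1] and [0 < d]. *)
have -> : d / 2 * (s * s) + (2 * d)^-1 * ((t - s) * (t - s)) - - (a * (s * t)) =
  (2 * d)^-1 * ((d * s + a * (t - s)) ^+ 2 + (1 - a ^+ 2) * (t - s) ^+ 2) + a * s ^+ 2.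
  by field; rewrite gt_eqF.
apply: addr_ge0; last by apply: mulr_ge0 => //; exact: sqr_ge0.
apply: mulr_ge0; first by rewrite invr_ge0 ltW// mulr_gt0.
apply: addr_ge0 => //; apply: mulr_ge0; last exact: sqr_ge0.
by rewrite subr_ge0 expr_le1.
Qed.

Let conv_index (e : R) : 0 < e -> exists N, forall i k, (N <= k)%N ->
  ip mu (fun x => convol (mollifier k) (p i) x - p i x)
        (fun x => convol (mollifier k) (p i) x - p i x) <= e.
Proof.
move=> e0; have /choice[N hN] i := convol_cvg (pL i) e0.
exists (\sum_i N i)%N => i k Nk; rewrite -lee_fin -ip_sqrE.
  by apply: hN; apply: leq_trans Nk; rewrite (bigD1 i)//= leq_addr.
exact: Lfun2B (convol_Lfun2 k (pL i)) (pL i).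
Qed.

(** [tested] applies to the mollifications of [u], whose derivatives are the mollified [p i]. Its
    right side is made small first, by [d] and then by the index; the left side passes to the limit
    under the majorant [pi / 2] times a fixed integrable function. *)
Let tested_limit chi : test_function chi -> (forall x, 0 <= chi x <= 1) ->
  \int[mu]_x ((A chi x + \sum_i B chi i x) * atan (u x)) <= 0.
Proof.
move=> tchi chi01; rewrite leNgt; apply/negP; set I0 := (X in 0 < X) => I0p.
pose e := I0 / 2; have e0 : 0 < e by rewrite divr_gt0.
pose P := \sum_i ip mu (p i) (p i).
have P0 : 0 <= P by apply: sumr_ge0 => i _; exact: ip_ge0.
(* [d] makes the first sum at most [e / 2], then [h] makes the second at most [e / 2] over all [n]
   directions; the added 1 avoids division by zero. *)
pose d := e / (P + 1); have d0 : 0 < d by rewrite divr_gt0// ltr_wpDl.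
pose h := d * e / n.+1%:R; have h0 : 0 < h by rewrite divr_gt0// mulr_gt0.
have [N hN] := conv_index h0.
(* Starting at [N] gives the bound for every [j], hence along any choice of indices. *)
pose w j := convol (mollifier (N + j)) u.
have sw j : smooth (w j).
  exact: convol_smooth (mollifier_test _ _ _) (L1loc_Lfun2 uL).
have we j : \int[mu]_x ((A chi x + \sum_i B chi i x) * atan (w j x)) <= e.
  apply: le_trans (tested d0 tchi chi01 (sw j) (q := fun i =>
    convol (mollifier (N + j)) (p i)) _ _) _.
  - move=> i; exact: partial_convol (mollifier_test _ _ _) (L1loc_Lfun2 uL) (up i).
  - by move=> i; exact: convol_Lfun2.
  rewrite big_split/= -mulr_sumr -mulr_sumr -/P.
  apply: le_trans (_ : d / 2 * P + (2 * d)^-1 * \sum_(i < n) h <= _).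
    have d20 : 0 <= (2 * d)^-1 by rewrite invr_ge0 ltW// mulr_gt0.
    rewrite lerD2l ler_wpM2l//.
    by apply: ler_sum => i _; apply: hN; rewrite leq_addr.
  rewrite sumr_const card_ord -[h *+ n]mulr_natr.
  have -> : (2 * d)^-1 * (h * n%:R) = e / 2 * (n%:R / n.+1%:R).
    have nz : n.+1%:R != 0 :> R by rewrite pnatr_eq0.
    rewrite /h; move: (n.+1%:R : R) nz => z nz; clearbody d.
    by field; rewrite nz gt_eqF.
  have : n%:R / n.+1%:R <= 1 :> R by rewrite ler_pdivrMr// mul1r ler_nat.
  have : d / 2 * P <= e / 2.
    rewrite mulrAC ler_wpM2r// /d mulrAC ler_pdivrMr ?ltr_wpDl//.
    by rewrite ler_wpM2l ?(ltW e0)// lerDl.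
  by move: (n%:R / n.+1%:R) => z; nra.
have wu : cvg2 mu w u.
  move=> r r0; have [K hK] := convol_cvg uL r0; exists K => j Kj; apply: hK.
  by rewrite (leq_trans Kj)// leq_addl.
have wL j : w j \in L2r by exact: convol_Lfun2.
have [k hk] := cvg2_ae_subseq wL uL wu.
have ma j : measurable_fun setT (fun x => atan (w j x)) by exact:
  measurable_atan_comp (smooth_measurable (sw j)).
have mu0 := measurable_atan_comp (Lfun2_measurable uL).
have [mF _] := integrableP _ _ _ (FL1 tchi).
have ba v x : `|atan (v x)| <= pi / 2 by exact: normr_atan_pi2.
have gi := integrable_norm (integrableZl measurableT (pi / 2) (FL1 tchi)).
pose F x := A chi x + \sum_i B chi i x.
have mF' : measurable_fun setT F by exact/measurable_EFinP.
have h1 j : measurable_fun setT (fun x => (F x * atan (w (k j) x))%:E).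
  by apply/measurable_EFinP; exact: measurable_funM.
have h2 : measurable_fun setT (fun x => (F x * atan (u x))%:E).
  by apply/measurable_EFinP; exact: measurable_funM.
have h3 : {ae mu, forall x, setT x -> (fun j =>
  (F x * atan (w (k j) x))%:E) @ \oo --> (F x * atan (u x))%:E}.
  apply: filterS hk => x hx _; apply: cvg_EFin; first exact: nearW.
  have H : (fun j => F x * atan (w (k j) x)) @ \oo --> F x * atan (u x).
    apply: cvgM; first exact: cvg_cst.
    by apply: continuous_cvg; [exact: continuous_atan|exact: hx].
  exact: H.
have h4 : {ae mu, forall x, forall j, setT x ->
  (`|(F x * atan (w (k j) x))%:E| <= `|(pi / 2)%:E * (F x)%:E|)%E}.
  apply: nearW => x j _; rewrite -EFinM !abse_EFin lee_fin (normrM (F x)) (normrM (pi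
    / 2)) mulrC ler_wpM2r//.
  by rewrite [`|pi / 2|]ger0_norm ?divr_ge0 ?pi_ge0.
have [_ _] := dominated_convergence measurableT h1 h2 h3 gi h4.
move=> H; suff : I0 <= e by rewrite /e; lra.
have fi v : measurable_fun setT v -> mu.-integrable setT (fun x =>
  (F x * atan (v x))%:E).
  by move=> mv; exact: integrable_mul_bounded (FL1 tchi) (measurable_atan_comp mv)
    (ba v).
have eI : (\int[mu]_x (F x * atan (u x))%:E = I0%:E)%E.
  by rewrite /I0 /Rintegral fineK//; apply: integrable_fin_num => //; apply: fi;
    exact: Lfun2_measurable uL.
rewrite eI in H; rewrite -lee_fin; apply: (cvge_le _ H) => //; apply: nearW => j /=.
have := we (k j); rewrite -lee_fin /Rintegral fineK//.
by apply: integrable_fin_num => //; apply: fi; exact: smooth_measurable.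
Qed.

Lemma weak_uniqueness : {ae mu, forall x, u x = 0}.
Proof.
have [C [chi [C0 hchi]]] := cutoff_family R n.
have aL : (fun x => atan (u x)) \in L2r.
  apply: Lfun2_le uL; first exact: measurable_atan_comp (Lfun2_measurable uL).
  by move=> x; exact: normr_atan_le.
have absL i : (fun x => `|p i x|) \in L2r.
  apply: (Lfun2_le _ _ (pL i)) => [|x]; last by rewrite normr_id.
  by apply: measurableT_comp => //; exact: Lfun2_measurable (pL i).
have absuL : (fun x => `|u x|) \in L2r.
  apply: (Lfun2_le _ _ uL) => [|x]; last by rewrite normr_id.
  by apply: measurableT_comp => //; exact: Lfun2_measurable uL.
pose G x := \sum_i `|p i x| * `|u x|.
have [GL _] := Rintegral_sum (index_enum 'I_n) (fun i => integrable_mul (absL i) absuL).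
have uaL := integrable_mul uL aL.
(* The claim is localised to a box, where the cutoffs equal 1 as soon as [r >= N]. *)
have hN (N : nat) : {ae mu, forall x, \1_(box N%:R) x * (u x * atan (u x)) = 0}.
  have mi : measurable_fun setT (\1_(box N%:R) : E -> R) by apply: measurable_indic;
    exact: measurable_box.
  have bi x : `|\1_(box N%:R) x : R| <= 1 by rewrite indicE; case: (_ \in _);
    rewrite ?normr1 ?normr0.
  have i0 : mu.-integrable setT (fun x => (\1_(box N%:R) x * (u x * atan (u x)))%:E).
    have := integrable_mul_bounded uaL mi bi.
    by under eq_fun do rewrite mulrC.
  have f0 x : 0 <= (\1_(box N%:R) x : R) * (u x * atan (u x)).
    by rewrite mulr_ge0 ?mulr_atan_ge0// indicE.
  apply: Rintegral_eq0_ae => //; apply/eqP; rewrite eq_le Rintegral_ge0// andbT.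
  set J := \int[mu]_x _; pose I1 := \int[mu]_x G x.
  (* From [tested_limit]: the [W^2] term is nonnegative and dropped, and the gradient of the cutoff
     costs [C / r]. *)
  have main r : 0 < r -> N%:R <= r -> m ^+ 2 * J <= C / r * I1.
    move=> r0 Nr; have [tchi chi01 chi1 dchi] := hchi r r0.
    have lim := tested_limit tchi chi01.
    have iF := integrable_mul_bounded (FL1 tchi) (measurable_atan_comp
      (Lfun2_measurable uL)) (fun x => normr_atan_pi2 (u x)).
    have iJ : mu.-integrable setT (fun x => (m ^+ 2 * (\1_(box N%:R) x * (u x * atan
      (u x))))%:E).
      exact: (integrableZl measurableT (m ^+ 2) i0).
    have iG : mu.-integrable setT (fun x => (C / r * G x)%:E).
      exact: (integrableZl measurableT (C / r) GL).
    have iJG : mu.-integrable setT (fun x =>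
      (m ^+ 2 * (\1_(box N%:R) x * (u x * atan (u x))) - C / r * G x)%:E).
      exact: (integrableB measurableT iJ iG).
    rewrite -subr_le0 /J /I1 -RintegralZl// -RintegralZl// -RintegralB//.
    apply: le_trans lim; apply: le_Rintegral => // x _.
    rewrite mulrDl lerD//.
      rewrite /A mulrDl; have /andP[c0 c1] := chi01 x; have ua := mulr_atan_ge0 (u x).
      apply: le_trans (_ : m ^+ 2 * (u x * chi r x) * atan (u x) <= _).
        have -> : m ^+ 2 * (u x * chi r x) * atan (u x) = m ^+ 2 * (chi r x * (u x *
          atan (u x))) by ring.
        rewrite ler_wpM2l ?sqr_ge0// ler_wpM2r// indicE.
        have [xN|xN] := pselect (box N%:R x); last by rewrite memNset.
        by rewrite mem_set// chi1//; exact: subset_box xN.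
      rewrite lerDr (_ : _ * _ = W x ^+ 2 * (chi r x * (u x * atan (u x)))); last ring.
      by apply: mulr_ge0; [exact: sqr_ge0|exact: mulr_ge0].
    rewrite mulr_suml /G mulr_sumr -sumrN; apply: ler_sum => i _.
    rewrite lerNl; apply: le_trans (ler_norm _) _; rewrite normrN !normrM.
    have := dchi i x; have := normr_atan_le (u x) => h1 h2.
    apply: le_trans (_ : `|p i x| * (C / r) * `|u x| <= _);
      last by rewrite [_ * (C / r)]mulrC mulrA.
    by apply: ler_pM => //; rewrite ?mulr_ge0// ler_wpM2l.
  have I10 : 0 <= I1 by apply: Rintegral_ge0 => x _; apply: sumr_ge0 => i _;
    exact: mulr_ge0.
  rewrite leNgt; apply/negP => J0.
  have mJ : 0 < m ^+ 2 * J by rewrite mulr_gt0// exprn_gt0.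
  (* For this [r] the product [m ^+ 2 * J * r] exceeds [C * I1], contrary to [main]; the summand
     [N + 1] ensures [N <= r] and positivity. *)
  pose r := N%:R + 1 + 2 * C * I1 / (m ^+ 2 * J).
  have r0 : 0 < r by rewrite ltr_pwDl ?ltr_wpDl// !mulr_ge0 ?invr_ge0 ?(ltW mJ).
  have Nr : N%:R <= r by rewrite /r -addrA lerDl addr_ge0// !mulr_ge0 ?invr_ge0 ?(ltW
    mJ).
  have := main r r0 Nr; rewrite [C / r * I1]mulrAC ler_pdivlMr// => H.
  have : m ^+ 2 * J * r = m ^+ 2 * J * (N%:R + 1) + 2 * (C * I1).
    by rewrite /r mulrDr [m ^+ 2 * J * (_ / _)]mulrC divfK ?gt_eqF// mulrA.
  have : 0 < m ^+ 2 * J * (N%:R + 1) by rewrite mulr_gt0// ltr_wpDl.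
  have : 0 <= C * I1 by rewrite mulr_ge0.
  by lra.
have := ae_foralln hN; apply: filterS => x /(_ (Num.trunc `|x|).+1).
rewrite indicE mem_set ?mul1r; first exact: mulr_atan_eq0.
by move=> i; apply: ltW; apply: le_lt_trans (truncnS_gt _); exact: rV_entry_le.
Qed.

End weak_uniqueness.

(** * The energy space *)

Lemma cvg_sumr (R : realType) (I : Type) (s : seq I) (F : I -> nat -> R) (l : I -> R) :
  (forall i, F i @ \oo --> l i) ->
  (fun k => \sum_(i <- s) F i k) @ \oo --> \sum_(i <- s) l i.
Proof.
move=> Fl; elim: s => [|i s IH].
  by under eq_fun do rewrite big_nil; rewrite big_nil; exact: cvg_cst.
under eq_fun do rewrite big_cons; rewrite big_cons.
by apply: cvgD; [exact: Fl|exact: IH].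
Qed.

(** * Graph norms of finitely many jointly closed operators *)

Section graph_space.
Variables (R : realType) (E : lmodType R[i]) (iH : E -> E -> R[i]).
Local Notation H := (InnerSpace [set: E] iH).
Hypotheses (HH : preHilbert H) (cplH : hcomplete H).
Variables (J : finType) (T : J -> E -> E) (cV : set E) (iV : E -> E -> R[i]).
Variable (c : R).
Hypotheses (c_gt0 : 0 < c) (cVS : linsub cV).
Hypothesis T_lin : forall j a x y, cV x -> cV y ->
  T j (a *: x + y) = a *: T j x + T j y.
Hypothesis T_closed : forall (u : nat -> E) x (g : J -> E),
  (forall k, cV (u k)) -> hcvg H u x ->
  (forall j, hcvg H (fun k => T j (u k)) (g j)) ->
  cV x /\ forall j, T j x = g j.
Hypothesis iVE : forall x y, cV x -> cV y ->
  iV x y = c%:C * iH x y + \sum_j iH (T j x) (T j y).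
Local Notation V := (InnerSpace cV iV).
Implicit Types (x y : E).

Let cH x : carrier H x. Proof. by []. Qed.

Lemma graph_rin x y : cV x -> cV y ->
  rin V x y = c * rin H x y + \sum_j rin H (T j x) (T j y).
Proof.
move=> cx cy; rewrite /rin /= iVE//.
have ReD (a b : R[i]) : Re (a + b) = Re a + Re b by case: a b => [? ?] [].
rewrite ReD; congr (_ + _); first by case: (iH x y) => a b /=; rewrite mul0r subr0.
by apply: (big_morph (@complex.Re R) ReD).
Qed.

Lemma graph_TB j x y : cV x -> cV y -> T j (x - y) = T j x - T j y.
Proof.
move=> cx cy; rewrite addrC -[- y]scaleN1r T_lin//.
by rewrite scaleN1r addrC.
Qed.

Lemma graph_preHilbert : preHilbert V.
Proof.
have ge0 x : 0 <= rin H x x by exact: (inner_ge0 HH).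
split=> //.
- move=> a x y z /= cx cy cz; rewrite !iVE//; last exact: cVS.2.
  rewrite -[iH (a *: x + y) z]/(inner H _ _) (inner_lin HH)// mulrDr !mulrDr.
  rewrite addrACA mulr_sumr -big_split/= mulrCA; congr (_ + _); apply: eq_bigr => j _.
  by rewrite T_lin// -[LHS]/(inner H _ _) (inner_lin HH).
- move=> x y /= cx cy; rewrite !iVE// rmorphD rmorphM rmorph_sum /=.
  congr (_ + _).
    by rewrite -[iH y x]/(inner H _ _) (inner_conj HH (cH x) (cH y)) oppr0.
  by apply: eq_bigr => j _; exact: (inner_conj HH (cH _) (cH _)).
- move=> x cx; rewrite -/(rin V x x) graph_rin// addr_ge0 ?mulr_ge0 ?(ltW c_gt0)//.
  by apply: sumr_ge0.
- move=> x cx; rewrite -/(rin V x x) graph_rin// => /eqP.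
  rewrite paddr_eq0 ?mulr_ge0 ?(ltW c_gt0)//; last by apply: sumr_ge0.
  rewrite mulf_eq0 gt_eqF//= => /andP[/eqP x0 _].
  exact: (inner_def HH).
Qed.

Let HV := graph_preHilbert.

Lemma graph_hnorm_ge x : cV x -> c * hnorm H x ^+ 2 <= hnorm V x ^+ 2.
Proof.
move=> cx; rewrite (hnorm_sqr HV)// (hnorm_sqr HH)// graph_rin// lerDl.
by apply: sumr_ge0 => j _; exact: (inner_ge0 HH).
Qed.

Lemma graph_hnorm_T j x : cV x -> hnorm H (T j x) <= hnorm V x.
Proof.
move=> cx; rewrite -(@ler_pXn2r _ 2)// ?nnegrE ?hnorm_ge0//.
rewrite (hnorm_sqr HV)// (hnorm_sqr HH)// graph_rin// (bigD1 j)//= addrCA lerDl.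
rewrite addr_ge0 ?mulr_ge0 ?(ltW c_gt0)//; first exact: (inner_ge0 HH).
by apply: sumr_ge0 => k _; exact: (inner_ge0 HH).
Qed.

(** A Cauchy sequence of the graph norm is Cauchy in [H] together with its images under each [T j];
    joint closedness identifies the limits. *)
Lemma graph_complete : hcomplete V.
Proof.
move=> u Vu ucau; have VB i j : cV (u i - u j) by exact: (linsubB cVS (Vu i) (Vu j)).
have [|x _ ux] := cplH (u := u) (fun=> I).
  move=> e e0; have [|N hN] := ucau (Num.sqrt c * e).
    by rewrite mulr_gt0// sqrtr_gt0.
  exists N => i j Ni Nj; have := hN i j Ni Nj.
  have := graph_hnorm_ge (VB i j); rewrite -{1}(sqr_sqrtr (ltW c_gt0)) -exprMn.
  rewrite ler_pXn2r// ?nnegrE ?mulr_ge0 ?sqrtr_ge0 ?hnorm_ge0// => h1 h2.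
  by have := le_lt_trans h1 h2; rewrite ltr_pM2l// sqrtr_gt0.
have /choice[g hg] j : exists g, hcvg H (fun k => T j (u k)) g.
  have [|y _ uy] := cplH (u := fun k => T j (u k)) (fun=> I); last by exists y.
  move=> e /ucau[N hN]; exists N => a b Na Nb.
  rewrite -(graph_TB j (Vu a) (Vu b)).
  exact: le_lt_trans (graph_hnorm_T j (VB a b)) (hN a b Na Nb).
have [Vx Tx] := T_closed Vu ux hg; exists x => //.
have VBx k : cV (u k - x) by exact: (linsubB cVS (Vu k) Vx).
have sq0 (z : nat -> E) (y : E) : hcvg H z y ->
    (fun k => rin H (z k - y) (z k - y)) @ \oo --> (0 : R).
  move=> zy; rewrite (_ : (fun k => _) = (fun k =>
    hnorm H (z k - y) * hnorm H (z k - y))).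
    by rewrite -(mul0r (0 : R)); exact: cvgM.
  by apply/funext => k; rewrite -expr2 (hnorm_sqr HH).
have rV : (fun k => rin V (u k - x) (u k - x)) @ \oo --> (0 : R).
  rewrite (_ : (fun k => _) = (fun k => c * rin H (u k - x) (u k - x) +
      \sum_j rin H (T j (u k) - g j) (T j (u k) - g j))); last first.
    apply/funext => k; rewrite graph_rin//; congr (_ + _); apply: eq_bigr => j _.
    by rewrite (graph_TB j (Vu k) Vx) Tx.
  suff : (fun k => c * rin H (u k - x) (u k - x) +
      \sum_j rin H (T j (u k) - g j) (T j (u k) - g j)) @ \oo --> (c * 0 + \sum_(j :
        J) 0 : R).
    by rewrite mulr0 big1// addr0.
  apply: cvgD; first by apply: cvgM; [exact: cvg_cst|exact: sq0].
  by apply: (cvg_sumr (F := fun j k => rin H (T j (u k) - g j) (T j (u k) - g j))) =>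
    j; exact: sq0.
rewrite /hcvg -[X in _ --> X](@sqrtr0 R).
by apply: continuous_cvg; [exact: sqrt_continuous|exact: rV].
Qed.

(** Pairing with [f] is bounded on [V], since the norm of [H] is at most that of [V] divided by the
    square root of [c]. *)
Lemma graph_riesz f : exists2 u, cV u & forall v, cV v -> rin V u v = rin H f v.
Proof.
have k0 : 0 < Num.sqrt c by rewrite sqrtr_gt0.
have [|||u Vu uE] := riesz HV (F := rin H f) (C := hnorm H f / Num.sqrt c)
  graph_complete.
- by move=> x y _ _; exact: (rinDr HH).
- by move=> t x _; exact: (rinZr HH).
- move=> x Vx; apply: le_trans (cauchy_schwarz HH (cH f) (cH x)) _.
  rewrite -mulrA ler_wpM2l ?hnorm_ge0// ler_pdivlMl//.
  rewrite -(@ler_pXn2r _ 2)// ?nnegrE ?mulr_ge0 ?hnorm_ge0 ?(ltW k0)//.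
  by rewrite exprMn sqr_sqrtr ?(ltW c_gt0)//; exact: graph_hnorm_ge.
by exists u.
Qed.

End graph_space.

(** * Distributions in L2 *)

Section L2_distributions.
Variables (R : realType) (n : nat).
Local Notation E := 'rV[R]_n.
Local Notation mu := (lebesgue_rV R n).
Local Notation L2r := (Lfun mu 2%:E).
Local Notation H := (L2_innerSpace mu).
Implicit Types (phi psi : E -> R) (f g h : L2 mu) (u v : E -> R[i]).
Implicit Types T : @Distribution R n.

Lemma regular_distE u phi : regular_dist u phi =
  ip mu (fun x => Re (u x)) phi +i* ip mu (fun x => Im (u x)) phi.
Proof.
congr (_ +i* _); apply: eq_Rintegral => x _; case: (u x) => a b /=.
  by rewrite mulr0 subr0.
by rewrite mulr0 add0r.
Qed.

Lemma L2_distE f phi : regular_dist f phi = ip mu (L2re f) phi +i* ip mu (L2im f) phi.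
Proof. exact: regular_distE. Qed.

(** By the fundamental lemma; this is what makes [dist_L2] depend on the distribution and not on a
    choice. *)
Lemma L2_dist_inj f g :
  (forall phi, test_function phi -> regular_dist f phi = regular_dist g phi) -> f = g.
Proof.
move=> fg; have aux (a b : E -> R) : a \in L2r -> b \in L2r ->
    (forall phi, test_function phi -> ip mu a phi = ip mu b phi) ->
    {ae mu, forall x, a x = b x}.
  move=> aL bL ab; have : {ae mu, forall x, a x - b x = 0}.
    apply: ip_test_eq0 => [|phi tphi]; first exact: Lfun2B.
    have pL := test_Lfun2 tphi; have mL := Lfun2Z (-1) bL.
    have -> : ip mu (fun x => a x - b x) phi = ip mu (fun x => a x + -1 * b x) phi.
      by apply: eq_Rintegral => x _; rewrite mulN1r.
    by rewrite ipDl// ipZl// ab// mulN1r subrr.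
  by apply: filterS => x /eqP; rewrite subr_eq0 => /eqP.
have hr : {ae mu, forall x, L2re f x = L2re g x}.
  apply: aux; [exact: L2reP..|] => phi tphi.
  by have := fg phi tphi; rewrite !L2_distE => -[].
have hi : {ae mu, forall x, L2im f x = L2im g x}.
  apply: aux; [exact: L2imP..|] => phi tphi.
  by have := fg phi tphi; rewrite !L2_distE => -[].
apply/L2_eqP; near=> x; have := near hr x; have := near hi x; rewrite /L2re /L2im.
by case: (f x) (g x) => [a b] [a' b'] /= -> // -> //.
Unshelve. all: by end_near.
Qed.

Lemma dist_L2E T h : represents T h -> dist_L2 T = h.
Proof.
move=> Th; rewrite /dist_L2; case: xgetP => [g _ Tg|/(_ h)//].
by apply: L2_dist_inj => phi tphi; rewrite -Tg// -Th.
Qed.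

Lemma dist_L2P T : in_L2 T -> represents T (dist_L2 T).
Proof. by move=> [h Th]; rewrite (dist_L2E Th). Qed.

Lemma L2_dist_lin a f g phi : phi \in L2r ->
  regular_dist (a *: f + g : L2 mu) phi = a * regular_dist f phi + regular_dist g phi.
Proof.
move=> pL; rewrite !L2_distE ip_L2reDZ// ip_L2imDZ//; case: a => a b.
by apply/eqP; rewrite eq_complex /=; apply/andP; split; apply/eqP; ring.
Qed.

Lemma L2_dist0 phi : phi \in L2r -> regular_dist (0 : L2 mu) phi = 0.
Proof.
move=> pL; have := L2_dist_lin 1 0 0 pL; rewrite scaler0 addr0 mul1r => /eqP.
by rewrite -subr_eq0 opprD addNKr oppr_eq0 => /eqP.
Qed.

Lemma L2_distZ a f phi : phi \in L2r ->
  regular_dist (a *: f : L2 mu) phi = a * regular_dist f phi.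
Proof. by move=> pL; rewrite -[a *: f]addr0 L2_dist_lin// L2_dist0// addr0. Qed.

Lemma represents_ae u f : measurable_fun setT (fun x => Re (u x)) ->
  measurable_fun setT (fun x => Im (u x)) -> {ae mu, forall x, f x = u x} ->
  represents (regular_dist u) f.
Proof.
move=> mr mi fu phi [/smooth_measurable mp _]; rewrite L2_distE regular_distE.
by congr (_ +i* _); apply: Rintegral_ae;
  [apply: measurable_funM => //; exact: mr|
   apply: measurable_funM => //; exact: Lfun2_measurable (L2reP f)|
   apply: filterS fu => x; rewrite /L2re => ->|
   apply: measurable_funM => //; exact: mi|
   apply: measurable_funM => //; exact: Lfun2_measurable (L2imP f)|
   apply: filterS fu => x; rewrite /L2im => ->].
Qed.

Definition cL1loc u := L1loc (fun x => Re (u x)) /\ L1loc (fun x => Im (u x)).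

Lemma ip_L1loc (a b : R) (s t w : E -> R) phi : L1loc s -> L1loc t -> L1loc w ->
  test_function phi -> ip mu (fun x => a * s x + b * t x + w x) phi =
  a * ip mu s phi + b * ip mu t phi + ip mu w phi.
Proof.
move=> sl tl wl tphi; have si := L1loc_test sl tphi.
have ti := L1loc_test tl tphi; have wi := L1loc_test wl tphi.
have Zs := integrableZl measurableT a si; have Zt := integrableZl measurableT b ti.
rewrite /ip -[in RHS]RintegralZl// -[in RHS]RintegralZl// -RintegralD//.
have Dst := integrableD measurableT Zs Zt.
rewrite -RintegralD//; apply: eq_Rintegral => x _; ring.
Qed.

Lemma regular_distDZ a u v phi : cL1loc u -> cL1loc v -> test_function phi ->
  regular_dist (fun x => a * u x + v x) phi = a * regular_dist u phi + regular_dist v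
    phi.
Proof.
move=> [ur ui] [vr vi] tphi; rewrite !regular_distE.
have -> : (fun x => Re (a * u x + v x)) =
    (fun x => Re a * Re (u x) + (- Im a) * Im (u x) + Re (v x)).
  by apply/funext => x; case: a (u x) (v x) => [? ?] [? ?] [? ?] /=; rewrite mulNr.
have -> : (fun x => Im (a * u x + v x)) =
    (fun x => Re a * Im (u x) + Im a * Re (u x) + Im (v x)).
  by apply/funext => x; case: a (u x) (v x) => [? ?] [? ?] [? ?].
rewrite !ip_L1loc//; case: a => a b.
by apply/eqP; rewrite eq_complex /=; apply/andP; split; apply/eqP; ring.
Qed.

(** Test functions are real, so the complex identity splits into real and imaginary parts. *)
Lemma dpartialP i f g : represents (dpartial i (regular_dist f)) g <->
  weak_derivative i (L2re f) (L2re g) /\ weak_derivative i (L2im f) (L2im g).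
Proof.
have E0 phi : dpartial i (regular_dist f) phi =
    - ip mu (L2re f) (partial i phi) +i* - ip mu (L2im f) (partial i phi).
  by rewrite /dpartial L2_distE.
split=> [fg|[h1 h2] phi tphi]; last first.
  have := h1 _ tphi; have := h2 _ tphi; rewrite -!/(ip _ _ _) => e2 e1.
  by rewrite E0 L2_distE e1 e2 !opprK.
by split=> phi tphi; have := fg _ tphi; rewrite E0 L2_distE => -[e1 e2];
  rewrite -!/(ip _ _ _) -?e1 -?e2 opprK.
Qed.

Lemma weak_partialE i f g : represents (dpartial i (regular_dist f)) g ->
  weak_partial i f = g.
Proof. exact: dist_L2E. Qed.

Lemma weak_partialP i f : @H1 R n f ->
  represents (dpartial i (regular_dist f)) (weak_partial i f).
Proof. by move=> /(_ i)/dist_L2P. Qed.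

Lemma represents_dpartialDZ i a f g h k : represents (dpartial i (regular_dist f)) h ->
  represents (dpartial i (regular_dist g)) k ->
  represents (dpartial i (regular_dist (a *: f + g : L2 mu))) (a *: h + k).
Proof.
move=> fh gk phi tphi.
have pL := test_Lfun2 tphi; have dL := test_Lfun2 (test_function_partial i tphi).
by rewrite L2_dist_lin// -fh// -gk// /dpartial L2_dist_lin// mulrN opprD.
Qed.

Lemma H1_linsub : linsub (@H1 R n).
Proof.
split=> [i|a f g Hf Hg i]; last first.
  by exists (a *: weak_partial i f + weak_partial i g); apply: represents_dpartialDZ;
    exact: weak_partialP.
exists 0 => phi tphi; rewrite L2_dist0 ?test_Lfun2//.
by rewrite /dpartial L2_dist0 ?oppr0//; exact/test_Lfun2/test_function_partial.
Qed.

Lemma weak_partial_lin i a f g : @H1 R n f -> @H1 R n g ->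
  weak_partial i (a *: f + g) = a *: weak_partial i f + weak_partial i g.
Proof.
by move=> Hf Hg; apply: weak_partialE; apply: represents_dpartialDZ;
  exact: weak_partialP.
Qed.

(** Norm convergence implies weak convergence; pairing a component with [s] is the real inner
    product with [s] or with ['i s]. *)
Lemma hcvg_L2_ip (u : nat -> L2 mu) f s : hcvg H u f -> s \in L2r ->
  (fun k => ip mu (L2re (u k)) s) @ \oo --> ip mu (L2re f) s /\
  (fun k => ip mu (L2im (u k)) s) @ \oo --> ip mu (L2im f) s.
Proof.
move=> uf sL; have zL := Lfun2_0 mu.
have ip0 (w : E -> R) : ip mu w (fun=> 0) = 0.
  by rewrite /ip /Rintegral integral0_eq// => x _; rewrite mulr0.
have [g1 g1E] := L2_exists_pair sL zL; have [g2 g2E] := L2_exists_pair zL sL.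
have HH := @L2_preHilbert _ _ _ mu; split.
  have := rin_cvg HH (z := g1) (fun=> I) I I uf.
  rewrite (rin_L2_pair _ sL zL g1E) ip0 addr0.
  by under eq_fun do rewrite (rin_L2_pair _ sL zL g1E) ip0 addr0.
have := rin_cvg HH (z := g2) (fun=> I) I I uf.
rewrite (rin_L2_pair _ zL sL g2E) ip0 add0r.
by under eq_fun do rewrite (rin_L2_pair _ zL sL g2E) ip0 add0r.
Qed.

(** The defining identity pairs [u k] and its derivative with fixed L2 functions, so it survives the
    limit. *)
Lemma weak_partial_closed i (u : nat -> L2 mu) f g : (forall k, @H1 R n (u k)) ->
  hcvg H u f -> hcvg H (fun k => weak_partial i (u k)) g ->
  represents (dpartial i (regular_dist f)) g.
Proof.
move=> Hu uf ug; apply/dpartialP.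
have wd k := iffLR (dpartialP i _ _) (weak_partialP i (Hu k)).
split=> phi tphi; have [pL dL] := (test_Lfun2 tphi,
  test_Lfun2 (test_function_partial i tphi)).
  have [c1 _] := hcvg_L2_ip uf dL; have [c2 _] := hcvg_L2_ip ug pL.
  apply: (cvg_unique _ c1) => //.
  have e k : ip mu (L2re (u k)) (partial i phi) = - ip mu (L2re (weak_partial i (u
    k))) phi.
    by have [+ _] := wd k; apply.
  suff : (fun k => ip mu (L2re (u k)) (partial i phi)) @ \oo --> - ip mu (L2re g) phi
    by [].
  by under eq_fun do rewrite e; exact: cvgN.
have [_ c1] := hcvg_L2_ip uf dL; have [_ c2] := hcvg_L2_ip ug pL.
apply: (cvg_unique _ c1) => //.
have e k : ip mu (L2im (u k)) (partial i phi) = - ip mu (L2im (weak_partial i (u k)))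
  phi.
  by have [_] := wd k; apply.
suff : (fun k => ip mu (L2im (u k)) (partial i phi)) @ \oo --> - ip mu (L2im g) phi
  by [].
by under eq_fun do rewrite e; exact: cvgN.
Qed.

Lemma test_dpartial i f g phi psi : test_function phi -> test_function psi ->
  {ae mu, forall x, f x = phi x +i* psi x} ->
  {ae mu, forall x, g x = partial i phi x +i* partial i psi x} ->
  represents (dpartial i (regular_dist f)) g.
Proof.
move=> tphi tpsi /L2_pairE[fr fi] /L2_pairE[gr gi]; apply/dpartialP.
have aux (a b w : E -> R) : test_function w -> a \in L2r -> b \in L2r ->
    {ae mu, forall x, a x = w x} -> {ae mu, forall x, b x = partial i w x} ->
    weak_derivative i a b.
  move=> tw aL bL aw bw chi tchi.
  have cL := test_Lfun2 tchi; have dcL := test_Lfun2 (test_function_partial i tchi).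
  have wL := test_Lfun2 tw; have dwL := test_Lfun2 (test_function_partial i tw).
  rewrite -!/(ip _ _ _) (ip_ae aL wL dcL dcL aw) 1?(ip_ae bL dwL cL cL bw);
    try exact: nearW.
  rewrite ipC [in RHS]ipC; apply: integration_by_parts_rV => //; by case: tw.
split; [exact: (aux _ _ phi) (L2reP f) (L2reP g) fr gr|exact: (aux _ _ psi) (L2imP f)
  (L2imP g) fi gi].
Qed.

End L2_distributions.

(** * The energy space as a graph space *)

Section energy_space.
Variables (R : realType) (n : nat) (W : 'rV[R]_n -> R).
Local Notation E := 'rV[R]_n.
Local Notation mu := (lebesgue_rV R n).
Local Notation L2r := (Lfun mu 2%:E).
Local Notation H := (L2_innerSpace mu).
Hypothesis W_loc : L2_loc W.
Implicit Types (phi psi : E -> R) (f g h : L2 mu) (u v : L2 mu).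

Let mW : measurable_fun setT W. Proof. by case: W_loc. Qed.

(** Made total by [xget]; it is the class of [W f] when [f] lies in [dom_mul W]. *)
Definition mulW f : L2 mu := xget 0 [set g : L2 mu | {ae mu, forall x,
  g x = (W x)%:C * f x}].

Lemma mulW_ae f : dom_mul W f -> {ae mu, forall x, mulW f x = (W x)%:C * f x}.
Proof.
move=> /L2_exists[g gE]; rewrite /mulW.
by case: xgetP => [h _ //|/(_ g)].
Qed.

Lemma mulWE f g : {ae mu, forall x, g x = (W x)%:C * f x} -> dom_mul W f /\ mulW f = g.
Proof.
move=> gE; have ReW (x : E) : Re ((W x)%:C * f x) = W x * L2re f x.
  by rewrite /L2re; case: (f x) => a b /=; rewrite mul0r subr0.
have ImW (x : E) : Im ((W x)%:C * f x) = W x * L2im f x.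
  by rewrite /L2im; case: (f x) => a b /=; rewrite mul0r addr0.
have df : dom_mul W f.
  apply: (cLfun2_ae _ _ gE).
    under eq_fun do rewrite ReW; apply: measurable_funM => //;
      exact: Lfun2_measurable (L2reP f).
  under eq_fun do rewrite ImW; apply: measurable_funM => //;
    exact: Lfun2_measurable (L2imP f).
split=> //; apply/L2_eqP; near=> x.
by rewrite (near (mulW_ae df) x)// (near gE x).
Unshelve. all: by end_near.
Qed.

Lemma mulW_re f : dom_mul W f -> {ae mu, forall x, L2re (mulW f) x = W x * L2re f x}.
Proof.
move=> /mulW_ae; apply: filterS => x; rewrite /L2re => ->.
by case: (f x) => a b /=; rewrite mul0r subr0.
Qed.

Lemma mulW_im f : dom_mul W f -> {ae mu, forall x, L2im (mulW f) x = W x * L2im f x}.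
Proof.
move=> /mulW_ae; apply: filterS => x; rewrite /L2im => ->.
by case: (f x) => a b /=; rewrite mul0r addr0.
Qed.

Lemma dom_mulDZ a f g : dom_mul W f -> dom_mul W g ->
  dom_mul W (a *: f + g) /\ mulW (a *: f + g) = a *: mulW f + mulW g.
Proof.
move=> df dg; apply: mulWE; near=> x.
rewrite (near (L2_funDZ a (mulW f) (mulW g)) x)// (near (L2_funDZ a f g) x)//.
by rewrite (near (mulW_ae df) x)// (near (mulW_ae dg) x)// mulrDr mulrCA.
Unshelve. all: by end_near.
Qed.

Lemma L1loc_W (w : E -> R) : w \in L2r -> L1loc (fun x => W x * w x).
Proof. by move=> wL; apply: L1loc_mulL2loc => //; exact: L2_loc_box. Qed.

(** Against a test function, [W] is moved to the other side: [W phi] is in L2, so both pairings pass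
    to the limit, and the fundamental lemma gives [W f = g]. The parameter [part] treats real and
    imaginary parts at once. *)
Lemma mulW_closed (w : nat -> L2 mu) f g : (forall k, dom_mul W (w k)) ->
  hcvg H w f -> hcvg H (fun k => mulW (w k)) g ->
  dom_mul W f /\ mulW f = g.
Proof.
move=> dw wf wg; apply: mulWE.
have aux (part : L2 mu -> E -> R) :
    (forall h, part h \in L2r) ->
    (forall h, dom_mul W h -> {ae mu, forall x, part (mulW h) x = W x * part h x}) ->
    (forall s, s \in L2r -> (fun k => ip mu (part (w k)) s) @ \oo --> ip mu (part f)
      s) ->
    (forall s, s \in L2r -> (fun k => ip mu (part (mulW (w k))) s) @ \oo --> ip mu
      (part g) s) ->
    {ae mu, forall x, part g x = W x * part f x}.
  move=> pL pW wf' wg'; have lf := L1loc_W (pL f); have lg := L1loc_Lfun2 (pL g).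
  have l : L1loc (fun x => W x * part f x - part g x).
    split; first by apply: measurable_funB; [case: lf|case: lg].
    move=> M; have [_ /(_ M) i1] := lf; have [_ /(_ M) i2] := lg.
    exact: (integrableB (measurable_box M) i1 i2).
  have : {ae mu, forall x, W x * part f x - part g x = 0}.
    apply: ae_eq0_of_test => // phi tphi.
    have WpL := L2_loc_test W_loc tphi; have pL' := test_Lfun2 tphi.
    under eq_Rintegral do rewrite mulrBl.
    rewrite RintegralB//; last 2 first.
    - exact: L1loc_test lf tphi.
    - exact: L1loc_test lg tphi.
    apply/eqP; rewrite subr_eq0; apply/eqP.
    have -> : \int[mu]_x (W x * part f x * phi x) = ip mu (part f) (fun x =>
      W x * phi x).
      by apply: eq_Rintegral => x _; ring.
    have c1 := wf' _ WpL; have c2 := wg' _ pL'.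
    apply: (cvg_unique _ c1) => //.
    suff : (fun k => ip mu (part (w k)) (fun x =>
      W x * phi x)) @ \oo --> ip mu (part g) phi by [].
    have e k : ip mu (part (w k)) (fun x => W x * phi x) = ip mu (part (mulW (w k)))
      phi.
      have -> : ip mu (part (w k)) (fun x => W x * phi x) = ip mu (fun x =>
        W x * part (w k) x) phi.
        by apply: eq_Rintegral => x _; ring.
      apply: Rintegral_ae.
      - apply: measurable_funM; last exact: Lfun2_measurable pL'.
        by apply: measurable_funM => //; exact: Lfun2_measurable (pL _).
      - by apply: measurable_funM; [exact: Lfun2_measurable (pL _)|exact:
        Lfun2_measurable pL'].
      - by apply: filterS (pW _ (dw k)) => x ->.
    by under eq_fun do rewrite e.
  by apply: filterS => x /eqP; rewrite subr_eq0 => /eqP.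
have hr := aux (@L2re _ _ _ mu) (@L2reP _ _ _ mu) mulW_re (fun s sL =>
  (hcvg_L2_ip wf sL).1) (fun s sL => (hcvg_L2_ip wg sL).1).
have hi := aux (@L2im _ _ _ mu) (@L2imP _ _ _ mu) mulW_im (fun s sL =>
  (hcvg_L2_ip wf sL).2) (fun s sL => (hcvg_L2_ip wg sL).2).
near=> x; have := near hr x; have := near hi x; rewrite /L2re /L2im.
case: (g x) (f x) => [a b] [a' b'] /= -> // -> //.
by congr (_ +i* _); rewrite mul0r ?subr0 ?addr0.
Unshelve. all: by end_near.
Qed.

(** The index [None] stands for multiplication by [W], so that the energy space is a graph space
    over [option 'I_n]. *)
Definition gradient (j : option 'I_n) : L2 mu -> L2 mu :=
  if j is Some i then weak_partial i else mulW.

Local Notation cV := (carrier (W_space W)).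

Lemma energy_linsub : linsub cV.
Proof.
split=> [|a f g [Hf df] [Hg dg]].
  split; first by case: (H1_linsub R n).
  have [] := @mulWE 0 0 _ => //; near=> x.
  by rewrite (near (L2_fun0 R n) x)// mulr0.
split; first by have [_] := H1_linsub R n; apply.
by have [] := dom_mulDZ a df dg.
Unshelve. all: by end_near.
Qed.

Lemma gradient_lin j a f g : cV f -> cV g ->
  gradient j (a *: f + g) = a *: gradient j f + gradient j g.
Proof.
move=> [Hf df] [Hg dg]; case: j => [i|] /=; first exact: weak_partial_lin.
by have [] := dom_mulDZ a df dg.
Qed.

Lemma gradient_closed (w : nat -> L2 mu) f (g : option 'I_n -> L2 mu) :
  (forall k, cV (w k)) -> hcvg H w f ->
  (forall j, hcvg H (fun k => gradient j (w k)) (g j)) ->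
  cV f /\ forall j, gradient j f = g j.
Proof.
move=> Vw wf wg.
have dp i : represents (dpartial i (regular_dist f)) (g (Some i)).
  by apply: weak_partial_closed wf (wg (Some i)) => k; have [] := Vw k.
have [df fW] : dom_mul W f /\ mulW f = g None.
  by apply: mulW_closed wf (wg None) => k; have [] := Vw k.
split; first by split=> // i; exists (g (Some i)).
by case=> [i|] //=; exact: weak_partialE.
Qed.

Let cint f g : cintegral mu (fun x => f x * (g x)^*%C) = L2_inner f g.
Proof. by []. Qed.

(** [W_inner] has the sum over directions inside one integral and the factor [W^2] on one side;
    pulling out the sum and sharing [W] between [f] and [g] gives the graph form with constant 1. *)
Lemma W_innerE f g : cV f -> cV g -> W_inner W f g =
  1%:C * L2_inner f g + \sum_j L2_inner (gradient j f) (gradient j g).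
Proof.
move=> [Hf df] [Hg dg]; rewrite /W_inner cint mul1r addrC; congr (_ + _).
rewrite (bigD1 None)//= (reindex_omap Some id)/=; last by case.
rewrite addrC; congr (_ + _); last first.
  have e (x : E) : (W x ^+ 2)%:C * f x * (g x)^*%C =
      (W x ^+ 2 * (L2re f x * L2re g x + L2im f x * L2im g x)) +i*
      (W x ^+ 2 * (L2im f x * L2re g x - L2re f x * L2im g x)).
    rewrite /L2re /L2im; case: (f x) (g x) => [a b] [a' b'] /=.
    by apply/eqP; rewrite eq_complex /=; apply/andP; split; apply/eqP; ring.
  have [mfr mfi] := (Lfun2_measurable (L2reP f), Lfun2_measurable (L2imP f)).
  have [mgr mgi] := (Lfun2_measurable (L2reP g), Lfun2_measurable (L2imP g)).
  have mfr' := Lfun2_measurable (L2reP (mulW f));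
    have mfi' := Lfun2_measurable (L2imP (mulW f)).
  have mgr' := Lfun2_measurable (L2reP (mulW g));
    have mgi' := Lfun2_measurable (L2imP (mulW g)).
  have e' (x : E) : mulW f x * (mulW g x)^*%C =
      (L2re (mulW f) x * L2re (mulW g) x + L2im (mulW f) x * L2im (mulW g) x) +i*
      (L2im (mulW f) x * L2re (mulW g) x - L2re (mulW f) x * L2im (mulW g) x).
    rewrite /L2re /L2im; case: (mulW f x) (mulW g x) => [a b] [a' b'] /=.
    by apply/eqP; rewrite eq_complex /=; apply/andP; split; apply/eqP; ring.
  rewrite /L2_inner /cintegral; congr (_ +i* _).
    under eq_Rintegral do rewrite e /=; under [RHS]eq_Rintegral do rewrite e' /=.
    apply: Rintegral_ae.
    - by apply: measurable_funM; [exact: measurable_funX|apply: measurable_funD;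
      exact: measurable_funM].
    - by apply: measurable_funD; exact: measurable_funM.
    - near=> x; rewrite (near (mulW_re df) x)// (near (mulW_im df) x)//.
      by rewrite (near (mulW_re dg) x)// (near (mulW_im dg) x)//; ring.
  under eq_Rintegral do rewrite e /=; under [RHS]eq_Rintegral do rewrite e' /=.
  apply: Rintegral_ae.
  - by apply: measurable_funM; [exact: measurable_funX|apply: measurable_funB;
    exact: measurable_funM].
  - by apply: measurable_funB; exact: measurable_funM.
  - near=> x; rewrite (near (mulW_re df) x)// (near (mulW_im df) x)//.
    by rewrite (near (mulW_re dg) x)// (near (mulW_im dg) x)//; ring.
have e (x : E) : \sum_i weak_partial i f x * (weak_partial i g x)^*%C =
    (\sum_i (L2re (weak_partial i f) x * L2re (weak_partial i g) x +
             L2im (weak_partial i f) x * L2im (weak_partial i g) x)) +i*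
    (\sum_i (L2im (weak_partial i f) x * L2re (weak_partial i g) x -
             L2re (weak_partial i f) x * L2im (weak_partial i g) x)).
  elim/big_rec3: _ => [|i y1 y2 y3 _ ->] //.
  rewrite /L2re /L2im; case: (weak_partial i f x) (weak_partial i g x) =>
    [a b] [a' b'] /=.
  by apply/eqP; rewrite eq_complex /=; apply/andP; split; apply/eqP; ring.
have ii (s t : E -> R) : s \in L2r -> t \in L2r -> mu.-integrable setT (fun x =>
  (s x * t x)%:E).
  exact: integrable_mul.
have iD (a b : E -> R) : mu.-integrable setT (fun x =>
  (a x)%:E) -> mu.-integrable setT (fun x => (b x)%:E) ->
    mu.-integrable setT (fun x => (a x + b x)%:E).
  by move=> ai bi; exact: (integrableD measurableT ai bi).
have iB (a b : E -> R) : mu.-integrable setT (fun x =>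
  (a x)%:E) -> mu.-integrable setT (fun x => (b x)%:E) ->
    mu.-integrable setT (fun x => (a x - b x)%:E).
  by move=> ai bi; exact: (integrableB measurableT ai bi).
have pr i h := L2reP (weak_partial i h); have pi i h := L2imP (weak_partial i h).
have [_ eR] := Rintegral_sum (index_enum 'I_n) (fun i =>
  iD _ _ (ii _ _ (pr i f) (pr i g)) (ii _ _ (pi i f) (pi i g))).
have [_ eI] := Rintegral_sum (index_enum 'I_n) (fun i =>
  iB _ _ (ii _ _ (pi i f) (pr i g)) (ii _ _ (pr i f) (pi i g))).
have -> : cintegral mu (fun x => \sum_i weak_partial i f x * (weak_partial i g x)^*%C) =
    (\sum_i \int[mu]_x (L2re (weak_partial i f) x * L2re (weak_partial i g) x +
             L2im (weak_partial i f) x * L2im (weak_partial i g) x)) +i*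
    (\sum_i \int[mu]_x (L2im (weak_partial i f) x * L2re (weak_partial i g) x -
             L2re (weak_partial i f) x * L2im (weak_partial i g) x)).
  rewrite /cintegral -eR -eI; congr (_ +i* _); apply: eq_Rintegral => x _; by rewrite e.
rewrite (eq_bigl xpredT); last by move=> i; rewrite eqxx.
symmetry; elim/big_rec3: _ => [|i y1 y2 y3 _ ->] //.
rewrite L2_innerE /ip RintegralD ?RintegralB//; by [exact: ii].
Unshelve. all: by end_near.
Qed.

End energy_space.

(** * The Schroedinger operator *)

Section variational_solution.
Variables (R : realType) (n : nat) (W : 'rV[R]_n -> R).
Local Notation E := 'rV[R]_n.
Local Notation mu := (lebesgue_rV R n).
Local Notation L2r := (Lfun mu 2%:E).
Local Notation H := (L2_innerSpace mu).
Local Notation cV := (carrier (W_space W)).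
Hypothesis W_loc : L2_loc W.
Implicit Types (phi psi : E -> R) (f g h u v : L2 mu) (c : R).

Let mW : measurable_fun setT W. Proof. by case: W_loc. Qed.

Lemma L1loc_comb (a b : R) (s t w : E -> R) : L1loc s -> L1loc t -> L1loc w ->
  L1loc (fun x => a * s x + b * t x + w x).
Proof.
move=> [ms si] [mt ti] [mw wi]; split.
  by apply: measurable_funD => //; apply: measurable_funD; apply: measurable_funM.
move=> M; have mb := @measurable_box R n M.
exact: (integrableD mb (integrableD mb (integrableZl mb a (si M)) (integrableZl mb b
  (ti M))) (wi M)).
Qed.

Lemma cL1locDZ a (u v : E -> R[i]) : cL1loc u -> cL1loc v -> cL1loc (fun x =>
  a * u x + v x).
Proof.
move=> [ur ui] [vr vi]; split.
  have -> : (fun x => Re (a * u x + v x)) =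
      (fun x => Re a * Re (u x) + (- Im a) * Im (u x) + Re (v x)).
    by apply/funext => x; case: a (u x) (v x) => [? ?] [? ?] [? ?] /=; rewrite mulNr.
  exact: L1loc_comb.
have -> : (fun x => Im (a * u x + v x)) =
    (fun x => Re a * Im (u x) + Im a * Re (u x) + Im (v x)).
  by apply/funext => x; case: a (u x) (v x) => [? ?] [? ?] [? ?].
exact: L1loc_comb.
Qed.

Lemma ReC (a : R) (z : R[i]) : Re (a%:C * z) = a * Re z.
Proof. by case: z => x y /=; rewrite mul0r subr0. Qed.

Lemma ImC (a : R) (z : R[i]) : Im (a%:C * z) = a * Im z.
Proof. by case: z => x y /=; rewrite mul0r addr0. Qed.

Lemma cL1loc_L2 f : cL1loc f.
Proof. by split; apply: L1loc_Lfun2; [exact: L2reP|exact: L2imP]. Qed.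

Lemma cL1loc_W f : cL1loc (fun x => (W x)%:C * f x).
Proof.
split.
  by under eq_fun do rewrite ReC; apply: L1loc_W => //; exact: L2reP.
by under eq_fun do rewrite ImC; apply: L1loc_W => //; exact: L2imP.
Qed.

Lemma dom_mul_re f : dom_mul W f -> (fun x => W x * L2re f x) \in L2r.
Proof.
rewrite /dom_mul /= cLfun2E => /andP[+ _].
by rewrite (_ : _ \o _ = (fun x => W x * L2re f x))//; apply/funext => x;
  rewrite /= ReC.
Qed.

Lemma dom_mul_im f : dom_mul W f -> (fun x => W x * L2im f x) \in L2r.
Proof.
rewrite /dom_mul /= cLfun2E => /andP[_ +].
by rewrite (_ : _ \o _ = (fun x => W x * L2im f x))//; apply/funext => x;
  rewrite /= ImC.
Qed.

Lemma cL1loc_W2 f : dom_mul W f -> cL1loc (fun x => (W x ^+ 2)%:C * f x).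
Proof.
move=> df; split.
  under eq_fun do rewrite ReC expr2 -mulrA.
  by apply: L1loc_W => //; exact: dom_mul_re.
under eq_fun do rewrite ImC expr2 -mulrA.
by apply: L1loc_W => //; exact: dom_mul_im.
Qed.

(** One factor [W] goes to each side, which turns the pairing with a locally integrable function
    into a pairing of two L2 functions. *)
Lemma dist_W2 f phi : dom_mul W f -> test_function phi ->
  regular_dist (fun x => (W x ^+ 2)%:C * f x) phi =
  regular_dist (mulW W f) (fun x => W x * phi x).
Proof.
move=> df tphi; have mp := smooth_measurable (proj1 tphi).
have mWp : measurable_fun setT (fun x => W x * phi x) by exact: measurable_funM.
rewrite !regular_distE; congr (_ +i* _); apply: Rintegral_ae.
- apply: measurable_funM => //; under eq_fun do rewrite ReC.
  apply: measurable_funM; [exact: measurable_funX|exact: Lfun2_measurable (L2reP f)].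
- apply: measurable_funM => //; exact: Lfun2_measurable (L2reP _).
- by apply: filterS (mulW_re df) => x; rewrite /L2re => ->; rewrite ReC; ring.
- apply: measurable_funM => //; under eq_fun do rewrite ImC.
  apply: measurable_funM; [exact: measurable_funX|exact: Lfun2_measurable (L2imP f)].
- apply: measurable_funM => //; exact: Lfun2_measurable (L2imP _).
- by apply: filterS (mulW_im df) => x; rewrite /L2im => ->; rewrite ImC; ring.
Qed.

Lemma regular_distZ a (u : E -> R[i]) phi : cL1loc u -> test_function phi ->
  regular_dist (fun x => a * u x) phi = a * regular_dist u phi.
Proof.
move=> ul tphi; have zl : cL1loc (fun _ : E => 0 : R[i]).
  by split; exact: (L1loc_cst n 0).
have := regular_distDZ a ul zl tphi; under eq_fun do rewrite addr0.
move=> ->; rewrite [X in _ + X](_ : _ = 0) ?addr0// regular_distE /ip.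
by rewrite /Rintegral integral0_eq// => x _; rewrite mul0r.
Qed.

Lemma dist_W f phi : dom_mul W f -> test_function phi ->
  regular_dist (fun x => (W x)%:C * f x) phi = regular_dist (mulW W f) phi.
Proof.
move=> df tphi; apply: represents_ae tphi.
- under eq_fun do rewrite ReC; apply: measurable_funM => //.
  exact: Lfun2_measurable (L2reP f).
- under eq_fun do rewrite ImC; apply: measurable_funM => //.
  exact: Lfun2_measurable (L2imP f).
- exact: mulW_ae.
Qed.

(** The mass term is a parameter: [m ^+ 2] for the operator itself, 1 for density, 0 where only the
    domain matters. *)
Definition schroedinger c u : @Distribution R n := - laplacian (regular_dist u)
  + c%:C *: regular_dist u + regular_dist (fun x => (W x ^+ 2)%:C * u x).

Definition gradient_pairing u phi : R[i] :=
  \sum_i regular_dist (weak_partial i u) (partial i phi).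

Lemma gradient_pairing_lin a u v phi : @H1 R n u -> @H1 R n v -> test_function phi ->
  gradient_pairing (a *: u + v) phi = a * gradient_pairing u phi + gradient_pairing v
    phi.
Proof.
move=> Hu Hv tphi; rewrite /gradient_pairing mulr_sumr -big_split.
apply: eq_bigr => i _.
by rewrite weak_partial_lin// L2_dist_lin//; exact/test_Lfun2/test_function_partial.
Qed.

Lemma laplacianE u phi : @H1 R n u -> test_function phi ->
  laplacian (regular_dist u) phi =
  - gradient_pairing u phi.
Proof.
move=> Hu tphi; rewrite -sumrN.
transitivity (\sum_i dpartial i (dpartial i (regular_dist u)) phi).
  rewrite /laplacian; apply: (big_morph (fun T : @Distribution R n => T phi)) => //.
apply: eq_bigr => i _; rewrite {1}/dpartial; congr (- _).
by rewrite (weak_partialP i Hu)//; exact: test_function_partial.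
Qed.

Lemma schroedingerE c u phi : cV u -> test_function phi -> schroedinger c u phi =
  gradient_pairing u phi + c%:C * regular_dist u phi + regular_dist (mulW W u) (fun x
    => W x * phi x).
Proof.
move=> [Hu du] tphi; rewrite -dist_W2//.
by rewrite -[LHS]/(- laplacian (regular_dist u) phi + c%:C * regular_dist u phi + _)
  laplacianE// opprK.
Qed.

Lemma schroedingerDZ c a u v phi : cV u -> cV v -> test_function phi ->
  schroedinger c (a *: u + v) phi = a * schroedinger c u phi + schroedinger c v phi.
Proof.
move=> cu cv tphi; have cS := energy_linsub W_loc.
have [[Hu du] [Hv dv]] := (cu, cv).
rewrite !schroedingerE//; last exact: cS.2.
have [_ ->] := dom_mulDZ W_loc a du dv.
rewrite !L2_dist_lin; [|exact: L2_loc_test|exact: test_Lfun2].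
rewrite gradient_pairing_lin//.
have aux (s s' b r r' w w' : R[i]) :
  (a * s + s') + b * (a * r + r') + (a * w + w') = a * (s + b * r + w) + (s' + b * r'
    + w').
  by ring.
exact: aux.
Qed.

Lemma schroedinger_represents c a u v f g : cV u -> cV v ->
  represents (schroedinger c u) f -> represents (schroedinger c v) g ->
  represents (schroedinger c (a *: u + v)) (a *: f + g).
Proof.
move=> cu cv uf vg phi tphi; rewrite schroedingerDZ// uf// vg// L2_dist_lin//.
exact: test_Lfun2.
Qed.

(** [c u] is in L2, so the domain is the same for every mass. *)
Lemma dom_S0P c u : dom_S0 W u <-> cV u /\ in_L2 (schroedinger c u).
Proof.
have e phi : schroedinger c u phi = c%:C * regular_dist u phi
    - (laplacian (regular_dist u) - regular_dist (fun x => (W x ^+ 2)%:C * u x)) phi.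
  have aux (x y z : R[i]) : - x + y + z = y - (x - z) by ring.
  exact: (aux (laplacian (regular_dist u) phi) (c%:C * regular_dist u phi)
    (regular_dist (fun x => (W x ^+ 2)%:C * u x) phi)).
split=> [[cu [h hE]]|[cu [f fE]]]; split=> //.
  exists (c%:C *: u + (-1) *: h) => phi tphi; have pL := test_Lfun2 tphi.
  by rewrite e hE// L2_dist_lin// L2_distZ// mulN1r.
exists (c%:C *: u + (-1) *: f) => phi tphi; have pL := test_Lfun2 tphi.
rewrite L2_dist_lin// L2_distZ// -fE// e.
have aux (x y : R[i]) : y = x + -1 * (x - y) by ring.
exact: aux.
Qed.

Definition qform (part : L2 mu -> E -> R) c u phi :=
  \sum_i ip mu (part (weak_partial i u)) (partial i phi)
  + ip mu (part (mulW W u)) (fun x => W x * phi x) + c * ip mu (part u) phi.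

Lemma schroedinger_qform c u phi : cV u -> test_function phi ->
  schroedinger c u phi =
  qform (@L2re _ _ _ mu) c u phi +i* qform (@L2im _ _ _ mu) c u phi.
Proof.
move=> cu tphi; rewrite schroedingerE// /qform.
have -> : gradient_pairing u phi =
    (\sum_i ip mu (L2re (weak_partial i u)) (partial i phi)) +i*
    (\sum_i ip mu (L2im (weak_partial i u)) (partial i phi)).
  by rewrite /gradient_pairing; elim/big_rec3: _ => [|i y1 y2 y3 _ ->] //;
    rewrite L2_distE.
rewrite !L2_distE; apply/eqP; rewrite eq_complex /=; apply/andP; split; apply/eqP; ring.
Qed.

(** [m] and [W] are real, so both components of [u] solve the real weak equation and
    [weak_uniqueness] applies to each. *)
Lemma schroedinger_inj (m : R) u : 0 < m -> cV u ->
  (forall phi, test_function phi -> schroedinger (m ^+ 2) u phi = 0) -> u = 0.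
Proof.
move=> m0 cu u0; have [Hu du] := cu.
have wd i := iffLR (dpartialP i _ _) (weak_partialP i Hu).
have mWp phi : test_function phi -> (fun x =>
  W x * phi x) \in L2r by exact: L2_loc_test.
have hr : {ae mu, forall x, L2re u x = 0}.
  apply: (weak_uniqueness m0 W_loc (L2reP u) (fun i =>
    L2reP (weak_partial i u)) (dom_mul_re du)).
    by move=> i; have [] := wd i.
  move=> phi tphi; have := u0 phi tphi; rewrite schroedinger_qform// => -[+ _].
  rewrite /qform (ip_ae (L2reP (mulW W u)) (dom_mul_re du) (mWp _ tphi) (mWp _ tphi))
    //.
  - exact: mulW_re.
  - exact: nearW.
have hi : {ae mu, forall x, L2im u x = 0}.
  apply: (weak_uniqueness m0 W_loc (L2imP u) (fun i =>
    L2imP (weak_partial i u)) (dom_mul_im du)).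
    by move=> i; have [] := wd i.
  move=> phi tphi; have := u0 phi tphi; rewrite schroedinger_qform// => -[_ +].
  rewrite /qform (ip_ae (L2imP (mulW W u)) (dom_mul_im du) (mWp _ tphi) (mWp _ tphi))
    //.
  - exact: mulW_im.
  - exact: nearW.
apply/L2_eqP; near=> x; rewrite (near (L2_fun0 R n) x)//.
have := near hr x; have := near hi x; rewrite /L2re /L2im.
by case: (u x) => a b /= -> // -> //.
Unshelve. all: by end_near.
Qed.

Definition energy_form c f g : R[i] :=
  c%:C * L2_inner f g + \sum_j L2_inner (gradient W j f) (gradient W j g).

Local Notation HH := (@L2_preHilbert _ _ _ mu).
Local Notation cplH := (@L2_complete _ _ _ mu).

Definition energy_space c : innerSpace R := @InnerSpace R (L2 mu) cV (energy_form c).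

Lemma energy_rin c u v : cV u -> cV v -> rin (energy_space c) u v =
  c * rin H u v + \sum_j rin H (gradient W j u) (gradient W j v).
Proof. by move=> cu cv; apply: (graph_rin (cV := cV)). Qed.

Lemma W_space_rin u v : cV u -> cV v -> rin (W_space W) u v = rin (energy_space 1) u v.
Proof.
move=> cu cv; rewrite energy_rin//.
exact: (graph_rin (cV := cV) (iV := W_inner W) (T := gradient W) (W_innerE W_loc) cu
  cv).
Qed.

Lemma W_space_preHilbert : preHilbert (W_space W).
Proof.
exact: (graph_preHilbert HH ltr01 (energy_linsub W_loc) (gradient_lin W_loc)
  (W_innerE W_loc)).
Qed.

Lemma W_space_complete : hcomplete (W_space W).
Proof.
exact: (graph_complete HH cplH ltr01 (energy_linsub W_loc) (gradient_lin W_loc)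
  (gradient_closed W_loc) (W_innerE W_loc)).
Qed.

Lemma test_energy phi psi v : test_function phi -> test_function psi ->
  {ae mu, forall x, v x = phi x +i* psi x} ->
  [/\ cV v, forall i, {ae mu, forall x, weak_partial i v x = partial i phi x +i*
    partial i psi x} &
    {ae mu, forall x, mulW W v x = (W x * phi x) +i* (W x * psi x)}].
Proof.
move=> tphi tpsi vE.
have /choice[g gE] i : exists g : L2 mu,
    {ae mu, forall x, g x = partial i phi x +i* partial i psi x}.
  by apply: L2_exists_pair; exact/test_Lfun2/test_function_partial.
have dg i := test_dpartial (i := i) tphi tpsi vE (gE i).
have [k kE] := L2_exists_pair (L2_loc_test W_loc tphi) (L2_loc_test W_loc tpsi).
have [dv kW] : dom_mul W v /\ mulW W v = k.
  apply: mulWE => //; near=> x; rewrite (near kE x)// (near vE x)//.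
  by congr (_ +i* _); rewrite mul0r ?subr0 ?addr0.
split; first by split=> // i; exists (g i).
- by move=> i; rewrite (weak_partialE (dg i)).
- by rewrite kW.
Unshelve. all: by end_near.
Qed.

Lemma test_L2_energy : test_L2 (R := R) (n := n) `<=` cV.
Proof. by move=> v [phi [psi [tphi tpsi vE]]]; have [] := test_energy tphi tpsi vE. Qed.

Lemma qform0 part c u : qform part c u (fun=> 0) = 0.
Proof.
have ip0 (w : E -> R) : ip mu w (fun=> 0) = 0.
  by rewrite /ip /Rintegral integral0_eq// => x _; rewrite mulr0.
have d0 i : partial i (fun _ : E => 0 : R) = fun=> 0.
  by apply/funext => x; exact: derive_cst.
rewrite /qform ip0 mulr0 addr0; under [X in ip _ _ X]eq_fun do rewrite mulr0.
by rewrite ip0 addr0 big1// => i _; rewrite d0 ip0.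
Qed.

Lemma energy_rin_test c u v phi psi : cV u -> test_function phi -> test_function psi ->
  {ae mu, forall x, v x = phi x +i* psi x} ->
  rin (energy_space c) u v =
  qform (@L2re _ _ _ mu) c u phi + qform (@L2im _ _ _ mu) c u psi.
Proof.
move=> cu tphi tpsi vE; have [cv dv Wv] := test_energy tphi tpsi vE.
rewrite energy_rin// (bigD1 None)//= (reindex_omap Some id)/=; last by case.
rewrite (eq_bigl xpredT); last by move=> i; rewrite eqxx.
rewrite (rin_L2_pair u (test_Lfun2 tphi) (test_Lfun2 tpsi) vE).
rewrite (rin_L2_pair (mulW W u) (L2_loc_test W_loc tphi) (L2_loc_test W_loc tpsi) Wv).
rewrite (eq_bigr (fun i => ip mu (L2re (weak_partial i u)) (partial i phi) +
    ip mu (L2im (weak_partial i u)) (partial i psi))); last first.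
  move=> i _; apply: rin_L2_pair (dv i); exact/test_Lfun2/test_function_partial.
rewrite big_split/= /qform.
have aux (x y w w' s s' : R) :
  c * (x + y) + ((w + w') + (s + s')) = (s + w + c * x) + (s' + w' + c * y) by ring.
exact: aux.
Qed.

(** The Riesz solution, tested with [phi] and with ['i phi], yields the two components of the
    equation between distributions. *)
Lemma energy_riesz c f : 0 < c -> exists u, [/\ cV u,
  forall v, cV v -> rin (energy_space c) u v = rin H f v &
  represents (schroedinger c u) f].
Proof.
move=> c0; have [u cu uE] := graph_riesz HH cplH c0 (energy_linsub W_loc)
  (gradient_lin W_loc) (gradient_closed W_loc) (iV := energy_form c) (fun _ _ _ _ =>
    erefl) f.
exists u; split=> // phi tphi; rewrite schroedinger_qform// L2_distE.
have pL := test_Lfun2 tphi; have zL := Lfun2_0 mu; have t0 := @test_function0 R n.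
have ip0 (w : E -> R) : ip mu w (fun=> 0) = 0.
  by rewrite /ip /Rintegral integral0_eq// => x _; rewrite mulr0.
congr (_ +i* _).
  have [v vE] := L2_exists_pair pL zL; have [cv _ _] := test_energy tphi t0 vE.
  have := uE v cv; rewrite -/(energy_space c) (energy_rin_test c cu tphi t0 vE)
    (rin_L2_pair f pL zL vE).
  by rewrite qform0 ip0 !addr0.
have [v vE] := L2_exists_pair zL pL; have [cv _ _] := test_energy t0 tphi vE.
have := uE v cv; rewrite -/(energy_space c) (energy_rin_test c cu t0 tphi vE)
  (rin_L2_pair f zL pL vE).
by rewrite qform0 ip0 !add0r.
Qed.

Lemma dom_S0_linsub : linsub (dom_S0 W).
Proof.
have cS := energy_linsub W_loc; split.
  (* The mass 0 is an arbitrary choice, the domain being the same for all. *)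
  apply/(dom_S0P 0); split; first exact: cS.1.
  exists 0 => phi tphi; rewrite L2_dist0; last exact: test_Lfun2.
  have := schroedingerDZ 0 (-1) cS.1 cS.1 tphi; rewrite scaler0 addr0 mulN1r addNr.
  by [].
move=> a u v /(dom_S0P 0)[cu [f uf]] /(dom_S0P 0)[cv [g vg]]; apply/(dom_S0P 0).
split; first exact: cS.2.
by exists (a *: f + g); exact: schroedinger_represents.
Qed.

Section positive_mass.
Variable m : R.
Hypothesis m_gt0 : 0 < m.

Definition schroedinger_op u : L2 mu := dist_L2 (schroedinger (m ^+ 2) u).

Lemma schroedinger_opP u : dom_S0 W u -> represents (schroedinger (m ^+ 2) u)
  (schroedinger_op u).
Proof. by move=> /(dom_S0P (m ^+ 2))[_]; exact: dist_L2P. Qed.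

Lemma schroedinger_op_lin a u v : dom_S0 W u -> dom_S0 W v ->
  schroedinger_op (a *: u + v) = a *: schroedinger_op u + schroedinger_op v.
Proof.
move=> Du Dv; apply: dist_L2E; apply: schroedinger_represents.
- by case: Du. - by case: Dv. - exact: schroedinger_opP. - exact: schroedinger_opP.
Qed.

Let m2_gt0 : 0 < m ^+ 2. Proof. exact: exprn_gt0. Qed.

Lemma schroedinger_op_surj f : exists2 u, dom_S0 W u & schroedinger_op u = f.
Proof.
have [u [cu _ uf]] := energy_riesz f m2_gt0.
by exists u; [apply/(dom_S0P (m ^+ 2)); split=> //; exists f|exact: dist_L2E].
Qed.

(** The Riesz solution [w] with the same right side differs from [u] by a solution of the
    homogeneous equation, which is zero. The identity is thus available for all [v] in the energy
    space, not for test functions alone. *)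
Lemma energy_schroedinger_op u v : dom_S0 W u -> cV v ->
  rin (energy_space (m ^+ 2)) u v = rin H (schroedinger_op u) v.
Proof.
move=> Du cv; have [w [cw wE wf]] := energy_riesz (schroedinger_op u) m2_gt0.
have [cu _] := Du; suff uw : u = w by rewrite {1}uw; exact: wE.
have cS := energy_linsub W_loc.
apply/eqP; rewrite -subr_eq0 addrC -scaleN1r; apply/eqP.
apply: (schroedinger_inj m_gt0); first exact: cS.2.
by move=> phi tphi; rewrite schroedingerDZ// wf// -schroedinger_opP// mulN1r addNr.
Qed.

(** The constant compares the forms with masses [m ^+ 2] and 1 term by term. *)
Lemma schroedinger_op_ge u : dom_S0 W u ->
  Num.min 1 (m ^+ 2) * rin (W_space W) u u <= rin H (schroedinger_op u) u.
Proof.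
move=> Du; have [cu _] := Du; rewrite -energy_schroedinger_op// W_space_rin//
  !energy_rin// mul1r.
have r0 x : 0 <= rin H x x by exact: (inner_ge0 HH).
rewrite mulrDr; apply: lerD; first by rewrite ler_wpM2r// ge_min lexx orbT.
by rewrite ler_piMl ?sumr_ge0// ge_min lexx.
Qed.

Lemma A0_act u v : dom_S0 W u -> cV v ->
  A0 m W (u, v) = (v, schroedinger_op u + (2 * 'i) *: mulW W v).
Proof.
move=> Du [_ dv]; congr pair; apply: dist_L2E.
have := schroedinger_opP Du => uL phi tphi; have pL := test_Lfun2 tphi.
rewrite -[LHS]/(schroedinger (m ^+ 2) u phi +
  regular_dist (fun x => 2 * 'i%C * (W x)%:C * v x) phi) uL// [RHS]/=.
have -> : schroedinger_op u + (2 * 'i) *: mulW W v = (2 * 'i) *: mulW W v +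
  schroedinger_op u by rewrite addrC.
rewrite L2_dist_lin// addrC; congr (_ + _).
by under eq_fun do rewrite -mulrA; rewrite regular_distZ ?dist_W//; exact: cL1loc_W.
Qed.

(** The expansion [(W + i l)^2 = W^2 + 2 i l W - l^2], each term being a distribution on its own by
    local integrability. *)
Lemma S0_act l u : dom_S0 W u ->
  S0 m W l u = l^-1 *: (schroedinger_op u + (2 * 'i * l) *: mulW W u - l ^+ 2 *: u).
Proof.
move=> Du; have [[_ du] _] := Du; apply: dist_L2E.
have := schroedinger_opP Du => uL phi tphi; have pL := test_Lfun2 tphi.
have e : regular_dist (fun x => ((W x)%:C + l * 'i%C) ^+ 2 * u x) phi =
    (2 * 'i * l) * regular_dist (mulW W u) phi +
    (- l ^+ 2 * regular_dist u phi + regular_dist (fun x => (W x ^+ 2)%:C * u x) phi).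
  have -> : (fun x => ((W x)%:C + l * 'i%C) ^+ 2 * u x) = (fun x =>
    (2 * 'i * l) * ((W x)%:C * u x) +
      (- l ^+ 2 * u x + (W x ^+ 2)%:C * u x)).
    apply/funext => x; rewrite rmorphXn /=; have i2 := sqrCi R[i].
    by rewrite complexiE; ring: i2.
  have w2 := cL1loc_W2 du; have ul := cL1loc_L2 u; have wl := cL1loc_W u.
  rewrite regular_distDZ//; last exact: cL1locDZ.
  by rewrite regular_distDZ// dist_W.
have -> : schroedinger_op u + (2 * 'i * l) *: mulW W u - l ^+ 2 *: u =
    (2 * 'i * l) *: mulW W u + ((- l ^+ 2) *: u + schroedinger_op u).
  by rewrite scaleNr addrC [schroedinger_op u + _]addrC addrA [in RHS]addrA [X in X +
    _ = _]addrC.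
rewrite L2_distZ// !L2_dist_lin//.
have u' := uL phi tphi; rewrite -u'.
rewrite -[LHS]/(l^-1 * (- laplacian (regular_dist u) phi + (m ^+ 2)%:C * regular_dist
  u phi
  + regular_dist (fun x => ((W x)%:C + l * 'i%C) ^+ 2 * u x) phi)) e.
have aux (x y z w q b : R[i]) : x + y + (w + (q + z)) = w + (q + (x + y + z)) by ring.
congr (_ * _); exact: aux.
Qed.

End positive_mass.

Lemma dom_S0_dense : hdense (W_space W) (dom_S0 W).
Proof.
have HV := W_space_preHilbert.
apply: (dense_of_trivial_orthogonal HV W_space_complete dom_S0_linsub) =>
  [u []//|x cx x0].
have [y Dy yx] := schroedinger_op_surj ltr01 x; have [cy _] := Dy.
apply: (inner_def HH) => //; rewrite -/(rin H x x) -{1}yx -energy_schroedinger_op//.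
by rewrite expr1n -W_space_rin// (rinC HV)// x0.
Qed.

(** Test functions lie in the energy space, because [W phi] is in L2, and they are dense in L2. *)
Lemma W_space_dense : hdense H cV.
Proof.
have [_ dH] := test_L2_dense R n; split=> // f cf e e0.
by have [y /test_L2_energy cy ye] := dH f cf e e0; exists y.
Qed.

End variational_solution.

Theorem theorem7p1 (R : realType) (n : nat) (n_gt0 : (0 < n)%N)
    (m : R) (m_gt0 : 0 < m) (W : 'rV[R]_n -> R) (W_loc : L2_loc W) :
  [/\ closed_operator (A0 m W),
      resolvent_set (A0 m W) 0,
      hdense (direct_sum (W_space W) (W_space W)) (dom (A0 m W))
    & hdense (direct_sum (W_space W) (L2_space R n)) (dom (A0 m W))] /\
  [/\ spectrum _ (A0 m W) = family_spectrum (@spectrum R) (S0 m W),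
      point_spectrum _ (A0 m W) = family_spectrum (@point_spectrum R) (S0 m W)
    & essential_spectrum2 _ (A0 m W)
      = family_spectrum (@essential_spectrum2 R) (S0 m W)].
Proof.
have HH := @L2_preHilbert _ _ _ (lebesgue_rV R n).
have HV := W_space_preHilbert W_loc.
have VH (u : L2 (lebesgue_rV R n)) : carrier (W_space W) u ->
    hnorm (L2_innerSpace (lebesgue_rV R n)) u <= hnorm (W_space W) u.
  move=> cu; have := graph_hnorm_ge HH ltr01 (energy_linsub W_loc)
    (gradient_lin W_loc) (W_innerE W_loc) cu.
  by rewrite mul1r ler_pXn2r// nnegrE hnorm_ge0.
have DS := dom_S0_linsub W_loc.
have DV : dom_S0 W `<=` carrier (W_space W) by move=> u [].
have Llin := schroedinger_op_lin W_loc m.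
have Mlin a u v : carrier (W_space W) u -> carrier (W_space W) v ->
    mulW W (a *: u + v) = a *: mulW W u + mulW W v.
  exact: (gradient_lin W_loc None).
have Mle u : carrier (W_space W) u ->
    hnorm (L2_innerSpace (lebesgue_rV R n)) (mulW W u) <= hnorm (W_space W) u.
  exact: (graph_hnorm_T HH ltr01 (energy_linsub W_loc) (gradient_lin W_loc) (W_innerE W_loc) None).
have Lsurj := schroedinger_op_surj W_loc m_gt0.
have cL0 : 0 < Num.min 1 (m ^+ 2) by rewrite lt_min ltr01 exprn_gt0.
have Lge := schroedinger_op_ge W_loc m_gt0.
have Aact := A0_act W_loc m.
have Sact := S0_act W_loc m.
have dD := dom_S0_dense W_loc.
(* [L2_space] and [L2_innerSpace] are convertible, so the abstract results on the pencil apply to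
   these data, with the hypotheses on domains holding by [erefl]. *)
pose mu := lebesgue_rV R n; pose cV := carrier (W_space W).
pose iV := W_inner W; pose iH := @L2_inner _ _ _ mu.
split; split.
- exact: (@A_closed R (L2 mu) cV iV iH HV HH VH (dom_S0 W) DS DV (schroedinger_op W m) (mulW W) Llin Mlin Mle Lsurj _ cL0 Lge (A0 m W) erefl Aact).
- exact: (@resolventA0 R (L2 mu) cV iV iH HV HH VH (dom_S0 W) DS DV (schroedinger_op W m) (mulW W) Llin Mlin Mle Lsurj _ cL0 Lge (A0 m W) erefl Aact).
(* The second factor of the domain is the whole energy space, dense in itself. *)
- apply: hdense_direct_sum => //; split=> // u cu e e0; exists u => //.
  by rewrite subrr ihnorm0.
- apply: hdense_direct_sum => //; exact: W_space_dense.
- exact: (@spectrumE R (L2 mu) cV iV iH HV HH VH (dom_S0 W) DS DV (schroedinger_op W m) (mulW W) Llin Mlin Mle Lsurj _ cL0 Lge (A0 m W) (S0 m W) erefl Aact (fun=> erefl) Sact).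
- exact: (@point_spectrumE R (L2 mu) cV iV iH HV HH VH (dom_S0 W) DV (schroedinger_op W m) (mulW W) Mlin Lsurj _ cL0 Lge (A0 m W) (S0 m W) erefl Aact (fun=> erefl) Sact).
- exact: (@essential_spectrumE R (L2 mu) cV iV iH HV HH (W_space_complete W_loc) VH (dom_S0 W) DS DV (schroedinger_op W m) (mulW W) Llin Mlin Mle Lsurj _ cL0 Lge (A0 m W) (S0 m W) erefl Aact (fun=> erefl) Sact).
Qed.
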